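(* Let $\mathscr{F}$ be a family of analytic functions on a domain $D$, and let $k\ge 1$, $q_0\ge 3$, $q_i\ge 0$ $(i=1,2,\ldots,k-1)$, $q_k\ge 1$ be integers. Suppose that for each $f\in\mathscr{F}$: (i) $f$ has only zeros of multiplicity at least $k$; (ii) $f^{q_0}(f')^{q_1}\cdots(f^{(k)})^{q_k}\ne 1$ at every point of $D$. Then $\mathscr{F}$ is normal on $D$.
   Context: Here $D\subset\overline{\mathbb{C}}$ is a domain. A family $\mathscr{F}$ of analytic functions in $D$ is normal if every sequence $\{f_n\}\subset\mathscr{F}$ has a subsequence which converges locally uniformly in $D$ with respect to the spherical metric, to an analytic function or to $\infty$. *)

(* Defs.v *)
From mathcomp Require Import all_boot all_order all_algebra.
From mathcomp Require Import all_classical all_reals all_analysis.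
From mathcomp Require Import complex.

Set Implicit Arguments.
Unset Strict Implicit.
Unset Printing Implicit Defensive.

Import Order.TTheory GRing.Theory Num.Theory.
Import numFieldNormedType.Exports.

Local Open Scope classical_set_scope.
Local Open Scope ring_scope.

(* The alias R[i]^o is what carries the topology and the C-normed module
   structure, so that derivable and derive1n below are complex derivatives. *)
Definition Cplx (R : realType) := R[i]^o.

(* The extended plane: Some z is the finite point z, None is infinity. *)
Definition sphere (R : realType) := one_point_compactification (Cplx R).

Section Sphere.
Variable R : realType.
Local Notation C := (Cplx R).
Local Notation S := (sphere R).

Definition is_domain (D : set S) : Prop :=
  [/\ open D, connected D & D !=set0].

Definition cmod (z : C) : R := ComplexField.Normc.normc z.

Definition chordal (a b : S) : R :=
  match a, b with
  | Some z, Some w => cmod (z - w) /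
      (Num.sqrt (1 + cmod z ^+ 2) * Num.sqrt (1 + cmod w ^+ 2))
  | Some z, None | None, Some z => (Num.sqrt (1 + cmod z ^+ 2))^-1
  | None, None => 0
  end.

(* Geodesic distance for the metric 2|dz| / (1 + |z|^2): on the unit sphere,
   the chord joining the images of a and b has length 2 * chordal a b. *)
Definition spherical_dist (a b : S) : R := 2 * asin (chordal a b).

(* The coordinate w = 1/z at infinity. *)
Definition sphere_inv (w : C) : S := if w == 0 then None else Some w^-1.

(* The expression of f near p in a local coordinate (z at finite points, 1/z at
   infinity), and the value of that coordinate at p. *)
Definition in_chart (f : S -> C) (p : S) : C -> C :=
  if p is Some _ then fun z => f (Some z) else fun w => f (sphere_inv w).
Definition chart_pt (p : S) : C := if p is Some z then z else 0.

Definition analytic_on (D : set S) (f : S -> C) : Prop :=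
  forall p, D p -> derivable (in_chart f p) (chart_pt p) 1.

(* The n-th derivative of f with respect to z. At infinity it is the limit of
   the n-th derivative at finite points (for f analytic at infinity, this limit
   exists and makes the n-th derivative analytic there). *)
Definition sderiv (n : nat) (f : S -> C) (p : S) : C :=
  let g := derive1n n (fun z : C => f (Some z)) in
  match n, p with
  | 0, _ => f p
  | _, Some z => g z
  | _, None => lim (g w^-1 @[w --> (0 : C)^'])
  end.

(* h has a zero of multiplicity exactly m at a; the zero function thus has no
   finite multiplicity at any point. *)
Definition zero_multiplicity (h : C -> C) (a : C) (m : nat) : Prop :=
  (0 < m)%N /\ exists g : C -> C,
    [/\ \forall z \near a, derivable g z 1, g a != 0 &
        \forall z \near a, h z = (z - a) ^+ m * g z].

Definition zeros_mult_ge (D : set S) (f : S -> C) (k : nat) : Prop :=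
  forall p m, D p -> zero_multiplicity (in_chart f p) (chart_pt p) m ->
    (k <= m)%N.

Definition diff_monomial (k : nat) (q : nat -> nat) (f : S -> C) (p : S) : C :=
  \prod_(0 <= i < k.+1) sderiv i f p ^+ q i.

Definition cvg_locally_spherically (D : set S) (u : nat -> S -> S)
    (g : S -> S) : Prop :=
  forall p, D p -> exists2 U, nbhs p U &
    forall e : R, 0 < e -> exists N : nat, forall n, (N <= n)%N ->
      forall x, U x -> D x -> spherical_dist (u n x) (g x) < e.

Definition normal_family (D : set S) (F : set (S -> C)) : Prop :=
  forall u : nat -> S -> C, (forall n, F (u n)) ->
    exists2 s : nat -> nat, {homo s : i j / (i < j)%N} &
      let v n x : S := Some (u (s n) x) in
      (exists2 g, analytic_on D g &
         cvg_locally_spherically D v (fun x => Some (g x))) \/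
      cvg_locally_spherically D v (fun=> None).

End Sphere.

(* Main.v *)
Require Import Defs.
From mathcomp Require Import all_boot all_order all_algebra.
From mathcomp Require Import all_classical all_reals all_analysis.
From mathcomp Require Import complex ring lra zify.
Import Order.TTheory GRing.Theory Num.Theory.
Import numFieldNormedType.Exports.
Local Open Scope classical_set_scope.
Local Open Scope ring_scope.
Set Implicit Arguments.
Unset Strict Implicit.
Unset Printing Implicit Defensive.

(* Write N for the degree of the monomial P[f] = f^q0 (f')^q1 ... and W for its weight; as
   q0 > 0, W < k N. The monomial is invariant under g zeta = t^(-W) f (z + t^N zeta). If
   |f| <= 1 at 0 did not bound |f'| there, the Zalcman-Pang rescaling, which needs W < k N
   because zeros have multiplicity >= k, would produce a nonconstant entire g whose
   derivative is bounded where |g| = 1. Such a g has exponential type, so P[g] - 1 is zero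
   free of exponential type, hence P[g] = 1 + exp(az + b). A zero of g is a multiple zero of
   P[g], which forces P[g] = 0 and then g = 0; a zero free g is exp(cz + d), and then P[g]
   takes the value 1 unless c = 0. This contradiction bounds |f'| wherever |f| is small, and
   normality at finite points follows from Montel's theorem.

   At infinity one has to exclude zeros of f_n near infinity when f_n tends to infinity on
   an annulus R < |z| < oo. By the maximum principle, blow-ups at scales tending to infinity
   are bounded near infinity; there the same exponential type argument, applied to
   s |-> g(e^s), makes the limits constant, and comparing the blow-ups at two scales gives a
   contradiction. *)

(** Value distribution theory is replaced by growth. A bound on |g'| along |g| = 1 limits how fast
    |g| can leave the level 1, and a zero-free function of exponential type is explicitly known. The
    exponent W/N of the invariant scaling never appears as a root of the functions: lengths are
    written t^N and amplitudes t^W, so only integer powers of t occur. Infinity is the real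
    obstacle. The omitted value concerns derivatives in z, which do not keep their form in the
    coordinate 1/z, so the finite argument cannot be repeated in the other chart. What survives is
    the scaling z -> r z with centre 0: blow-ups with r tending to infinity live on the whole
    punctured plane, and the exponential pulls their limits back to entire functions. Every
    normality statement keeps two alternatives, a finite holomorphic limit or divergence to
    infinity, because these exclude each other wherever two discs meet and can therefore be glued
    over a connected set. *)

Local Notation Re := (@complex.Re _).
Local Notation Im := (@complex.Im _).

(** * Modulus and sequences of complex numbers *)

Section Modulus.
Variable R : realType.
Local Notation C := (Cplx R).
Implicit Types (z w : C) (x : R).

Definition rc (x : R) : C := real_complex R x.

Lemma cmodE z : cmod z = Num.sqrt (Re z ^+ 2 + Im z ^+ 2).
Proof. by case: z. Qed.

Lemma cmod_ge0 z : 0 <= cmod z.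
Proof. by rewrite cmodE sqrtr_ge0. Qed.

Lemma cmodD z w : cmod (z + w) <= cmod z + cmod w.
Proof. exact: le_normcD. Qed.

Lemma cmodM z w : cmod (z * w) = cmod z * cmod w.
Proof. exact: ComplexField.Normc.normcM. Qed.

Lemma cmodN z : cmod (- z) = cmod z.
Proof. exact: normcN. Qed.

Lemma cmodV z : cmod (z^-1) = (cmod z)^-1.
Proof. exact: ComplexField.Normc.normcV. Qed.

Lemma cmod0 : cmod (0 : C) = 0.
Proof. exact: ComplexField.Normc.normc0. Qed.

Lemma cmod1 : cmod (1 : C) = 1.
Proof. exact: ComplexField.Normc.normc1. Qed.

Lemma cmodX z n : cmod (z ^+ n) = cmod z ^+ n.
Proof. by elim: n => [|n IH]; rewrite ?expr0 ?cmod1// !exprS cmodM IH. Qed.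

Lemma cmodBC z w : cmod (z - w) = cmod (w - z).
Proof. by rewrite -cmodN opprB. Qed.

Lemma cmod_eq0 z : (cmod z == 0) = (z == 0).
Proof.
apply/eqP/eqP => [|->]; last exact: cmod0.
exact: ComplexField.Normc.eq0_normc.
Qed.

Lemma cmod_gt0 z : (0 < cmod z) = (z != 0).
Proof. by rewrite lt_def cmod_eq0 cmod_ge0 andbT. Qed.

Lemma cmod_rc x : cmod (rc x) = `|x|.
Proof. by rewrite cmodE /= expr0n addr0 sqrtr_sqr. Qed.

Lemma cmod_nat n : cmod (n%:R : C) = n%:R.
Proof.
by rewrite (_ : n%:R = rc n%:R) ?cmod_rc ?normr_nat// /rc rmorph_nat.
Qed.

Lemma cmodB_le z w : cmod (z - w) <= cmod z + cmod w.
Proof. by rewrite -(cmodN w) cmodD. Qed.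

Lemma cmod_sub_ge z w : cmod z - cmod w <= cmod (z - w).
Proof. by rewrite lerBlDr -{1}(subrK w z) cmodD. Qed.

Lemma cmod_tri z w v : cmod (z - v) <= cmod (z - w) + cmod (w - v).
Proof. by rewrite -{1}(subrK w z) -addrA cmodD. Qed.

Lemma sqr_cmod z : cmod z ^+ 2 = Re z ^+ 2 + Im z ^+ 2.
Proof. by rewrite cmodE sqr_sqrtr// addr_ge0// sqr_ge0. Qed.

Lemma Re_le_cmod z : `|Re z| <= cmod z.
Proof.
by rewrite cmodE -sqrtr_sqr ler_wsqrtr// lerDl sqr_ge0.
Qed.

Lemma Im_le_cmod z : `|Im z| <= cmod z.
Proof.
by rewrite cmodE -sqrtr_sqr ler_wsqrtr// lerDr sqr_ge0.
Qed.

Lemma cmod_le_ReIm z : cmod z <= `|Re z| + `|Im z|.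
Proof.
rewrite cmodE -[leRHS]ger0_norm ?addr_ge0// -sqrtr_sqr ler_wsqrtr//.
by rewrite sqrrD !real_normK ?num_real// addrAC lerDl mulrn_wge0// mulr_ge0.
Qed.

Lemma ReD z w : Re (z + w) = Re z + Re w. Proof. by case: z; case: w. Qed.
Lemma ImD z w : Im (z + w) = Im z + Im w. Proof. by case: z; case: w. Qed.
Lemma ReN z : Re (- z) = - Re z. Proof. by case: z. Qed.
Lemma ImN z : Im (- z) = - Im z. Proof. by case: z. Qed.
Lemma ReB z w : Re (z - w) = Re z - Re w. Proof. by rewrite ReD ReN. Qed.
Lemma ImB z w : Im (z - w) = Im z - Im w. Proof. by rewrite ImD ImN. Qed.
Lemma Re_rcM x z : Re (rc x * z) = x * Re z.
Proof. by case: z => a b /=; rewrite mul0r subr0. Qed.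
Lemma Im_rcM x z : Im (rc x * z) = x * Im z.
Proof. by case: z => a b /=; rewrite mul0r addr0. Qed.

Lemma Ceq z w : Re z = Re w -> Im z = Im w -> z = w.
Proof. by case: z => a b; case: w => c d /= -> ->. Qed.

Lemma rcD x y : rc (x + y) = rc x + rc y. Proof. exact: rmorphD. Qed.
Lemma rcM x y : rc (x * y) = rc x * rc y. Proof. exact: rmorphM. Qed.
Lemma rcN x : rc (- x) = - rc x. Proof. exact: rmorphN. Qed.
Lemma rcB x y : rc (x - y) = rc x - rc y. Proof. exact: rmorphB. Qed.
Lemma rcV x : rc (x^-1) = (rc x)^-1. Proof. exact: fmorphV. Qed.
Lemma rc0 : rc 0 = 0. Proof. exact: rmorph0. Qed.
Lemma rc1 : rc 1 = 1. Proof. exact: rmorph1. Qed.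
Lemma rcX x n : rc (x ^+ n) = rc x ^+ n. Proof. exact: rmorphXn. Qed.
Lemma rc_nat n : rc n%:R = n%:R. Proof. exact: rmorph_nat. Qed.
Lemma rc_eq0 x : (rc x == 0) = (x == 0). Proof. exact: fmorph_eq0. Qed.

End Modulus.

Section Sequences.
Variable R : realType.
Local Notation C := (Cplx R).

Definition inc (s : nat -> nat) := {homo s : i j / (i < j)%N}.

Lemma inc_ge s : inc s -> forall n, (n <= s n)%N.
Proof. by move=> hs; elim=> [//|n IH]; apply: (leq_ltn_trans IH); apply: hs. Qed.

Lemma inc_id : inc id. Proof. by []. Qed.

Lemma inc_comp s t : inc s -> inc t -> inc (s \o t).
Proof. by move=> hs ht i j /ht /hs. Qed.

Lemma inc_succ s : (forall n, (s n < s n.+1)%N) -> inc s.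
Proof. by move=> h; apply: (homo_ltn ltn_trans h). Qed.

Lemma extract (P : nat -> nat -> Prop) :
  (forall k N, exists2 n, (N <= n)%N & P k n) ->
  exists2 s, inc s & forall k, P k (s k).
Proof.
move=> h.
have /choice [f hf] : forall kN : nat * nat,
    exists n, (kN.2 <= n)%N /\ P kN.1 n.
  by move=> [k N]; have [n] := h k N; exists n.
pose s := fix s k := if k is j.+1 then f (j.+1, (s j).+1) else f (0%N, 0%N).
exists s; first by apply: inc_succ => n; have [] := hf (n.+1, (s n).+1).
by case=> [|k]; [have [] := hf (0%N, 0%N)|have [] := hf (k.+1, (s k).+1)].
Qed.

Lemma extract_io (P : nat -> Prop) :
  (forall N, exists2 n, (N <= n)%N & P n) -> exists2 s, inc s & forall k, P (s k).
Proof. by move=> h; apply: (@extract (fun=> P)). Qed.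

Lemma inv_lt (e : R) : 0 < e -> exists N, forall n, (N <= n)%N -> n.+1%:R^-1 < e.
Proof.
move=> e0; have [N hN] : exists N : nat, e^-1 < N%:R.
  exists (Num.truncn e^-1).+1.
  by rewrite Num.Theory.truncnS_gt.
exists N => n Nn; rewrite invf_plt ?posrE// (lt_le_trans hN)// ler_nat.
exact: leqW.
Qed.

Lemma archi (x : R) : exists N, forall n, (N <= n)%N -> x < n%:R.
Proof.
exists (Num.truncn x).+1 => n hn; rewrite (lt_le_trans (Num.Theory.truncnS_gt x))// ler_nat //.
Qed.

Definition cvr (u : nat -> R) (l : R) :=
  forall e, 0 < e -> exists N, forall n, (N <= n)%N -> `|u n - l| < e.

Definition cvc (u : nat -> C) (l : C) :=
  forall e : R, 0 < e -> exists N, forall n, (N <= n)%N -> cmod (u n - l) < e.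

Lemma cvr_sub u l s : cvr u l -> inc s -> cvr (u \o s) l.
Proof.
move=> h hs e /h [N hN]; exists N => n Nn; apply: hN.
exact: (leq_trans Nn (inc_ge hs n)).
Qed.

Lemma cvc_sub u l s : cvc u l -> inc s -> cvc (u \o s) l.
Proof.
move=> h hs e /h [N hN]; exists N => n Nn; apply: hN.
exact: (leq_trans Nn (inc_ge hs n)).
Qed.

(** [sup A] is the upper limit of u: smaller numbers are exceeded infinitely often, larger ones are
    not, so terms close to it occur beyond every index. *)
Lemma bw_real (u : nat -> R) (M : R) : (forall n, `|u n| <= M) ->
  exists2 s, inc s & exists l, cvr (u \o s) l.
Proof.
move=> hM.
pose A := [set x : R | forall N, exists2 n, (N <= n)%N & x <= u n].
have hA : has_sup A.
  split; first by exists (- M) => N; exists N => //; have := hM N; rewrite ler_norml => /andP[].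
  exists M => x /(_ 0%N) [n _ hx]; apply: (le_trans hx).
  by have := hM n; rewrite ler_norml => /andP[].
pose l := sup A.
have [s hs hsl] : exists2 s, inc s & forall k, `|u (s k) - l| < k.+1%:R^-1.
  apply: (@extract (fun k n => `|u n - l| < k.+1%:R^-1)) => k N; have e0 : 0 < k.+1%:R^-1 :> R by rewrite invr_gt0.
  have [x Ax xl] := sup_adherent e0 hA.
  have : ~ A (l + k.+1%:R^-1).
    move=> h; have := ub_le_sup (proj2 hA) h; rewrite -/l gerDl.
    by rewrite leNgt e0.
  rewrite /A /= => /existsNP[N' hN'].
  have [n Nn hx] := Ax (maxn N N').
  exists n; first exact: leq_trans (leq_maxl _ _) Nn.
  rewrite ltr_norml ltrBrDl (lt_le_trans xl)//= ltrBlDl ltNge.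
  apply/negP => hc; apply: hN'; exists n; first exact: leq_trans (leq_maxr _ _) Nn.
  by [].
exists s => //; exists l => e /inv_lt [N hN]; exists N => n Nn.
exact: (lt_trans (hsl n) (hN n Nn)).
Qed.

Lemma bw (u : nat -> C) M : (forall n, cmod (u n) <= M) ->
  exists2 s, inc s & exists l, cvc (u \o s) l.
Proof.
move=> hM.
have [s hs [a ha]] : exists2 s, inc s & exists l, cvr ((Re \o u) \o s) l.
  by apply: (bw_real (M := M)) => n; rewrite (le_trans (Re_le_cmod _)).
have [t ht [b hb]] : exists2 t, inc t & exists l, cvr ((Im \o u \o s) \o t) l.
  by apply: (bw_real (M := M)) => n; rewrite (le_trans (Im_le_cmod _)).
exists (s \o t); first exact: inc_comp.
exists (Complex a b) => e e0.
have e2 : 0 < e / 2 by rewrite divr_gt0.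
have [N1 h1] := cvr_sub ha ht e2.
have [N2 h2] := hb _ e2.
exists (maxn N1 N2) => n; rewrite geq_max => /andP[/h1 k1 /h2 k2].
rewrite (le_lt_trans (cmod_le_ReIm _))// ReB ImB /=.
by rewrite (splitr e) ltrD.
Qed.

Lemma cvc_uniq u l l' : cvc u l -> cvc u l' -> l = l'.
Proof.
move=> h h'; apply/eqP; rewrite -subr_eq0 -cmod_eq0 eq_le cmod_ge0 andbT.
apply/ler_addgt0Pr => e e0; rewrite add0r.
have e2 : 0 < e / 2 by rewrite divr_gt0.
have [N1 h1] := h _ e2; have [N2 h2] := h' _ e2.
have k1 := h1 _ (leq_maxl N1 N2); have k2 := h2 _ (leq_maxr N1 N2).
rewrite (le_trans (cmod_tri _ (u (maxn N1 N2)) _))// cmodBC (splitr e) lerD// ltW//.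
Qed.

Lemma cvc_cmod u l : cvc u l -> cvr (fun n => cmod (u n)) (cmod l).
Proof.
move=> h e /h [N hN]; exists N => n /hN; apply: le_lt_trans.
by rewrite ler_norml lerNl opprB {1}cmodBC !cmod_sub_ge.
Qed.

Lemma cvc_le u l M : cvc u l -> (exists N, forall n, (N <= n)%N -> cmod (u n) <= M) -> cmod l <= M.
Proof.
move=> h [N' hM]; apply/ler_addgt0Pr => e e0.
have [N hN] := cvc_cmod h e0.
have := hN _ (leq_maxl N N'); have := hM _ (leq_maxr N N').
rewrite ltr_norml => h1 /andP[h2 h3]; lra.
Qed.

Lemma cvc_ge u l M : cvc u l -> (exists N, forall n, (N <= n)%N -> M <= cmod (u n)) -> M <= cmod l.
Proof.
move=> h [N' hM]; apply/ler_addgt0Pr => e e0.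
have [N hN] := cvc_cmod h e0.
have := hN _ (leq_maxl N N'); have := hM _ (leq_maxr N N').
rewrite ltr_norml => h1 /andP[h2 h3]; lra.
Qed.

Definition cauchyc (u : nat -> C) := forall e : R, 0 < e ->
  exists N, forall m n, (N <= m)%N -> (N <= n)%N -> cmod (u m - u n) < e.

(** A tail is bounded, so it has a convergent subsequence, and the Cauchy condition makes the whole
    sequence follow it. *)
Lemma cauchyc_cvc u : cauchyc u -> exists l, cvc u l.
Proof.
move=> hu.
have [N hN] := hu 1 ltr01.
have [s hs [l hl]] : exists2 s, inc s & exists l, cvc ((fun n => u (N + n)%N) \o s) l.
  apply: (bw (M := 1 + cmod (u N))) => n.
  have := hN (N + n)%N N (leq_addr _ _) (leqnn _).
  by have := cmod_sub_ge (u (N + n)%N) (u N); lra.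
exists l => e e0; have e2 : 0 < e / 2 by rewrite divr_gt0.
have [N1 h1] := hu _ e2; have [N2 h2] := hl _ e2.
exists N1 => n Nn; pose m := maxn N1 N2.
have := h2 m (leq_maxr _ _) => /= k2.
have k1 := h1 n (N + s m)%N Nn.
rewrite (le_lt_trans (cmod_tri _ (u (N + s m)%N) _))// (splitr e) ltrD// k1//.
rewrite (leq_trans (leq_maxl N1 N2))// (leq_trans (inc_ge hs _))// leq_addl//.
Qed.

End Sequences.

(** * Derivatives *)

Section LibraryDerivative.
Variables (K : numFieldType) (f : K^o -> K^o) (a : K^o).

(** With [eps_derivable], the bridge between the derivative of the library and explicit estimates.
    For K = R[i] a positive e is automatically real, so the estimates become real ones. *)
Lemma derivable_eps : derivable f a 1 -> forall e : K, 0 < e ->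
  exists2 d : K, 0 < d & forall z, `|z - a| < d ->
    `|f z - f a - derive1 f a * (z - a)| <= e * `|z - a|.
Proof.
move=> /derivable_nbhs; rewrite -derive1E => /eqaddoP h e e0.
have [d /= d0 hd] := (nbhs_ballP _ _).1 (h e e0).
exists d => // z zd; have := hd (z - a); rewrite -ball_normE /= sub0r normrN.
move=> /(_ zd) /=; apply: le_trans.
rewrite le_eqVlt; apply/orP; left; apply/eqP; congr (`|_|).
rewrite !fctE /= /GRing.scale /= mulr1 subrK.
by rewrite [(z - a) * _]mulrC opprD addrA.
Qed.

Lemma eps_derivable (l : K) : (forall e : K, 0 < e ->
  exists2 d : K, 0 < d & forall z, `|z - a| < d ->
    `|f z - f a - l * (z - a)| <= e * `|z - a|) ->
  derivable f a 1 /\ derive1 f a = l.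
Proof.
move=> h.
have cv : (fun h => h^-1 *: ((f \o shift a) (h *: (1 : K^o)) - f a)) @ 0^' --> (l : K^o).
  apply/cvgrPdist_le => e e0; have [d d0 hd] := h e e0.
  apply/nbhs_ballP; exists d => //= z; rewrite -ball_normE /= sub0r normrN => zd z0.
  have := hd (z + a); rewrite addrK => /(_ zd) {}hd.
  rewrite /GRing.scale /= mulr1.
  have nz : 0 < `|z| by rewrite normr_gt0.
  rewrite -(ler_pM2r nz) -normrM; apply: le_trans hd.
  rewrite le_eqVlt; apply/orP; left; apply/eqP; rewrite -normrN; congr (`|_|).
  by rewrite mulrBl mulrAC mulVf// mul1r opprB.
have D : derivable f a 1 by apply/cvg_ex; exists l.
by split=> //; rewrite derive1E; apply/cvg_lim.
Qed.

End LibraryDerivative.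
Section Derivatives.
Variables (R : realType).
Local Notation C := (Cplx R).

Section Generic.
(* The domain X is the plane (i = id) or the real line (i = rc). *)
Variables (X : Type) (i : X -> C).
Implicit Types (f g : X -> C) (a x : X).

Definition cont f a := forall e : R, 0 < e -> exists2 d : R, 0 < d &
  forall x, cmod (i x - i a) < d -> cmod (f x - f a) < e.

(** Non-strict and free of division, so that x = a needs no exception. *)
Definition der f a (l : C) := forall e : R, 0 < e -> exists2 d : R, 0 < d &
  forall x, cmod (i x - i a) < d ->
    cmod (f x - f a - l * (i x - i a)) <= e * cmod (i x - i a).

Lemma cont_cst (c : C) a : cont (fun=> c) a.
Proof. by move=> e e0; exists 1 => // x _; rewrite subrr cmod0. Qed.

Lemma cont_i a : cont i a.
Proof. by move=> e e0; exists e. Qed.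

Lemma contD f g a : cont f a -> cont g a -> cont (fun x => f x + g x) a.
Proof.
move=> hf hg e e0; have e2 : 0 < e / 2 by rewrite divr_gt0.
have [d1 d10 h1] := hf _ e2; have [d2 d20 h2] := hg _ e2.
exists (Num.min d1 d2); first by rewrite lt_min d10.
move=> x; rewrite lt_min => /andP[/h1 k1 /h2 k2].
rewrite (_ : _ - _ = (f x - f a) + (g x - g a)); last by ring.
by rewrite (le_lt_trans (cmodD _ _))// (splitr e) ltrD.
Qed.

Lemma contM f g a : cont f a -> cont g a -> cont (fun x => f x * g x) a.
Proof.
move=> hf hg e e0.
pose K := cmod (f a) + cmod (g a) + 1.
have K0 : 0 < K by rewrite /K; have := cmod_ge0 (f a); have := cmod_ge0 (g a); lra.
pose e' := Num.min 1 (e / K).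
have e'0 : 0 < e' by rewrite lt_min ltr01 divr_gt0.
have [d1 d10 h1] := hf _ e'0; have [d2 d20 h2] := hg _ e'0.
exists (Num.min d1 d2); first by rewrite lt_min d10.
move=> x; rewrite lt_min => /andP[/h1 k1 /h2 k2].
rewrite (_ : _ - _ = (f x - f a) * g x + f a * (g x - g a)); last by ring.
rewrite (le_lt_trans (cmodD _ _))// !cmodM.
have e'1 : e' <= 1 by rewrite ge_min lexx.
have e'e : e' * K <= e.
  by rewrite -ler_pdivlMr// ge_min lexx orbT.
have hg1 : cmod (g x) <= cmod (g a) + 1.
  by have := cmod_sub_ge (g x) (g a); lra.
apply: lt_le_trans e'e.
have m1 : cmod (f x - f a) * cmod (g x) <= e' * (cmod (g a) + 1).
  by rewrite ler_pM ?cmod_ge0// ltW.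
have m2 : cmod (f a) * cmod (g x - g a) <= cmod (f a) * e'.
  by rewrite ler_wpM2l ?cmod_ge0// ltW.
(* Strictness comes from the second summand, except when f a = 0; then the first one has to supply
   it. *)
have [f0|f0] := eqVneq (cmod (f a)) 0.
  rewrite f0 mul0r addr0 /K f0 add0r.
  by rewrite (le_lt_trans (ler_wpM2l (cmod_ge0 _) hg1))// ltr_pM2r//; have := cmod_ge0 (g a); lra.
have {}f0 : 0 < cmod (f a) by rewrite lt_def f0 cmod_ge0.
have m2' : cmod (f a) * cmod (g x - g a) < cmod (f a) * e' by rewrite ltr_pM2l.
by rewrite /K; nra.
Qed.

Lemma contN f a : cont f a -> cont (fun x => - f x) a.
Proof.
by move=> h e /h [d d0 hd]; exists d => // x /hd; rewrite -opprD cmodN.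
Qed.

Lemma contB f g a : cont f a -> cont g a -> cont (fun x => f x - g x) a.
Proof. by move=> hf /contN; apply: contD. Qed.

Lemma contX f n a : cont f a -> cont (fun x => f x ^+ n) a.
Proof.
move=> h; elim: n => [|n IH]; first exact: cont_cst.
by under [X in cont X]funext => x do rewrite exprS; apply: contM.
Qed.

Lemma cont_cmod_gt f a (c : R) : cont f a -> c < cmod (f a) ->
  exists2 d, 0 < d & forall x, cmod (i x - i a) < d -> c < cmod (f x).
Proof.
move=> h c0; have e0 : 0 < cmod (f a) - c by rewrite subr_gt0.
have [d d0 hd] := h _ e0; exists d => // x /hd.
by rewrite cmodBC; have := cmod_sub_ge (f a) (f x); lra.
Qed.

Lemma cont_cmod_lt f a (c : R) : cont f a -> cmod (f a) < c ->
  exists2 d, 0 < d & forall x, cmod (i x - i a) < d -> cmod (f x) < c.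
Proof.
move=> h c0; have e0 : 0 < c - cmod (f a) by rewrite subr_gt0.
have [d d0 hd] := h _ e0; exists d => // x /hd.
by have := cmod_sub_ge (f x) (f a); lra.
Qed.

Lemma contV f a : cont f a -> f a != 0 -> cont (fun x => (f x)^-1) a.
Proof.
move=> h fa e e0.
have m0 : 0 < cmod (f a) by rewrite cmod_gt0.
have h2 : cmod (f a) / 2 < cmod (f a) by lra.
have [d1 d10 h1] := cont_cmod_gt h h2.
have e'0 : 0 < e * (cmod (f a) * (cmod (f a) / 2)) by rewrite !mulr_gt0.
have [d2 d20 k2] := h _ e'0.
exists (Num.min d1 d2); first by rewrite lt_min d10.
move=> x; rewrite lt_min => /andP[/h1 k1 /k2 k].
have fx0 : 0 < cmod (f x) by lra.
have fx : f x != 0 by rewrite -cmod_gt0.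
rewrite (_ : _ - _ = (f a - f x) / (f a * f x)); last first.
  by field; rewrite fx fa.
rewrite cmodM cmodV cmodM cmodBC ltr_pdivrMr ?mulr_gt0//.
apply: (lt_le_trans k); rewrite ler_pM2l// ler_pM2l//; exact: ltW.
Qed.

Lemma cont_near f g a : cont f a ->
  (exists2 d : R, 0 < d & forall x, cmod (i x - i a) < d -> f x = g x) -> cont g a.
Proof.
move=> h [d d0 hd] e /h [d' d'0 hd'].
exists (Num.min d d'); first by rewrite lt_min d0.
move=> x; rewrite lt_min => /andP[/hd <- /hd']; rewrite -hd//.
by rewrite subrr cmod0.
Qed.

Lemma der_near f g a l : der f a l ->
  (exists2 d : R, 0 < d & forall x, cmod (i x - i a) < d -> f x = g x) -> der g a l.
Proof.
move=> h [d d0 hd] e /h [d' d'0 hd'].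
exists (Num.min d d'); first by rewrite lt_min d0.
move=> x; rewrite lt_min => /andP[/hd <- /hd']; rewrite -hd//.
by rewrite subrr cmod0.
Qed.

(** Caratheodory's form of the derivative: with a slope function continuous at a, the rules of
    differentiation reduce to algebra and rules of continuity. *)
Lemma der_slope f a l : der f a l -> exists phi : X -> C,
  [/\ forall x, f x - f a = phi x * (i x - i a), phi a = l & cont phi a].
Proof.
move=> h; exists (fun x => if i x == i a then l else (f x - f a) / (i x - i a)); split.
(* Injectivity of [i] is not assumed: when i x = i a the estimate itself forces f x = f a. *)
- move=> x; have [xa|xa] := eqVneq (i x) (i a); last by rewrite divfK// subr_eq0.
  have [d d0 hd] := h 1 ltr01.
  have := hd x; rewrite xa subrr cmod0 !mulr0 subr0 => /(_ d0) h0.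
  by apply/eqP; rewrite -cmod_eq0 eq_le h0 cmod_ge0.
- by rewrite eqxx.
- move=> e e0; have e2 : 0 < e / 2 by rewrite divr_gt0.
  have [d d0 hd] := h _ e2; exists d => // x /hd; rewrite eqxx.
  have [xa _|xa] := eqVneq (i x) (i a); first by rewrite subrr cmod0.
  have n0 : 0 < cmod (i x - i a) by rewrite cmod_gt0 subr_eq0.
  rewrite -ler_pdivrMr// -cmodV -cmodM mulrBl -(mulrA l) divff ?subr_eq0// mulr1.
  by move=> hh; apply: le_lt_trans hh _; lra.
Qed.

Lemma slope_der f a (phi : X -> C) :
  (forall x, f x - f a = phi x * (i x - i a)) -> cont phi a -> der f a (phi a).
Proof.
move=> h hp e e0; have [d d0 hd] := hp e e0; exists d => // x xd.
by rewrite h -mulrBl cmodM ler_wpM2r ?cmod_ge0// ltW// hd.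
Qed.

Lemma der_eq f a l l' : der f a l -> l = l' -> der f a l'.
Proof. by move=> h <-. Qed.

Lemma der_cont f a l : der f a l -> cont f a.
Proof.
move=> /der_slope [phi [h _ hp]].
have : cont (fun x => f a + phi x * (i x - i a)) a.
  apply: contD; first exact: cont_cst.
  by apply: contM => //; apply: contB; [exact: cont_i|exact: cont_cst].
move/cont_near; apply; exists 1 => // x _; by rewrite -h addrC subrK.
Qed.

Lemma der_cst (c : C) a : der (fun=> c) a 0.
Proof.
by move=> e e0; exists 1 => // x _; rewrite subrr mul0r subr0 cmod0 mulr_ge0 ?cmod_ge0// ltW.
Qed.

Lemma der_i a : der i a 1.
Proof.
by move=> e e0; exists 1 => // x _; rewrite mul1r subrr cmod0 mulr_ge0 ?cmod_ge0// ltW.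
Qed.

Lemma derD f g a l m : der f a l -> der g a m -> der (fun x => f x + g x) a (l + m).
Proof.
move=> /der_slope [p [hp <- cp]] /der_slope [q [hq <- cq]].
apply: (@slope_der _ _ (fun x => p x + q x)); last exact: contD.
by move=> x; rewrite mulrDl -hp -hq; ring.
Qed.

Lemma derM f g a l m : der f a l -> der g a m ->
  der (fun x => f x * g x) a (l * g a + f a * m).
Proof.
move=> df /der_slope [q [hq <- cq]]; have cf := der_cont df.
have [p [hp <- cp]] := der_slope df.
apply: (@slope_der _ _ (fun x => p x * g a + f x * q x)).
  move=> x; rewrite (_ : _ - _ = (f x - f a) * g a + f x * (g x - g a)); last by ring.
  by rewrite hp hq; ring.
by apply: contD; apply: contM => //; exact: cont_cst.
Qed.

Lemma derZ f a l c : der f a l -> der (fun x => c * f x) a (c * l).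
Proof.
by move=> h; apply: (der_eq (derM (der_cst c a) h)); rewrite mul0r add0r.
Qed.

Lemma derN f a l : der f a l -> der (fun x => - f x) a (- l).
Proof.
move=> h; apply: (der_near (f := fun x => (-1) * f x)).
  by apply: (der_eq (derZ (-1) h)); rewrite mulN1r.
by exists 1 => // x _; rewrite mulN1r.
Qed.

Lemma derB f g a l m : der f a l -> der g a m -> der (fun x => f x - g x) a (l - m).
Proof. by move=> hf /derN; apply: derD. Qed.

Lemma derX f n a l : der f a l -> der (fun x => f x ^+ n) a (n%:R * f a ^+ n.-1 * l).
Proof.
move=> h; elim: n => [|n IH].
  by apply: (der_eq (der_cst 1 a)); rewrite !mul0r.
apply: (der_near (f := fun x => f x * f x ^+ n)).
  apply: (der_eq (derM h IH)); case: n {IH} => [|n] /=; first by rewrite !expr0; ring.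
  by rewrite -!natr1 exprS; ring.
by exists 1 => // x _; rewrite exprS.
Qed.

Lemma derV f a l : der f a l -> f a != 0 -> der (fun x => (f x)^-1) a (- l / f a ^+ 2).
Proof.
move=> df fa; have cf := der_cont df; have [p [hp <- cp]] := der_slope df.
have [d d0 hd] : exists2 d, 0 < d & forall x, cmod (i x - i a) < d -> f x != 0.
  have m0 : 0 < cmod (f a) by rewrite cmod_gt0.
  have [d d0 hd] := cont_cmod_gt cf m0.
  by exists d => // x /hd; rewrite cmod_gt0.
have ci : cont (fun x => - p x / (f a * f x)) a.
  apply: contM; first exact: contN.
  apply: contV; last by rewrite mulf_neq0.
  by apply: contM => //; exact: cont_cst.
move=> e e0; have [d' d'0 hd'] := ci _ e0.
exists (Num.min d d'); first by rewrite lt_min d0.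
move=> x; rewrite lt_min => /andP[/hd fx /hd' h'].
rewrite (_ : (f x)^-1 - (f a)^-1 = - (f x - f a) / (f a * f x)); last first.
  by field; rewrite fx fa.
rewrite hp expr2 (_ : _ - _ = (- p x / (f a * f x) - - p a / (f a * f a)) * (i x - i a)); last by ring.
by rewrite cmodM ler_wpM2r ?cmod_ge0// ltW.
Qed.

End Generic.

Lemma cont_comp (X : Type) (i : X -> C) (f : C -> C) (g : X -> C) (a : X) :
  cont id f (g a) -> cont i g a -> cont i (fun x => f (g x)) a.
Proof.
move=> hf hg e /hf [d d0 hd]; have [d' d'0 hd'] := hg d d0.
by exists d' => // x /hd' /hd.
Qed.

Lemma der_comp (X : Type) (i : X -> C) (f : C -> C) (g : X -> C) (a : X) l m :
  der id f (g a) l -> der i g a m -> der i (fun x => f (g x)) a (l * m).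
Proof.
move=> df dg; have [p [hp <- cp]] := der_slope df; have cg := der_cont dg.
have [q [hq <- cq]] := der_slope dg.
refine (@slope_der X i (fun x => f (g x)) a (fun x => p (g x) * q x) _ _).
  by move=> x; rewrite hp hq mulrA.
by apply: contM => //; exact: cont_comp.
Qed.

(** Separate from [der_comp], whose outer function is defined on the plane: here f lives on the
    line. *)
Lemma der_affine (f : R -> C) (u v t : R) l :
  der (@rc R) f (u * t + v) l -> der (@rc R) (fun t => f (u * t + v)) t (l * rc u).
Proof.
move=> df; have [p [hp <- cp]] := der_slope df.
refine (@slope_der R (@rc R) (fun t0 => f (u * t0 + v)) t (fun x => p (u * x + v) * rc u) _ _).
  move=> x; rewrite hp -mulrA -rcB -rcB -rcM; congr (_ * rc _); by ring.
apply: contM; last exact: cont_cst.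
move=> e /cp [d d0 hd]; exists (d / (`|u| + 1)); first by rewrite divr_gt0// ltr_wpDl.
move=> x hx; apply: hd; rewrite -rcB cmod_rc (_ : _ - _ = u * (x - t)); last by ring.
rewrite normrM; move: hx; rewrite -rcB cmod_rc ltr_pdivlMr ?ltr_wpDl// => hx.
by have := normr_ge0 u; have := normr_ge0 (x - t); nra.
Qed.

(** Complex-valued curves have no mean value point, so the inequality is propagated. With M enlarged
    by e, the set of t where it holds contains its supremum, and differentiability there would push
    it further if the supremum were below b. *)
Lemma mvt_ineq (f f' : R -> C) (a b M : R) : a <= b ->
  (forall t, a <= t <= b -> der (@rc R) f t (f' t)) ->
  (forall t, a <= t <= b -> cmod (f' t) <= M) ->
  cmod (f b - f a) <= M * (b - a).
Proof.
move=> ab df hM; apply/ler_addgt0Pr => e0 e00.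
pose e := e0 / (b - a + 1).
have e1 : 0 < e by rewrite divr_gt0// ltr_wpDl// subr_ge0.
suff h : cmod (f b - f a) <= (M + e) * (b - a).
  apply: (le_trans h); rewrite mulrDl lerD2l /e mulrAC ler_pdivrMr ?ltr_wpDl ?subr_ge0//.
  by rewrite ler_pM2l// lerDl.
have M0 : 0 <= M by apply: le_trans (hM a _); rewrite ?cmod_ge0// lexx.
pose A := [set t | a <= t <= b /\ cmod (f t - f a) <= (M + e) * (t - a)].
have Aa : A a by split; rewrite ?lexx// !subrr cmod0 mulr0.
have supA : has_sup A by split; [exists a|exists b => t [/andP[]]].
pose s := sup A.
have as_ : a <= s by apply: ub_le_sup Aa; case: supA.
have sb : s <= b by apply: ge_sup => [|t [/andP[]]//]; exists a.
have [|d d0 hd] := df s _ e e1; first by rewrite as_.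
have key t : a <= t <= b -> `|t - s| < d -> cmod (f t - f s) <= (M + e) * `|t - s|.
  move=> tab; rewrite -(@cmod_rc R) rcB => /hd h.
  have := cmod_sub_ge (f t - f s) (f' s * (rc t - rc s)).
  rewrite cmodM => h'; have := hM s; rewrite as_ sb => /(_ isT) h2.
  by have := cmod_ge0 (rc t - rc s); nra.
have As : A s.
  split; first by rewrite as_.
  have [t At st] := sup_adherent d0 supA.
  have ts : t <= s by apply: ub_le_sup At; case: supA.
  have [tab ht] := At.
  have := key t tab; rewrite ler0_norm ?subr_le0// opprB -/s => /(_ _)/wrap[].
    by rewrite -/s in st; lra.
  rewrite cmodBC => k; apply: (le_trans (cmod_tri _ (f t) _)).
  have -> : s - a = (s - t) + (t - a) by rewrite addrA subrK.
  by rewrite mulrDr lerD.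
have [->|sb'] := eqVneq b s; first by case: As.
have {}sb' : s < b by rewrite lt_neqAle eq_sym sb' sb.
pose t := Num.min b (s + d / 2).
have st : s < t by rewrite lt_min sb' ltrDl divr_gt0.
have tb : t <= b by rewrite ge_min lexx.
have td : t - s < d.
  have : t <= s + d / 2 by rewrite ge_min lexx orbT.
  by move=> h; lra.
have tab : a <= t <= b by rewrite tb (le_trans as_)// ltW.
have : A t.
  split => //; have := key t tab; rewrite gtr0_norm ?subr_gt0// => /(_ td) k.
  apply: (le_trans (cmod_tri _ (f s) _)).
  have -> : t - a = (t - s) + (s - a) by rewrite addrA subrK.
  by rewrite mulrDr lerD//; case: As.
by move=> /(ub_le_sup (proj2 supA)); rewrite -/s leNgt st.
Qed.

Lemma rder0_cst (f : R -> C) (a b : R) : a <= b ->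
  (forall t, a <= t <= b -> der (@rc R) f t 0) -> f b = f a.
Proof.
move=> ab h; have := mvt_ineq ab h (M := 0); rewrite mul0r => h0.
apply/eqP; rewrite -subr_eq0 -cmod_eq0 eq_le cmod_ge0 andbT; apply: h0.
by move=> t _; rewrite cmod0.
Qed.

End Derivatives.

(** * Primitives of holomorphic functions *)

Section Integration.
Variables (R : realType).
Local Notation C := (Cplx R).
Local Notation rder := (der (@rc R)).
Local Notation cder := (der (fun z : C => z)).
Local Notation ccont := (cont (fun z : C => z)).

Lemma real_primitive (u : R -> R) (a b : R) : continuous u ->
  exists U : R -> R, forall t, a <= t <= b -> forall e, 0 < e ->
    exists2 d, 0 < d & forall x, `|x - t| < d ->
      `|U x - U t - u t * (x - t)| <= e * `|x - t|.
Proof.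
move=> cu.
(* The interval is enlarged to [a - 1, b + 1], which makes a and b interior points and the
   derivative two-sided there. *)
exists (fun x => \int[@lebesgue_measure R]_(t in `[a - 1, x]) u t)%R => t /andP[at_ tb] e e0.
have iu : (@lebesgue_measure R).-integrable `[a - 1, b + 1] (EFin \o u).
  apply: continuous_compact_integrable; first exact: segment_compact.
  exact: continuous_subspaceT.
have [||dU EU] := continuous_FTC1_closed _ iu (x := t) _ (cu t); [lra|lra|].
have [d d0 hd] := derivable_eps dU e0; exists d => // x /hd.
by rewrite EU.
Qed.

Lemma curve_primitive (f : R -> C) (a b : R) : a <= b ->
  (forall t, a <= t <= b -> cont (@rc R) f t) ->
  exists F : R -> C, forall t, a <= t <= b -> rder F t (f t).
Proof.
move=> ab cf.
(* Clamping to [a, b] is 1-Lipschitz and makes f continuous on the whole line. *)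
pose cl t := Num.max a (Num.min b t).
have clab t : a <= cl t <= b.
  by rewrite /cl le_max lexx /= ge_max ab ge_min lexx.
have clid t : a <= t <= b -> cl t = t.
  by move=> /andP[h1 h2]; rewrite /cl min_r// max_r.
have clL x t : `|cl x - cl t| <= `|x - t|.
  rewrite /cl !maxEle !minEle; do ! case: ifP => /idP; rewrite ?subrr ?normr0 ?normr_ge0 //; move=> *; rewrite ler_norml; apply/andP; split;
  have := ler_norm (x - t); have := ler_norm (- (x - t)); rewrite normrN; lra.
have cg (p : C -> R) : (forall z w, `|p z - p w| <= cmod (z - w)) ->
    continuous (fun t => p (f (cl t))).
  move=> hp t; apply/cvgrPdist_lt => e e0.
  have [d d0 hd] := cf _ (clab t) _ e0.
  apply/nbhs_ballP; exists d => //= x xd.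
  have {}xd : `|x - t| < d by move: xd; rewrite /ball_ /= distrC.
  rewrite distrC; have := hd (cl x).
  by rewrite -rcB cmod_rc => /(_ (le_lt_trans (clL x t) xd)); apply: le_lt_trans (hp _ _).
have [|U hU] := @real_primitive (fun t => Re (f (cl t))) a b.
  by apply: (cg Re) => z w; rewrite -ReB Re_le_cmod.
have [|V hV] := @real_primitive (fun t => Im (f (cl t))) a b.
  by apply: (cg Im) => z w; rewrite -ImB Im_le_cmod.
exists (fun t => Complex (U t) (V t)) => t tab e e0.
have e2 : 0 < e / 2 by rewrite divr_gt0.
have [d1 d10 h1] := hU t tab _ e2; have [d2 d20 h2] := hV t tab _ e2.
exists (Num.min d1 d2); first by rewrite lt_min d10.
move=> x; rewrite -rcB cmod_rc lt_min => /andP[/h1 k1 /h2 k2].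
apply: le_trans (cmod_le_ReIm _) _; rewrite [X in _ <= X * _](splitr e) mulrDl.
rewrite clid// in k1 k2.
by rewrite [f t * _]mulrC !ReB !ImB Re_rcM Im_rcM /= ![(x - t) * _]mulrC lerD.
Qed.

Lemma unit0 : 0 <= (0 : R) <= 1. Proof. by rewrite lexx ler01. Qed.
Lemma unit1 : 0 <= (1 : R) <= 1. Proof. by rewrite lexx ler01. Qed.

Definition segm (p q : C) (t : R) : C := p + rc t * (q - p).

Lemma segm0 p q : segm p q 0 = p. Proof. by rewrite /segm rc0 mul0r addr0. Qed.
Lemma segm1 p q : segm p q 1 = q. Proof. by rewrite /segm rc1 mul1r addrC subrK. Qed.

Lemma segm_der p q t : rder (segm p q) t (q - p).
Proof.
rewrite /segm; apply: (der_eq (derD (der_cst _ p t) (derM (der_i _ t) (der_cst _ (q - p) t)))).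
by rewrite add0r mul1r mulr0 addr0.
Qed.

Lemma segm_cont p q t : cont (@rc R) (segm p q) t.
Proof. exact: der_cont (segm_der p q t). Qed.

Lemma segm_segm p q s u t :
  segm (segm p q s) (segm p q u) t = segm p q ((u - s) * t + s).
Proof. by rewrite /segm rcD rcM rcB; ring. Qed.

Lemma cmod_segm p q t : 0 <= t <= 1 -> cmod (segm p q t - p) <= cmod (q - p).
Proof.
move=> /andP[t0 t1]; rewrite /segm addrC addKr cmodM cmod_rc ger0_norm//.
by rewrite ler_piMl ?cmod_ge0.
Qed.

Lemma segm_near p q x t c : cmod (p - x) <= c -> cmod (q - x) <= c -> 0 <= t <= 1 ->
  cmod (segm p q t - x) <= c.
Proof.
move=> pc qc /andP[t0 t1].
rewrite (_ : segm p q t - x = rc (1 - t) * (p - x) + rc t * (q - x)); last first.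
  by rewrite /segm rcB rc1; ring.
apply: (le_trans (cmodD _ _)); rewrite !cmodM !cmod_rc !ger0_norm ?subr_ge0//.
by nra.
Qed.

(** The integral of f along the segment from p to q, read off from any primitive of the pulled back
    integrand; [sint] selects it and defaults to 0 when there is no primitive. *)
Definition sint_rel (f : C -> C) (p q v : C) := exists2 F : R -> C,
  forall t, 0 <= t <= 1 -> rder F t (f (segm p q t) * (q - p)) & v = F 1 - F 0.

Definition sint (f : C -> C) (p q : C) : C := xget 0 [set v | sint_rel f p q v].

Lemma sint_relE f p q v : sint_rel f p q v -> sint f p q = v.
Proof.
move=> h; rewrite /sint; case: xgetP => [w _ /= [G dG ->]|/(_ v)//].
case: h => F dF ->; have := @rder0_cst _ (fun t => G t - F t) 0 1 ler01.
move=> h; have {}h : G 1 - F 1 = G 0 - F 0.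
  by apply: h => t /[dup] /dG dg /dF df; apply: (der_eq (derB dg df)); rewrite subrr.
apply/eqP; rewrite -subr_eq0; apply/eqP.
have -> : G 1 - G 0 - (F 1 - F 0) = (G 1 - F 1) - (G 0 - F 0) by ring.
by rewrite h subrr.
Qed.

Definition cseg f (p q : C) := forall t, 0 <= t <= 1 -> ccont f (segm p q t).

Lemma cont_segm f p q t : ccont f (segm p q t) -> cont (@rc R) (fun t => f (segm p q t)) t.
Proof. by move=> h; apply: (@cont_comp R _ (@rc R) f (segm p q)) => //; exact: segm_cont. Qed.

Lemma sintP f p q : cseg f p q -> sint_rel f p q (sint f p q).
Proof.
move=> cf; have [F hF] := @curve_primitive (fun t => f (segm p q t) * (q - p)) 0 1 ler01
  (fun t ht => contM (cont_segm (cf t ht)) (cont_cst _ (q - p) t)).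
have h : sint_rel f p q (F 1 - F 0) by exists F.
by rewrite (sint_relE h).
Qed.

(* All subsegments of one segment share a primitive. *)
Lemma sint_line f p q : cseg f p q -> exists F : R -> C,
  forall s u, 0 <= s <= 1 -> 0 <= u <= 1 -> sint f (segm p q s) (segm p q u) = F u - F s.
Proof.
move=> /sintP [F dF _]; exists F => s u hs hu; apply: sint_relE.
exists (fun t => F ((u - s) * t + s)); last by rewrite mulr1 mulr0 add0r subrK.
move=> t /andP[t0 t1]; rewrite segm_segm.
have /dF d : 0 <= (u - s) * t + s <= 1.
  by move: hs hu => /andP[? ?] /andP[? ?]; apply/andP; split; nra.
apply: (der_eq (der_affine d)); rewrite -mulrA; congr (_ * _).
by rewrite /segm rcB; ring.
Qed.

Lemma sintxx f p : sint f p p = 0.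
Proof.
apply: sint_relE; exists (fun=> 0); last by rewrite subrr.
by move=> t _; apply: (der_eq (der_cst _ _ _)); rewrite subrr mulr0.
Qed.

Lemma sint_sym f p q : cseg f p q -> sint f q p = - sint f p q.
Proof.
move=> /sint_line [F hF].
have h0 := unit0.
have h1 := unit1.
by have := hF 1 0 h1 h0; have := hF 0 1 h0 h1; rewrite segm0 segm1 => -> ->; ring.
Qed.

Lemma sint_split f p q s : cseg f p q -> 0 <= s <= 1 ->
  sint f p q = sint f p (segm p q s) + sint f (segm p q s) q.
Proof.
move=> /sint_line [F hF] hs.
have h0 := unit0.
have h1 := unit1.
have := hF 0 s h0 hs; have := hF s 1 hs h1; have := hF 0 1 h0 h1.
by rewrite segm0 segm1 => -> -> ->; ring.
Qed.

Lemma sint_bound f p q M : cseg f p q ->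
  (forall t, 0 <= t <= 1 -> cmod (f (segm p q t)) <= M) ->
  cmod (sint f p q) <= M * cmod (q - p).
Proof.
move=> cf hM; have [F dF ->] := sintP cf.
have := mvt_ineq ler01 dF (M := M * cmod (q - p)); rewrite subr0 mulr1; apply.
by move=> t /hM h; rewrite cmodM ler_wpM2r// cmod_ge0.
Qed.

Lemma sintD f g p q : cseg f p q -> cseg g p q ->
  sint (fun z => f z + g z) p q = sint f p q + sint g p q.
Proof.
move=> /sintP [F dF ->] /sintP [G dG ->]; apply: sint_relE.
exists (fun t => F t + G t); last by ring.
by move=> t /[dup] /dF df /dG dg; apply: (der_eq (derD df dg)); rewrite mulrDl.
Qed.

Lemma sint_prim f g p q :
  (forall t, 0 <= t <= 1 -> cder g (segm p q t) (f (segm p q t))) ->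
  sint f p q = g q - g p.
Proof.
move=> dg; apply: sint_relE; exists (fun t => g (segm p q t)); last by rewrite segm0 segm1.
by move=> t /dg d; apply: der_comp (segm_der p q t).
Qed.

Definition is_convex (U : C -> Prop) := forall p q t, U p -> U q -> 0 <= t <= 1 -> U (segm p q t).

Definition open_set (U : C -> Prop) := forall p, U p ->
  exists2 d : R, 0 < d & forall z, cmod (z - p) < d -> U z.

Definition holo (U : C -> Prop) (f : C -> C) := forall z, U z -> exists l, cder f z l.

Definition tint f (p q r : C) := sint f p q + sint f q r + sint f r p.

Definition perim (p q r : C) := cmod (q - p) + cmod (r - q) + cmod (p - r).

Lemma perim_ge0 p q r : 0 <= perim p q r.
Proof. by rewrite !addr_ge0 ?cmod_ge0. Qed.

Definition mid (p q : C) := segm p q (2^-1).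

Lemma midC p q : mid p q = mid q p.
Proof. by rewrite /mid /segm rcV rc_nat; field. Qed.

Lemma half01 : 0 <= (2^-1 : R) <= 1. Proof. by apply/andP; split; lra. Qed.

Lemma mid_sub p q r : mid p q - mid p r = rc 2^-1 * (q - r).
Proof. by rewrite /mid /segm; ring. Qed.

Lemma cmod_half (z : C) : cmod (rc 2^-1 * z) = cmod z / 2.
Proof. by rewrite cmodM cmod_rc ger0_norm ?invr_ge0// mulrC. Qed.

Lemma mid_subl p q : mid p q - p = rc 2^-1 * (q - p).
Proof. by rewrite /mid /segm; ring. Qed.

Lemma mid_subr p q : p - mid p q = rc 2^-1 * (p - q).
Proof. by rewrite /mid /segm; ring. Qed.

Section ConvexU.
Variables (U : C -> Prop) (f : C -> C).
Hypothesis cU : is_convex U.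
Hypothesis cf : forall z, U z -> ccont f z.

Lemma cseg_in p q : U p -> U q -> cseg f p q.
Proof. by move=> up uq t ht; apply/cf/cU. Qed.

(** Midpoint subdivision: every inner edge is run through twice, in opposite directions. *)
Lemma tint_split p q r : U p -> U q -> U r ->
  tint f p q r = tint f p (mid p q) (mid p r) + tint f q (mid q r) (mid q p)
    + tint f r (mid r p) (mid r q) + tint f (mid p q) (mid q r) (mid r p).
Proof.
move=> up uq ur; rewrite /tint.
have um p' q' : U p' -> U q' -> U (mid p' q') by move=> *; apply/cU => //; exact: half01.
rewrite (midC q p) (midC r q) (midC r p).
rewrite (sint_split (cseg_in up uq) half01) (sint_split (cseg_in uq ur) half01).
rewrite (sint_split (cseg_in ur up) half01) -!/(mid _ _) (midC r p).
rewrite (sint_sym (p := mid p q) (q := mid p r)); last by apply: cseg_in; exact: um.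
rewrite (sint_sym (p := mid q r) (q := mid p q)); last by apply: cseg_in; exact: um.
rewrite (sint_sym (p := mid p r) (q := mid q r)); last by apply: cseg_in; exact: um.
by ring.
Qed.

(** The bound on cmod (p' - p) is what later makes the first vertices of the nested triangles a
    Cauchy sequence. *)
Lemma tint_quarter p q r : U p -> U q -> U r -> exists p' q' r' : C,
  [/\ [/\ U p', U q' & U r'], perim p' q' r' = perim p q r / 2,
      cmod (p' - p) <= perim p q r & cmod (tint f p q r) <= 4 * cmod (tint f p' q' r')].
Proof.
move=> up uq ur.
have um p' q' : U p' -> U q' -> U (mid p' q') by move=> *; apply/cU => //; exact: half01.
have d1 := cmod_ge0 (q - p); have d2 := cmod_ge0 (r - q); have d3 := cmod_ge0 (p - r).
have s1 := cmodBC p q; have s2 := cmodBC q r; have s3 := cmodBC r p.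
set T := cmod (tint f p q r).
have [h|h1] := leP T (4 * cmod (tint f p (mid p q) (mid p r))).
  exists p, (mid p q), (mid p r); split=> //; first by split => //; exact: um.
  - by rewrite /perim mid_subl mid_sub mid_subr !cmod_half; lra.
  - by rewrite subrr cmod0 perim_ge0.
have [h|h2] := leP T (4 * cmod (tint f q (mid q r) (mid q p))).
  exists q, (mid q r), (mid q p); split=> //; first by split => //; exact: um.
  - by rewrite /perim mid_subl mid_sub mid_subr !cmod_half; lra.
  - by rewrite /perim; lra.
have [h|h3] := leP T (4 * cmod (tint f r (mid r p) (mid r q))).
  exists r, (mid r p), (mid r q); split=> //; first by split => //; exact: um.
  - by rewrite /perim mid_subl mid_sub mid_subr !cmod_half; lra.
  - by rewrite /perim; lra.
have [h|h4] := leP T (4 * cmod (tint f (mid p q) (mid q r) (mid r p))).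
  exists (mid p q), (mid q r), (mid r p); split=> //; first by split => //; exact: um.
  - rewrite /perim {1}(midC p q) mid_sub {1}(midC q r) mid_sub {1}(midC r p) mid_sub !cmod_half; lra.
  - by rewrite mid_subl cmod_half /perim; lra.
have := tint_split up uq ur => e.
have : T <= cmod (tint f p (mid p q) (mid p r)) + cmod (tint f q (mid q r) (mid q p))
   + cmod (tint f r (mid r p) (mid r q)) + cmod (tint f (mid p q) (mid q r) (mid r p)).
  rewrite /T e; do 3 (apply: (le_trans (cmodD _ _)); rewrite lerD2r).
  by [].
by move=> h; lra.
Qed.

End ConvexU.

(** The closed triangle. A convex U need not be closed, so the nested triangles of [goursat] are
    kept in the hull, which contains their limit point and lies in U. *)
Definition hull (p q r z : C) := exists a b : R,
  [/\ 0 <= a, 0 <= b, a + b <= 1 & z = p + rc a * (q - p) + rc b * (r - p)].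

Lemma hull_convex p q r : is_convex (hull p q r).
Proof.
move=> z w t [a [b [a0 b0 ab ->]]] [a' [b' [a'0 b'0 ab' ->]]] /andP[t0 t1].
exists ((1 - t) * a + t * a'), ((1 - t) * b + t * b'); split; [nra|nra|nra|].
by rewrite /segm !rcD !rcM !rcB rc1; ring.
Qed.

Lemma hull_sub U p q r z : is_convex U -> U p -> U q -> U r -> hull p q r z -> U z.
Proof.
move=> cU up uq ur [a [b [a0 b0 ab ->]]].
have [b1|b1] := eqVneq b 1.
  rewrite b1 in ab *; have -> : a = 0 by lra.
  by rewrite rc0 mul0r addr0 rc1 mul1r addrC subrK.
have nb : 1 - b != 0 by rewrite subr_eq0 eq_sym.
have nb0 : 0 < 1 - b by rewrite lt_def nb /=; lra.
(* Project from r onto the side [p, q]; b = 1, the point r itself, was treated before because of the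
   division. *)
rewrite (_ : _ + _ = segm (segm p q (a / (1 - b))) r b).
  apply/cU => //; last by rewrite b0 /=; lra.
  apply/cU => //; rewrite divr_ge0 ?ler_pdivrMr //=; lra.
have -> : rc a = rc (1 - b) * rc (a / (1 - b)) by rewrite -rcM; congr rc; field.
by rewrite /segm rcB rc1; ring.
Qed.

Lemma hull_p p q r : hull p q r p.
Proof. by exists 0, 0; split; rewrite ?addr0 ?rc0 ?mul0r ?addr0. Qed.
Lemma hull_q p q r : hull p q r q.
Proof. by exists 1, 0; split; rewrite ?addr0 ?rc0 ?rc1 ?mul1r ?mul0r ?addr0 // addrC subrK. Qed.
Lemma hull_r p q r : hull p q r r.
Proof. by exists 0, 1; split; rewrite ?add0r ?rc0 ?rc1 ?mul1r ?mul0r ?addr0 // addrC subrK. Qed.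

Lemma hull_closed p q r u x : (forall n, hull p q r (u n)) -> cvc u x -> hull p q r x.
Proof.
move=> /choice[a /choice[b hab]] ux.
have [s hs [A hA]] : exists2 s, inc s & exists l, cvr (a \o s) l.
  apply: (bw_real (M := 1)) => n; have [a0 b0 ab _] := hab n.
  by rewrite ger0_norm//; lra.
have [t ht [B hB]] : exists2 t, inc t & exists l, cvr ((b \o s) \o t) l.
  apply: (bw_real (M := 1)) => n; have [a0 b0 ab _] := hab (s n).
  by rewrite /= ger0_norm//; lra.
have {}hA := cvr_sub hA ht.
have near (e : R) : 0 < e -> exists n, `|a n - A| < e /\ `|b n - B| < e /\ cmod (u n - x) < e.
  move=> e0; have [N1 h1] := hA e e0; have [N2 h2] := hB e e0.
  have [N3 h3] := cvc_sub (cvc_sub ux hs) ht e0.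
  exists (s (t (maxn N1 (maxn N2 N3)))); split; [|split].
  - by apply: h1; rewrite leq_maxl.
  - by apply: h2; rewrite !leq_max leqnn orbT.
  - by apply: h3; rewrite !leq_max leqnn !orbT.
exists A, B; split.
- apply/ler_addgt0Pr => e /near [n [+ _]]; have [a0 b0 ab _] := hab n.
  by rewrite ltr_norml => /andP[? ?]; lra.
- apply/ler_addgt0Pr => e /near [n [_ [+ _]]]; have [a0 b0 ab _] := hab n.
  by rewrite ltr_norml => /andP[? ?]; lra.
- apply/ler_addgt0Pr => e e0; have e2 : 0 < e / 2 by rewrite divr_gt0.
  have [n [+ [+ _]]] := near _ e2; have [a0 b0 ab _] := hab n.
  by rewrite !ltr_norml => /andP[? ?] /andP[? ?]; lra.
- apply/eqP; rewrite -subr_eq0 -cmod_eq0 eq_le cmod_ge0 andbT.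
  apply/ler_addgt0Pr => e e0; rewrite add0r.
  pose K := 1 + cmod (q - p) + cmod (r - p).
  have K0 : 0 < K by rewrite /K; have := cmod_ge0 (q - p); have := cmod_ge0 (r - p); lra.
  have eK : 0 < e / K by rewrite divr_gt0.
  have [n [h1 [h2 h3]]] := near _ eK; have [a0 b0 ab E] := hab n.
  rewrite (_ : x - _ = (x - u n) + (rc (a n - A) * (q - p) + rc (b n - B) * (r - p))); last first.
    by rewrite E !rcB; ring.
  apply: (le_trans (cmodD _ _)); have := cmodD (rc (a n - A) * (q - p)) (rc (b n - B) * (r - p)).
  rewrite !cmodM !cmod_rc (cmodBC x).
  have : e / K * K = e by rewrite divfK// gt_eqF.
  set E' := e / K in eK h1 h2 h3 *; rewrite /K.
  have m1 : `|a n - A| * cmod (q - p) <= E' * cmod (q - p) by rewrite ler_wpM2r ?cmod_ge0// ltW.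
  have m2 : `|b n - B| * cmod (r - p) <= E' * cmod (r - p) by rewrite ler_wpM2r ?cmod_ge0// ltW.
  by lra.
Qed.

Lemma pow2_inv (d e : R) : 0 < e -> exists n, d / 2 ^+ n < e.
Proof.
move=> e0; have [N /(_ N (leqnn _)) hN] := archi (d / e).
exists N; rewrite ltr_pdivrMr ?exprn_gt0// mulrC -ltr_pdivrMr//.
apply: (lt_le_trans hN); rewrite -natrX ler_nat; exact: ltnW (ltn_expl _ _).
Qed.

Theorem goursat U f p q r : is_convex U -> holo U f -> U p -> U q -> U r ->
  tint f p q r = 0.
Proof.
move=> cU hf up uq ur.
pose H := hull p q r; have HU z : H z -> U z by exact: hull_sub.
have cH : is_convex H by exact: hull_convex.
have cfU z : U z -> ccont f z by move=> Uz; have [l dl] := hf z Uz; exact: der_cont dl.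
have cf z : H z -> ccont f z by move=> /HU; exact: cfU.
pose P (t : C * C * C) := tint f t.1.1 t.1.2 t.2.
pose c (t : C * C * C) := perim t.1.1 t.1.2 t.2.
pose I (t : C * C * C) := [/\ H t.1.1, H t.1.2 & H t.2].
have /choice [nx hnx] : forall t : C * C * C, exists t' : C * C * C, I t ->
    [/\ I t', c t' = c t / 2, cmod (t'.1.1 - t.1.1) <= c t & cmod (P t) <= 4 * cmod (P t')].
  move=> t; have [it|] := pselect (I t); last by exists t.
  have [i1 i2 i3] := it.
  have [p' [q' [r' h]]] := tint_quarter cH cf i1 i2 i3.
  by exists (p', q', r').
pose s n := iter n nx (p, q, r).
have Is n : I (s n).
  elim: n => [|n IH]; first by split; [exact: hull_p|exact: hull_q|exact: hull_r].
  by have [] := hnx _ IH.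
have cs n : c (s n) = perim p q r / 2 ^+ n.
  elim: n => [|n IH]; first by rewrite expr0 divr1.
  by have [_ -> _ _] := hnx _ (Is n); rewrite IH exprSr invfM mulrA.
have Ps n : cmod (tint f p q r) <= 4 ^+ n * cmod (P (s n)).
  elim: n => [|n IH]; first by rewrite expr0 mul1r.
  apply: (le_trans IH); have [_ _ _ h] := hnx _ (Is n).
  by rewrite exprSr -mulrA ler_wpM2l// exprn_ge0.
have c0 n : 0 <= c (s n) by exact: perim_ge0.
(* A telescoping bound: the perimeter halves at each step, so it equals twice its own decrease. *)
have dist n k : cmod ((s (n + k)%N).1.1 - (s n).1.1) <= 2 * (c (s n) - c (s (n + k)%N)).
  elim: k => [|k IH]; first by rewrite addn0 !subrr cmod0 mulr0.
  rewrite addnS; apply: (le_trans (cmod_tri _ (s (n + k)%N).1.1 _)).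
  have [_ e h _] := hnx _ (Is (n + k)%N).
  by rewrite -/(s (n + k).+1) /= in e *; rewrite e; lra.
have small e : 0 < e -> exists n, c (s n) < e.
  by move=> /(pow2_inv (perim p q r)) [n hn]; exists n; rewrite cs.
have [x hx] : exists x, cvc (fun n => (s n).1.1) x.
  apply: cauchyc_cvc => e e0; have [|n hn] := small (e / 4); first by rewrite divr_gt0.
  exists n => i j ni nj; have := dist n (i - n)%N; have := dist n (j - n)%N.
  rewrite !subnKC// => h1 h2.
  apply: (le_lt_trans (cmod_tri _ (s n).1.1 _)); rewrite (cmodBC (s n).1.1).
  by have := c0 i; have := c0 j; lra.
have Hx : H x by apply: hull_closed hx => n; case: (Is n).
have xn n : cmod ((s n).1.1 - x) <= 2 * c (s n).
  rewrite cmodBC.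
  have hx' : cvc (fun k => (s k).1.1 - (s n).1.1) (x - (s n).1.1).
    move=> e /hx [N hN]; exists N => k /hN.
    by rewrite (_ : _ - _ - _ = (s k).1.1 - x)//; ring.
  apply: (cvc_le hx'); exists n => k nk; have := dist n (k - n)%N; rewrite subnKC//.
  by have := c0 k; lra.
have [l dl] := hf _ (HU _ Hx).
apply/eqP; rewrite -cmod_eq0 eq_le cmod_ge0 andbT; apply/ler_addgt0Pr => e e0; rewrite add0r.
set d := perim p q r in cs.
have d0 : 0 <= d by exact: perim_ge0.
(* After n subdivisions the integral is at most 4^n e' (3 c) c with c = d / 2^n, which is 3 d^2 e'.
   The summand 1 covers d = 0. *)
pose e' := e / (3 * d ^+ 2 + 1).
have K0 : 0 < 3 * d ^+ 2 + 1 by rewrite ltr_wpDl// mulr_ge0// sqr_ge0.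
have e'0 : 0 < e' by rewrite divr_gt0.
have [dl0 dl00 hd] := dl _ e'0.
have [|n hn] := small (dl0 / 3); first by rewrite divr_gt0.
have [i1 i2 i3] := Is n.
set a := (s n).1.1 in i1; set b := (s n).1.2 in i2; set g := (s n).2 in i3.
have an := xn n; rewrite -/a in an.
have cn : c (s n) = cmod (b - a) + cmod (g - b) + cmod (a - g) by [].
(* A is the tangent approximation of f at x and B, below, a primitive of A; the increments of B
   around the triangle cancel. *)
pose A z := f x + l * (z - x).
pose B z := f x * z + l * ((z - x) ^+ 2 / 2).
have dB z : cder B z (A z).
  rewrite /B /A; apply: (der_eq (derD (derZ (f x) (der_i _ z))
    (derZ l (derM (derX 2 (derB (der_i _ z) (der_cst _ x z))) (der_cst _ (2^-1) z))))).
  by rewrite mulr1 mulr0 addr0 subr0 mulr1 /=; field.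
have dA z : ccont A z.
  apply: contD; first exact: cont_cst.
  by apply: contM; [exact: cont_cst|apply: contB; [exact: cont_i|exact: cont_cst]].
have hs u v : H u -> H v -> cmod (u - x) <= 3 * c (s n) -> cmod (v - x) <= 3 * c (s n) ->
    cmod (sint f u v - (B v - B u)) <= e' * (3 * c (s n)) * cmod (v - u).
  move=> Hu Hv ux vx.
  have E1 : sint f u v = sint (fun z => (f z - A z) + A z) u v.
    have -> : (fun z => (f z - A z) + A z) = f by apply/funext => z; rewrite subrK.
    by [].
  have cAf z : H z -> ccont (fun z => f z - A z) z by move=> Hz; apply: contB; [exact: cf|exact: dA].
  rewrite E1 sintD; last 2 first.
  - exact: cseg_in cH cAf _ _ Hu Hv.
  - by move=> t _; exact: dA.
  rewrite (sint_prim (f := A) (g := B)) ?addrK; last by move=> t _; exact: dB.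
  apply: sint_bound; first exact: cseg_in cH cAf _ _ Hu Hv.
  move=> t /andP[t0 t1].
  have tx : cmod (segm u v t - x) <= 3 * c (s n).
    by apply: segm_near => //; rewrite t0.
  have := hd (segm u v t); rewrite (_ : f _ - f x - _ = f (segm u v t) - A (segm u v t)); last first.
    by rewrite /A; ring.
  move=> h; apply: (le_trans (h _)); first by lra.
  by rewrite ler_wpM2l// ltW.
have ab3 : cmod (b - x) <= 3 * c (s n).
  have := cmod_tri b a x; have := cmod_ge0 (g - b); have := cmod_ge0 (a - g); lra.
have ag3 : cmod (g - x) <= 3 * c (s n).
  have := cmod_tri g a x; rewrite (cmodBC g a); have := cmod_ge0 (g - b); have := cmod_ge0 (b - a); lra.
have aa3 : cmod (a - x) <= 3 * c (s n) by have := c0 n; lra.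
have h1 := hs _ _ i1 i2 aa3 ab3; have h2 := hs _ _ i2 i3 ab3 ag3; have h3 := hs _ _ i3 i1 ag3 aa3.
have PT : cmod (P (s n)) <= e' * (3 * c (s n)) * c (s n).
  rewrite (_ : P (s n) = (sint f a b - (B b - B a)) + (sint f b g - (B g - B b)) + (sint f g a - (B a - B g))); last first.
    by rewrite /P /tint -/a -/b -/g; ring.
  apply: (le_trans (cmodD _ _)); have := cmodD (sint f a b - (B b - B a)) (sint f b g - (B g - B b)).
  by rewrite [X in _ <= _ * X]cn; move: h1 h2 h3; clear; rewrite !mulrDr; lra.
apply: (le_trans (Ps n)).
have n0 : (4 : R) ^+ n = 2 ^+ n * 2 ^+ n by rewrite -exprMn; congr (_ ^+ _); ring.
have n1 : (0 : R) < 2 ^+ n by rewrite exprn_gt0.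
have : 4 ^+ n * cmod (P (s n)) <= 4 ^+ n * (e' * (3 * c (s n)) * c (s n)).
  by rewrite ler_wpM2l// exprn_ge0.
move=> /le_trans; apply.
rewrite cs n0 (_ : _ * _ = e' * (3 * d ^+ 2)); last by field; rewrite gt_eqF.
rewrite /e' mulrAC ler_pdivrMr// ler_wpM2l ?ltW//.
by rewrite ltrDl.
Qed.

End Integration.

Section Cauchy.
Variables (R : realType).
Local Notation C := (Cplx R).
Local Notation rder := (der (@rc R)).
Local Notation cder := (der (fun z : C => z)).
Local Notation ccont := (cont (fun z : C => z)).

Lemma sint_approx (f : C -> C) p q c (e : R) : cseg f p q ->
  (forall t, 0 <= t <= 1 -> cmod (f (segm p q t) - c) <= e) ->
  cmod (sint f p q - c * (q - p)) <= e * cmod (q - p).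
Proof.
move=> cf h; have [F dF ->] := sintP cf.
have dG t : 0 <= t <= 1 -> rder (fun t => F t - rc t * (c * (q - p))) t
    ((f (segm p q t) - c) * (q - p)).
  move=> /dF d; apply: (der_eq (derB d (derM (der_i _ t) (der_cst _ (c * (q - p)) t)))).
  by ring.
have := mvt_ineq ler01 dG (M := e * cmod (q - p)).
rewrite rc1 rc0 mul1r mul0r !subr0 mulr1 (_ : F 1 - _ - _ = F 1 - F 0 - c * (q - p)); last by ring.
by apply => t /h ht; rewrite cmodM ler_wpM2r// cmod_ge0.
Qed.

(** The primitive is the integral from z0. Vanishing triangle integrals make its increment from z to
    w the integral over [z, w], where f is close to f z. *)
Lemma primitive_of_tint (U : C -> Prop) (f : C -> C) z0 : is_convex U -> open_set U ->
  U z0 -> (forall z, U z -> ccont f z) ->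
  (forall p q r, U p -> U q -> U r -> tint f p q r = 0) ->
  exists F, forall z, U z -> cder F z (f z).
Proof.
move=> cU oU Uz0 cf T0; exists (sint f z0) => z Uz e e0.
have [d1 d10 h1] := oU _ Uz; have [d2 d20 h2] := cf _ Uz _ e0.
exists (Num.min d1 d2); first by rewrite lt_min d10.
move=> w; rewrite lt_min => /andP[wd1 wd2]; have Uw := h1 _ wd1.
have E : sint f z0 w - sint f z0 z = sint f z w.
  have := T0 _ _ _ Uz0 Uz Uw; rewrite /tint (sint_sym (p := z0) (q := w)).
    by move=> /eqP; rewrite subr_eq0 => /eqP <-; ring.
  exact: (@cseg_in _ U f cU cf).
rewrite E; apply: sint_approx; first exact: (@cseg_in _ U f cU cf).
move=> t ht; apply/ltW/h2; apply: le_lt_trans wd2.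
exact: cmod_segm.
Qed.

Lemma dot_comb (n z w : C) (a b : R) :
  Re n * Re (rc a * z + rc b * w) + Im n * Im (rc a * z + rc b * w) =
  a * (Re n * Re z + Im n * Im z) + b * (Re n * Re w + Im n * Im w).
Proof. by rewrite ReD ImD !Re_rcM !Im_rcM; ring. Qed.

Section Exceptional.
Variables (U : C -> Prop) (f : C -> C) (b : C).
Hypothesis cU : is_convex U.
Hypothesis cf : forall z, U z -> ccont f z.
Hypothesis df : forall z, U z -> z != b -> exists l, cder f z l.
Hypothesis Ub : U b.

Let cs p q : U p -> U q -> cseg f p q.
Proof. exact: (@cseg_in _ U f cU cf). Qed.

Lemma tint_flat p q s : U p -> U q -> 0 <= s <= 1 -> tint f (segm p q s) p q = 0.
Proof.
move=> up uq hs; have ub : U (segm p q s) by exact: cU.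
rewrite /tint (sint_split (cs up uq) hs) (sint_sym (cs up ub)) (sint_sym (cs ub uq)).
by ring.
Qed.

(** If b lies on [p, q] the triangle is flat. Otherwise n bisects the angle at b, and p, q lie in an
    open half-plane with b on its boundary, where f is differentiable. Cutting a small triangle off
    at b leaves two triangles in that half-plane, and the small one contributes little because f is
    bounded near b. *)
Lemma tint_vertex p q : U p -> U q -> tint f b p q = 0.
Proof.
move=> up uq; set u := p - b; set v := q - b.
pose n := rc (cmod v) * u + rc (cmod u) * v.
pose K := cmod u * cmod v + (Re u * Re v + Im u * Im v).
have En : cmod n ^+ 2 = 2 * (cmod u * cmod v) * K.
  rewrite sqr_cmod /n ReD ImD !Re_rcM !Im_rcM /K.
  have := sqr_cmod u; have := sqr_cmod v.
  set m := cmod u; set k := cmod v => hv hu.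
  rewrite (_ : _ + _ = k ^+ 2 * (Re u ^+ 2 + Im u ^+ 2) + m ^+ 2 * (Re v ^+ 2 + Im v ^+ 2)
     + 2 * (m * k) * (Re u * Re v + Im u * Im v)); last by ring.
  by rewrite -hu -hv; ring.
have [n0|n0] := eqVneq n 0.
  have [u0|u0] := eqVneq u 0.
    have -> : p = b by apply/eqP; rewrite -subr_eq0 -/u u0.
    by rewrite /tint sintxx (sint_sym (cs Ub uq)); ring.
  have mu : 0 < cmod u by rewrite cmod_gt0.
  have mv := cmod_ge0 v.
  pose s := cmod u / (cmod u + cmod v).
  have muv : 0 < cmod u + cmod v by lra.
  have hs : 0 <= s <= 1.
    by rewrite /s divr_ge0 ?ler_pdivrMr ?mul1r ?lerDl //=; lra.
  have -> : b = segm p q s; last exact: tint_flat.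
  apply: (@mulfI _ (rc (cmod u + cmod v))); first by rewrite rc_eq0 gt_eqF.
  rewrite /segm mulrDr mulrA -rcM.
  have -> : (cmod u + cmod v) * s = cmod u by rewrite /s; field; rewrite gt_eqF.
  have -> : rc (cmod u + cmod v) * p + rc (cmod u) * (q - p) = rc (cmod u + cmod v) * b + n.
    by rewrite /n /u /v rcD; ring.
  by rewrite n0 addr0.
have K0 : 0 < K.
  have : 0 < cmod n ^+ 2 by rewrite exprn_gt0// cmod_gt0.
  rewrite En => h; rewrite ltNge; apply/negP => K0.
  have : 0 <= 2 * (cmod u * cmod v) by rewrite mulr_ge0// mulr_ge0// cmod_ge0.
  by nra.
have u0 : u != 0.
  by apply: contra_neq n0 => u0; rewrite /n u0 cmod0 rc0 mulr0 mul0r addr0.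
have v0 : v != 0.
  by apply: contra_neq n0 => v0; rewrite /n v0 cmod0 rc0 mulr0 mul0r addr0.
pose dot z := Re n * Re z + Im n * Im z.
have dotu : 0 < dot u.
  rewrite (_ : dot u = cmod u * K) ?mulr_gt0 ?cmod_gt0//.
  rewrite /dot /n ReD ImD !Re_rcM !Im_rcM /K.
  have := sqr_cmod u; set m := cmod u; set k := cmod v => hu.
  transitivity (k * m ^+ 2 + m * (Re u * Re v + Im u * Im v)); last by ring.
  rewrite hu; ring.
have dotv : 0 < dot v.
  rewrite (_ : dot v = cmod v * K) ?mulr_gt0 ?cmod_gt0//.
  rewrite /dot /n ReD ImD !Re_rcM !Im_rcM /K.
  have := sqr_cmod v; set m := cmod u; set k := cmod v => hv.
  transitivity (m * k ^+ 2 + k * (Re u * Re v + Im u * Im v)); last by ring.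
  rewrite hv; ring.
pose V z := U z /\ 0 < dot (z - b).
have cV : is_convex V.
  move=> z w t [Uz dz] [Uw dw] /[dup] ht /andP[t0 t1]; split; first exact: cU.
  rewrite (_ : dot _ = (1 - t) * dot (z - b) + t * dot (w - b)); last first.
    rewrite (_ : segm z w t - b = rc (1 - t) * (z - b) + rc t * (w - b)).
      exact: dot_comb.
    by rewrite /segm rcB rc1; ring.
  by nra.
have hV : holo V f.
  move=> z [Uz dz]; apply: df => //; apply/eqP => zb; move: dz.
  by rewrite zb subrr /dot /= !mulr0 addr0 ltxx.
have Vp : V p by []. have Vq : V q by [].
pose P := perim b p q.
have P0 : 0 <= P by exact: perim_ge0.
have uP : cmod u <= P by rewrite /P /perim -/u; have := cmod_ge0 (q - p); have := cmod_ge0 (b - q); lra.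
have vP : cmod v <= P by rewrite /P /perim (cmodBC b q) -/v; have := cmod_ge0 (q - p); have := cmod_ge0 (p - b); lra.
have [d d0 hd] := cf Ub ltr01.
pose M := cmod (f b) + 1.
have hM z : cmod (z - b) < d -> cmod (f z) <= M.
  by move=> /hd; have := cmod_sub_ge (f z) (f b); rewrite /M; lra.
have M0 : 0 <= M by rewrite /M; have := cmod_ge0 (f b); lra.
apply/eqP; rewrite -cmod_eq0 eq_le cmod_ge0 andbT; apply/ler_addgt0Pr => e e0; rewrite add0r.
pose s := Num.min 2^-1 (Num.min (d / (P + 1) / 2) (e / (M * P + 1))).
have P1 : 0 < P + 1 by lra.
have MP1 : 0 < M * P + 1 by rewrite ltr_wpDl// mulr_ge0.
have s0 : 0 < s by rewrite !lt_min invr_gt0 ltr0n /= !divr_gt0.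
have s1 : s <= 2^-1 by rewrite ge_min lexx.
have s2 : s <= d / (P + 1) / 2 by rewrite !ge_min lexx orbT.
have s3 : s <= e / (M * P + 1) by rewrite !ge_min lexx !orbT.
have hs : 0 <= s <= 1 by rewrite ltW//=; lra.
pose p' := segm b p s; pose q' := segm b q s.
have up' : U p' by exact: cU. have uq' : U q' by exact: cU.
have Vp' : V p'.
  split=> //; rewrite (_ : p' - b = rc s * u); last by rewrite /p' /segm /u; ring.
  by rewrite /dot Re_rcM Im_rcM mulrCA [X in _ + X]mulrCA -mulrDr mulr_gt0.
have Vq' : V q'.
  split=> //; rewrite (_ : q' - b = rc s * v); last by rewrite /q' /segm /v; ring.
  by rewrite /dot Re_rcM Im_rcM mulrCA [X in _ + X]mulrCA -mulrDr mulr_gt0.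
have T1 := goursat cV hV Vp' Vp Vq.
have T2 := goursat cV hV Vp' Vq Vq'.
have E : tint f b p q = tint f b p' q'.
  move: T1 T2; rewrite /tint (sint_split (cs Ub up) hs) -/p'.
  rewrite (sint_sym (cs Ub uq)) (sint_split (cs Ub uq) hs) -/q'.
  rewrite (sint_sym (cs up' uq)) (sint_sym (cs uq' uq)) (sint_sym (cs Ub uq')) (sint_sym (cs up' uq')).
  set A := sint f b p'; set B := sint f p' p; set D := sint f p q.
  set G := sint f p' q; set H := sint f b q'; set I := sint f q' q; set J := sint f p' q'.
  move=> h1 h2; apply/eqP; rewrite -subr_eq0.
  rewrite (_ : _ - _ = (B + D - G) + (G - I - J)); last by ring.
  by rewrite h1 h2 addr0.
rewrite E.
have sd : s * (P + 1) <= d / 2.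
  by rewrite -ler_pdivlMr// (le_trans s2)// mulrAC.
have sP : s * P < d by nra.
have p'b : cmod (p' - b) = s * cmod u.
  by rewrite /p' /segm addrC addKr cmodM cmod_rc gtr0_norm.
have q'b : cmod (q' - b) = s * cmod v.
  by rewrite /q' /segm addrC addKr cmodM cmod_rc gtr0_norm.
have p'd : cmod (p' - b) <= s * P by rewrite p'b ler_pM2l.
have q'd : cmod (q' - b) <= s * P by rewrite q'b ler_pM2l.
have bd : cmod (b - b) <= s * P by rewrite subrr cmod0 mulr_ge0// ltW.
have bnd z w : U z -> U w -> cmod (z - b) <= s * P -> cmod (w - b) <= s * P ->
    cmod (sint f z w) <= M * cmod (w - z).
  move=> Uz Uw zP wP; apply: sint_bound => [|t ht]; first exact: cs.
  by apply: hM; apply: le_lt_trans sP; apply: segm_near.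
have b1 := bnd _ _ Ub up' bd p'd; have b2 := bnd _ _ up' uq' p'd q'd; have b3 := bnd _ _ uq' Ub q'd bd.
have pe : cmod (p' - b) + cmod (q' - p') + cmod (b - q') = s * P.
  rewrite (cmodBC b q') p'b q'b (_ : q' - p' = rc s * (q - p)); last by rewrite /p' /q' /segm; ring.
  by rewrite cmodM cmod_rc gtr0_norm// /P /perim -/u (cmodBC b q) -/v; ring.
have : cmod (tint f b p' q') <= M * (s * P).
  rewrite -pe /tint !mulrDr.
  apply: (le_trans (cmodD _ _)); apply: lerD b3.
  by apply: (le_trans (cmodD _ _)); apply: lerD.
move=> /le_trans; apply.
have : s * (M * P + 1) <= e by rewrite -ler_pdivlMr.
by move: (ltW s0); clear; move=> s0; rewrite (_ : M * (s * P) = s * (M * P)); [lra|ring].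
Qed.

(** The boundary of the triangle is the sum of the boundaries of the three triangles with apex b. *)
Lemma tint_exceptional p q r : U p -> U q -> U r -> tint f p q r = 0.
Proof.
move=> up uq ur; have := tint_vertex up uq; have := tint_vertex uq ur; have := tint_vertex ur up.
rewrite /tint (sint_sym (cs Ub up)) (sint_sym (cs Ub uq)) (sint_sym (cs Ub ur)).
move=> h1 h2 h3.
transitivity ((sint f b p + sint f p q - sint f b q) + (sint f b q + sint f q r - sint f b r)
  + (sint f b r + sint f r p - sint f b p)); first by ring.
by rewrite h1 h2 h3 !addr0.
Qed.

(** Meant for difference quotients (f z - f b) / (z - b), which extend continuously to b but are not
    yet known to be differentiable there. *)
Lemma primitive_exceptional : open_set U -> exists F, forall z, U z -> cder F z (f z).
Proof. by move=> oU; apply: primitive_of_tint Ub cf tint_exceptional. Qed.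

End Exceptional.

Lemma primitive_convex (U : C -> Prop) f z0 : is_convex U -> open_set U -> U z0 -> holo U f ->
  exists F, forall z, U z -> cder F z (f z).
Proof.
move=> cU oU Uz0 hf; apply: (primitive_of_tint cU oU Uz0) => [z Uz|p q r up uq ur].
  by have [l dl] := hf _ Uz; exact: der_cont dl.
exact: goursat cU hf up uq ur.
Qed.

End Cauchy.

(** * The exponential function *)

Section ComplexExp.
Variables (R : realType).
Local Notation C := (Cplx R).
Local Notation rder := (der (@rc R)).
Local Notation cder := (der (fun z : C => z)).
Local Notation ccont := (cont (fun z : C => z)).

Definition cexp (z : C) : C := Complex (expR (Re z) * cos (Im z)) (expR (Re z) * sin (Im z)).

Lemma cexpD z w : cexp (z + w) = cexp z * cexp w.
Proof.
by apply: Ceq; rewrite /cexp /= ReD ImD expRD ?cosD ?sinD; ring.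
Qed.

Lemma cexp0 : cexp 0 = 1.
Proof. by apply: Ceq; rewrite /= expR0 ?cos0 ?sin0 mul1r. Qed.

Lemma cmod_cexp z : cmod (cexp z) = expR (Re z).
Proof.
by rewrite cmodE /= !exprMn -mulrDr cos2Dsin2 mulr1 sqrtr_sqr gtr0_norm// expR_gt0.
Qed.

Lemma cexp_neq0 z : cexp z != 0.
Proof. by rewrite -cmod_gt0 cmod_cexp expR_gt0. Qed.

Lemma cexpN z : cexp (- z) = (cexp z)^-1.
Proof. by apply: (mulfI (cexp_neq0 z)); rewrite -cexpD subrr cexp0 divff// cexp_neq0. Qed.

Lemma cexp_nat n z : cexp (n%:R * z) = cexp z ^+ n.
Proof.
by elim: n => [|n IH]; rewrite ?mul0r ?cexp0// exprS -IH -cexpD -natr1 mulrDl mul1r addrC.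
Qed.

Definition twopi_i : C := Complex 0 (pi *+ 2).

Lemma cexp_2pi : cexp twopi_i = 1.
Proof. by apply: Ceq; rewrite /= expR0 mul1r ?cos2pi ?sin2pi. Qed.

Lemma twopi_i_neq0 : twopi_i != 0.
Proof.
rewrite -cmod_gt0 cmodE /= expr0n add0r sqrtr_sqr normr_gt0.
by rewrite mulrn_eq0 /= gt_eqF// pi_gt0.
Qed.

(** The arc cosine determines the argument up to sign, and the sign of Im w decides. *)
Lemma cexp_surj w : w != 0 -> exists2 z, cexp z = w & `|Im z| <= pi.
Proof.
rewrite -cmod_gt0 => w0.
pose x := Re w / cmod w; pose y := Im w / cmod w.
have xy : x ^+ 2 + y ^+ 2 = 1.
  by rewrite /x /y !expr_div_n -mulrDl -sqr_cmod divff// expf_neq0// gt_eqF.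
have x1 : -1 <= x <= 1.
  rewrite -ler_norml normrM normfV (ger0_norm (ltW w0)) ler_pdivrMr// mul1r.
  exact: Re_le_cmod.
have lnw : expR (ln (cmod w)) = cmod w by rewrite lnK// posrE.
have hs : sin (acos x) = `|y|.
  by rewrite sin_acos// (_ : 1 - x ^+ 2 = y ^+ 2) ?sqrtr_sqr// -xy addrAC subrr add0r.
have pi0 := acos_ge0 x1; have pi1 := acos_lepi x1.
have wx : cmod w * x = Re w by rewrite mulrC divfK// gt_eqF.
have wy : cmod w * y = Im w by rewrite mulrC divfK// gt_eqF.
have xin : x \in `[-1, 1] by rewrite in_itv.
have [y0|y0] := leP 0 y.
  exists (Complex (ln (cmod w)) (acos x)) => /=; last by rewrite ger0_norm.
  by apply: Ceq; rewrite /= lnw ?acosK// hs ger0_norm.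
exists (Complex (ln (cmod w)) (- acos x)) => /=; last by rewrite normrN ger0_norm.
by apply: Ceq; rewrite /= lnw ?cosN ?acosK// sinN hs ltr0_norm// opprK.
Qed.

Lemma cder_cexp0 : cder cexp 0 1.
Proof.
(* The error terms for the real and imaginary parts add up to (1 + 2 + 2 + 2) e' |z|. *)
move=> e e0; pose e' := Num.min (2^-1) (e / 7).
have e'0 : 0 < e' by rewrite lt_min invr_gt0 ltr0n /= divr_gt0.
have e'2 : e' <= 2^-1 by rewrite ge_min lexx.
have e'7 : e' * 7 <= e by rewrite -ler_pdivlMr// ge_min lexx orbT.
have [d1 d10 h1] := derivable_eps (@derivable_expR R 0) e'0.
have [d2 d20 h2] := derivable_eps (@derivable_cos R 0) e'0.
have [d3 d30 h3] := derivable_eps (@derivable_sin R 0) e'0.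
exists (Num.min e' (Num.min d1 (Num.min d2 d3))); first by rewrite lt_min e'0 lt_min d10 lt_min d20.
move=> z; rewrite subr0 lt_min => /andP[ze]; rewrite lt_min => /andP[z1]; rewrite lt_min => /andP[z2 z3].
have xz := Re_le_cmod z; have yz := Im_le_cmod z.
set x := Re z in xz; set y := Im z in yz.
have := h1 x; rewrite subr0 => /(_ (le_lt_trans xz z1)).
have := h2 y; rewrite subr0 => /(_ (le_lt_trans yz z2)).
have := h3 y; rewrite subr0 => /(_ (le_lt_trans yz z3)).
rewrite !derive1E !derive_val expR0 cos0 sin0 oppr0 mul0r !subr0 !mul1r => k3 k2 k1; rewrite addr0 in k3.
rewrite cexp0; apply: le_trans (cmod_le_ReIm _) _.
rewrite !ReB !ImB /= -/x -/y subr0.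
have E1 : `|expR x| <= 2.
  rewrite gtr0_norm ?expR_gt0//.
  have := ler_norm (expR x - 1 - x); have := ler_norm x; have := normr_ge0 x.
  by nra.
have E2 : `|expR x - 1| <= 2 * `|x|.
  rewrite (_ : expR x - 1 = (expR x - 1 - x) + x); last by ring.
  by rewrite (le_trans (ler_normD _ _))//; have := normr_ge0 x; nra.
have A : `|expR x * cos y - 1 - x| <= e' * `|x| + 2 * (e' * `|y|).
  rewrite (_ : _ - x = (expR x - 1 - x) + expR x * (cos y - 1)); last by ring.
  by rewrite (le_trans (ler_normD _ _))// lerD// normrM ler_pM.
have B : `|expR x * sin y - y| <= 2 * (e' * `|y|) + 2 * `|x| * `|y|.
  rewrite (_ : _ - y = expR x * (sin y - y) + (expR x - 1) * y); last by ring.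
  by rewrite (le_trans (ler_normD _ _))// !normrM lerD// ?ler_pM// ler_wpM2r.
have xy : `|x| * `|y| <= e' * `|y| by rewrite ler_wpM2r// (le_trans xz)// ltW.
have yy : e' * `|y| <= e' * cmod z by rewrite ler_wpM2l// ltW.
have xx : e' * `|x| <= e' * cmod z by rewrite ler_wpM2l// ltW.
have : e' * 7 * cmod z <= e * cmod z by rewrite ler_wpM2r// cmod_ge0.
lra.
Qed.

Lemma cder_cexp z : cder cexp z (cexp z).
Proof.
have h : cder (fun w => cexp z * cexp (w - z)) z (cexp z * (1 * 1)).
  apply: derZ; apply: (@der_comp R C id cexp (fun w => w - z)).
    by rewrite subrr; exact: cder_cexp0.
  by apply: (der_eq (derB (der_i _ z) (der_cst _ z z))); rewrite subr0.
apply: (der_near (der_eq h _)); first by rewrite !mulr1.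
by exists 1 => // w _; rewrite -cexpD addrC subrK.
Qed.

End ComplexExp.

(** * Cauchy's formula and its consequences *)

Section CauchyFormula.
Variables (R : realType).
Local Notation C := (Cplx R).
Local Notation rder := (der (@rc R)).
Local Notation cder := (der (fun z : C => z)).
Local Notation ccont := (cont (fun z : C => z)).
Local Notation rcont := (cont (@rc R)).

Definition disc (a : C) (r : R) (z : C) : Prop := cmod (z - a) < r.

Lemma disc_convex a r : is_convex (disc a r).
Proof.
move=> p q t; rewrite /disc => pr qr ht.
apply: le_lt_trans (segm_near (c := Num.max (cmod (p - a)) (cmod (q - a))) _ _ ht) _.
- by rewrite le_max lexx.
- by rewrite le_max lexx orbT.
- by rewrite gt_max pr qr.
Qed.

Lemma disc_open a r : open_set (disc a r).
Proof.
move=> p pr; exists (r - cmod (p - a)); first by rewrite subr_gt0.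
move=> z; rewrite ltrBrDr => zr; apply: le_lt_trans zr.
exact: cmod_tri.
Qed.

Lemma disc_center a r : 0 < r -> disc a r a.
Proof. by rewrite /disc subrr cmod0. Qed.

Lemma holo_sub (U V : C -> Prop) (f : C -> C) :
  (forall z, V z -> U z) -> holo U f -> holo V f.
Proof. by move=> VU hf z /VU /hf. Qed.

Lemma holo_cont (U : C -> Prop) (f : C -> C) z : holo U f -> U z -> ccont f z.
Proof. by move=> hf Uz; have [l dl] := hf _ Uz; exact: der_cont dl. Qed.

(** The norm on R[i] takes its values in R[i]; [nE] rewrites it as a real modulus, here and in the
    next two lemmas. *)
Lemma cder_derive1 (f : C -> C) z l : cder f z l -> derive1 f z = l.
Proof.
move=> dl.
have nE (w : C) : `|w| = (cmod w)%:C%C by case: w.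
have [|_ //] := @eps_derivable R[i] f z l.
move=> e; rewrite ltcE /= => /andP[/eqP ie e0].
have [d d0 hd] := dl _ e0; exists d%:C%C; first by rewrite ltcR.
move=> w; rewrite nE ltcR => /hd h.
rewrite !nE (_ : e = (complex.Re e)%:C%C) -?rmorphM ?lecR//.
by move: ie; case: (e) => x y /= ->.
Qed.

Lemma derivable_cder (f : C -> C) z : derivable f z 1 -> cder f z (derive1 f z).
Proof.
move=> df e e0.
have nE (w : C) : `|w| = (cmod w)%:C%C by case: w.
have [|d d0 hd] := @derivable_eps R[i] f z df (e%:C%C); first by rewrite ltcR.
move: d0; rewrite ltcE /= => /andP[/eqP id d0].
exists (complex.Re d) => // w wd; have := hd w.
rewrite !nE -rmorphM lecR; apply.
rewrite (_ : d = (complex.Re d)%:C%C) ?ltcR//.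
by move: id; case: (d) => x y /= ->.
Qed.

Lemma cder_derivable (f : C -> C) z l : cder f z l -> derivable f z 1.
Proof.
move=> dl.
have nE (w : C) : `|w| = (cmod w)%:C%C by case: w.
have [|//] := @eps_derivable R[i] f z l.
move=> e; rewrite ltcE /= => /andP[/eqP ie e0].
have [d d0 hd] := dl _ e0; exists d%:C%C; first by rewrite ltcR.
move=> w; rewrite nE ltcR => /hd h.
rewrite !nE (_ : e = (complex.Re e)%:C%C) -?rmorphM ?lecR//.
by move: ie; case: (e) => x y /= ->.
Qed.

Lemma holo_der (U : C -> Prop) f z : holo U f -> U z -> cder f z (derive1 f z).
Proof. by move=> hf /hf[l dl]; rewrite (cder_derive1 dl). Qed.

(** The integral over [0, 1] is cast as a segment integral in order to inherit the uniqueness in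
    [sint_relE]. *)
Definition cint (f : R -> C) : C := sint (fun z => f (Re z)) 0 1.

Lemma cint_eq (f F : R -> C) : (forall t, 0 <= t <= 1 -> rder F t (f t)) -> cint f = F 1 - F 0.
Proof.
move=> dF; apply: sint_relE; exists F => // t /dF d.
by apply: (der_eq d); rewrite /segm !subr0 mulr1 add0r mulr1.
Qed.

Lemma cintP (f : R -> C) : (forall t, 0 <= t <= 1 -> rcont f t) ->
  exists2 F, forall t, 0 <= t <= 1 -> rder F t (f t) & cint f = F 1 - F 0.
Proof.
move=> cf; have [F dF] := curve_primitive ler01 cf.
by exists F => //; exact: cint_eq.
Qed.

Lemma cintZ (f : R -> C) c : (forall t, 0 <= t <= 1 -> rcont f t) ->
  cint (fun t => c * f t) = c * cint f.
Proof.
move=> /cintP[F dF ->]; rewrite (@cint_eq _ (fun t => c * F t)); first by ring.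
by move=> t ht; apply: derZ; exact: dF.
Qed.

Lemma cintB (f g : R -> C) : (forall t, 0 <= t <= 1 -> rcont f t) ->
  (forall t, 0 <= t <= 1 -> rcont g t) -> cint (fun t => f t - g t) = cint f - cint g.
Proof.
move=> /cintP[F dF ->] /cintP[G dG ->]; rewrite (@cint_eq _ (fun t => F t - G t)); first by ring.
by move=> t ht; apply: derB; [exact: dF|exact: dG].
Qed.

Lemma cint_bound (f : R -> C) M : (forall t, 0 <= t <= 1 -> rcont f t) ->
  (forall t, 0 <= t <= 1 -> cmod (f t) <= M) -> cmod (cint f) <= M.
Proof.
move=> /cintP[F dF ->] hM; have := mvt_ineq ler01 dF hM.
by rewrite subr0 mulr1.
Qed.

Lemma curve_bounded (f : R -> C) : (forall t, 0 <= t <= 1 -> rcont f t) ->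
  exists2 M, 0 < M & forall t, 0 <= t <= 1 -> cmod (f t) <= M.
Proof.
move=> cf; apply: contrapT => hn.
have /choice[u hu] : forall n : nat, exists t, 0 <= t <= 1 /\ n%:R < cmod (f t).
  move=> n; apply: contrapT => hn'; apply: hn; exists (n.+1%:R) => // t ht.
  rewrite leNgt; apply/negP => h; apply: hn'; exists t; split=> //.
  by apply: lt_trans h; rewrite ltr_nat.
have [|s hs [l hl]] := @bw_real R u 1.
  by move=> n; have [/andP[? ?] _] := hu n; rewrite ger0_norm.
have l01 : 0 <= l <= 1.
  apply/andP; split; apply/ler_addgt0Pr => e /hl[N /(_ N (leqnn _))] /=;
  have [/andP[? ?] _] := hu (s N); rewrite ltr_norml => /andP[? ?]; lra.
have [d d0 hd] := cf _ l01 1 ltr01.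
have [N hN] := hl _ d0; have [N' hN'] := archi (cmod (f l) + 1).
pose n := maxn N N'.
have := hd (u (s n)); rewrite -rcB cmod_rc => /(_ (hN _ (leq_maxl _ _))).
have [_] := hu (s n); have := hN' (s n) (leq_trans (leq_maxr _ _) (inc_ge hs n)).
by have := cmod_sub_ge (f (u (s n))) (f l); lra.
Qed.

Section CauchyTransform.
Variables (phi g : R -> C) (r : R) (b : C).
Hypothesis cphi : forall t, 0 <= t <= 1 -> rcont phi t.
Hypothesis cg : forall t, 0 <= t <= 1 -> rcont g t.
Hypothesis r0 : 0 < r.
Hypothesis rb : forall t, 0 <= t <= 1 -> r <= cmod (g t - b).

Definition ctrans n (z : C) : C := cint (fun t => phi t / (g t - z) ^+ n).

Let cont_ct n z t : 0 <= t <= 1 -> g t - z != 0 -> rcont (fun t => phi t / (g t - z) ^+ n) t.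
Proof.
move=> ht gz; apply: contM; first exact: cphi.
apply: contV; last by rewrite expf_neq0.
by apply: contX; apply: contB; [exact: cg|exact: cont_cst].
Qed.

(** Differentiation of a Cauchy transform under the integral sign, reduced to an algebraic
    second-order remainder estimate that is uniform in |w| >= r. *)
Lemma ctrans_der_gen n K : 0 <= K ->
  (forall w h : C, r <= cmod w -> cmod h <= r / 2 ->
     cmod ((w - h) ^- n - w ^- n - n%:R * h / w ^+ n.+1) <= K * cmod h ^+ 2) ->
  cder (ctrans n) b (n%:R * ctrans n.+1 b).
Proof.
move=> K0 hK e e0; have [M M0 hM] := curve_bounded cphi.
exists (Num.min (r / 2) (e / (M * K + 1))).
  by rewrite lt_min !divr_gt0// ltr_wpDl// mulr_ge0// ltW.
move=> z; rewrite lt_min => /andP[zr ze].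
set h := z - b in zr ze *.
have gb t : 0 <= t <= 1 -> g t - b != 0.
  by move=> ht; rewrite -cmod_gt0 (lt_le_trans r0)// rb.
have gz t : 0 <= t <= 1 -> g t - z != 0.
  move=> ht; rewrite -cmod_gt0; have := rb ht.
  have := cmod_sub_ge (g t - b) h; have -> : g t - b - h = g t - z by rewrite /h; ring.
  move=> k1 k2; apply: lt_le_trans k1; rewrite subr_gt0.
  apply: lt_le_trans zr _; apply: le_trans k2.
  by have r0' := r0; lra.
have E : ctrans n z - ctrans n b - n%:R * ctrans n.+1 b * h =
    cint (fun t => phi t * ((g t - b - h) ^- n - (g t - b) ^- n - n%:R * h / (g t - b) ^+ n.+1)).
  have c1 t : 0 <= t <= 1 -> rcont (fun t => phi t / (g t - z) ^+ n) t.
    by move=> ht; apply: cont_ct => //; exact: gz.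
  have c2 t : 0 <= t <= 1 -> rcont (fun t => phi t / (g t - b) ^+ n) t.
    by move=> ht; apply: cont_ct => //; exact: gb.
  have c3 t : 0 <= t <= 1 -> rcont (fun t => phi t / (g t - b) ^+ n.+1) t.
    by move=> ht; apply: cont_ct => //; exact: gb.
  rewrite (_ : n%:R * ctrans n.+1 b * h = (n%:R * h) * ctrans n.+1 b); last by ring.
  rewrite /ctrans -cintZ// -cintB// -cintB//; last 2 first.
  - by move=> t ht; apply: contB; [exact: c1|exact: c2].
  - by move=> t ht; apply: contM; [exact: cont_cst|exact: c3].
  congr cint; apply/funext => t.
  rewrite (_ : g t - b - h = g t - z); last by rewrite /h; ring.
  by ring.
rewrite E.
apply: (@le_trans _ _ (M * (K * cmod h ^+ 2))).
  apply: cint_bound => t ht; last first.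
    by rewrite cmodM ler_pM ?cmod_ge0//; [exact: hM|apply: hK; [exact: rb|exact: ltW]].
  apply: contM; first exact: cphi.
  have cgb : rcont (fun t => g t - b) t by apply: contB; [exact: cg|exact: cont_cst].
  apply: contB; first apply: contB.
  - apply: contV; first by apply: contX; apply: contB => //; exact: cont_cst.
    by rewrite expf_neq0// (_ : _ - h = g t - z) ?gz// /h; ring.
  - by apply: contV; [exact: contX|rewrite expf_neq0// gb].
  - apply: contM; first exact: cont_cst.
    by apply: contV; [exact: contX|rewrite expf_neq0// gb].
have MK : 0 <= M * K by rewrite mulr_ge0// ltW.
have h0 := cmod_ge0 h.
have : cmod h * (M * K + 1) <= e by rewrite -ler_pdivlMr ?ltW// ltr_wpDl.
by move: MK h0; set m := M * K => m0 h0 he; rewrite expr2 (_ : M * _ = m * cmod h * cmod h); [nra|rewrite /m; ring].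
Qed.

Let wbounds (w h : C) : r <= cmod w -> cmod h <= r / 2 -> [/\ w != 0, w - h != 0, 0 < cmod w & r / 2 <= cmod (w - h)].
Proof.
move=> rw hr; have w0 : 0 < cmod w by rewrite (lt_le_trans r0).
have wh : r / 2 <= cmod (w - h) by have := cmod_sub_ge w h; lra.
by split=> //; rewrite -cmod_gt0 ?w0// (lt_le_trans _ wh)// divr_gt0.
Qed.

(** The remainder is h^2 / (w^2 (w - h)), and |w| >= r, |w - h| >= r / 2 yield the constant 2 /
    r^3. *)
Lemma ctrans_der1 : cder (ctrans 1) b (ctrans 2 b).
Proof.
rewrite -[X in cder _ _ X]mul1r; apply: (@ctrans_der_gen 1 (2 / r ^+ 3)).
  by rewrite divr_ge0// exprn_ge0// ltW.
move=> w h rw /(wbounds rw)[w0 wh0 w1 wh1].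
rewrite !expr1 (_ : _ - _ = h ^+ 2 / (w ^+ 2 * (w - h))); last by field; rewrite wh0 w0.
rewrite cmodM cmodV cmodM !cmodX mulrC ler_wpM2r ?exprn_ge0 ?cmod_ge0//.
have r3 : 0 < r ^+ 3 by rewrite exprn_gt0.
have rr : 0 < r / 2 by rewrite divr_gt0.
rewrite -[_^-1]mul1r ler_pdivrMr ?mulr_gt0 ?exprn_gt0//; last by rewrite (lt_le_trans rr).
rewrite mulrAC ler_pdivlMr// mul1r.
have w2 : r ^+ 2 <= cmod w ^+ 2 by rewrite ler_sqr ?nnegrE// ?ltW// cmod_ge0.
have : r ^+ 2 * (r / 2) <= cmod w ^+ 2 * cmod (w - h) by rewrite ler_pM// ?sqr_ge0// ltW.
by rewrite exprSr; lra.
Qed.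

(** The remainder is h^2 (3 w - 2 h) / (w^3 (w - h)^2) with |3 w - 2 h| <= 4 |w|, which yields 16 /
    r^4. *)
Lemma ctrans_der2 : cder (ctrans 2) b (2 * ctrans 3 b).
Proof.
apply: (@ctrans_der_gen 2 (16 / r ^+ 4)).
  by rewrite divr_ge0// exprn_ge0// ltW.
move=> w h rw hr; have [w0 wh0 w1 wh1] := wbounds rw hr.
rewrite (_ : _ - _ = h ^+ 2 * ((3 * w - 2 * h) / (w ^+ 3 * (w - h) ^+ 2))); last by field; rewrite wh0 w0.
rewrite cmodM cmodX mulrC ler_wpM2r ?exprn_ge0 ?cmod_ge0// cmodM cmodV cmodM !cmodX.
have A : cmod (3 * w - 2 * h) <= 4 * cmod w.
  have := cmodB_le (3 * w) (2 * h); rewrite !cmodM !cmod_nat.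
  by lra.
have rr : 0 < r / 2 by rewrite divr_gt0.
have wh2 : (r / 2) ^+ 2 <= cmod (w - h) ^+ 2 by rewrite ler_sqr ?nnegrE// ?ltW// (lt_le_trans rr).
have w2 : r ^+ 2 <= cmod w ^+ 2 by rewrite ler_sqr ?nnegrE// ?ltW// cmod_ge0.
have r4 : 0 < r ^+ 4 by rewrite exprn_gt0.
have p1 : 0 < cmod (w - h) by rewrite (lt_le_trans rr).
have p2 : 0 < cmod (w - h) ^+ 2 by rewrite exprn_gt0.
rewrite ler_pdivrMr ?mulr_gt0 ?exprn_gt0// mulrAC ler_pdivlMr//.
have B : r ^+ 2 * (r / 2) ^+ 2 <= cmod w ^+ 2 * cmod (w - h) ^+ 2 by rewrite ler_pM// ?sqr_ge0.
have B' : r ^+ 4 <= 4 * (cmod w ^+ 2 * cmod (w - h) ^+ 2).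
  rewrite (_ : r ^+ 4 = 4 * (r ^+ 2 * (r / 2) ^+ 2)); last by field.
  by rewrite ler_pM2l.
apply: (@le_trans _ _ (4 * cmod w * (4 * (cmod w ^+ 2 * cmod (w - h) ^+ 2)))).
  by rewrite ler_pM ?cmod_ge0// ltW.
rewrite exprSr le_eqVlt; apply/orP; left; apply/eqP; ring.
Qed.

End CauchyTransform.

Section Circle.
Variables (a : C) (r : R).
Hypothesis r0 : 0 < r.

Definition circ (t : R) : C := a + rc r * cexp (rc t * twopi_i R).
Definition circ' (t : R) : C := twopi_i R * (circ t - a).

Lemma circ_der t : rder circ t (circ' t).
Proof.
have h : rder (fun t => cexp (rc t * twopi_i R)) t (cexp (rc t * twopi_i R) * twopi_i R).
  apply: (@der_comp R _ (@rc R) (@cexp R) (fun t => rc t * twopi_i R)).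
    exact: cder_cexp.
  by apply: (der_eq (derM (der_i _ t) (der_cst _ _ t))); rewrite mul1r mulr0 addr0.
apply: (der_eq (derD (der_cst _ a t) (derZ (rc r) h))).
by rewrite /circ' /circ; ring.
Qed.

Lemma circ_cont t : rcont circ t.
Proof. exact: der_cont (circ_der t). Qed.

Lemma circ'_cont t : rcont circ' t.
Proof.
by apply: contM; [exact: cont_cst|apply: contB; [exact: circ_cont|exact: cont_cst]].
Qed.

Lemma cmod_circ t : cmod (circ t - a) = r.
Proof.
rewrite /circ addrC addKr cmodM cmod_cexp cmod_rc (gtr0_norm r0) Re_rcM /= mulr0 expR0.
by rewrite mulr1.
Qed.

Lemma circ_closed : circ 1 = circ 0.
Proof. by rewrite /circ rc1 rc0 mul1r mul0r cexp_2pi cexp0. Qed.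

Lemma circ_dist b t : disc a r b -> r - cmod (b - a) <= cmod (circ t - b).
Proof.
move=> _; have := cmod_sub_ge (circ t - a) (b - a).
have -> : circ t - a - (b - a) = circ t - b by ring.
by rewrite cmod_circ.
Qed.

Lemma circ_neq b t : disc a r b -> circ t - b != 0.
Proof.
move=> hb; rewrite -cmod_gt0 (lt_le_trans _ (circ_dist t hb))// subr_gt0.
exact: hb.
Qed.

(** Differentiating in b gives the integral of circ' / (circ - b)^2, which has the primitive -1 /
    (circ - b) on a closed curve and so vanishes. The integral is therefore constant in b, and at
    the centre it is explicit. *)
Lemma winding b : disc a r b -> cint (fun t => circ' t / (circ t - b)) = twopi_i R.
Proof.
move=> hb; pose K := ctrans circ' circ 1.
have dK z : disc a r z -> cder K z 0.
  move=> hz; have rz : 0 < r - cmod (z - a) by rewrite subr_gt0.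
  have := @ctrans_der1 circ' circ _ z (fun t _ => circ'_cont t) (fun t _ => circ_cont t) rz (fun t _ => circ_dist t hz).
  move=> h; apply: (der_eq h); rewrite /ctrans (@cint_eq _ (fun t => - (circ t - z)^-1)).
    by rewrite circ_closed subrr.
  move=> t ht; have d := derB (circ_der t) (der_cst _ z t).
  apply: (der_eq (derN (derV d (circ_neq t hz)))).
  by rewrite subr0 mulNr opprK.
have Ka : K a = twopi_i R.
  rewrite /K /ctrans (@cint_eq _ (fun t => rc t * twopi_i R)).
    by rewrite rc1 rc0 mul1r mul0r subr0.
  move=> t ht; apply: (der_eq (derM (der_i _ t) (der_cst _ (twopi_i R) t))).
  rewrite mul1r mulr0 addr0 /circ' expr1 mulfK//.
  by apply: circ_neq; exact: disc_center.
have Kb : K b = K a.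
  have := @rder0_cst R (fun t => K (segm a b t)) 0 1 ler01; rewrite segm0 segm1; apply.
  move=> t ht; rewrite -(mul0r (b - a)); apply: (@der_comp R _ (@rc R) K (segm a b)).
    by apply/dK/disc_convex => //; exact: disc_center.
  exact: segm_der.
by rewrite -[RHS]Ka -Kb /K /ctrans; congr cint; apply/funext => t; rewrite expr1.
Qed.

Variables (rho : R) (f : C -> C).
Hypothesis r_rho : r < rho.
Hypothesis hf : holo (disc a rho) f.

Let circ_in t : disc a rho (circ t).
Proof. by rewrite /disc cmod_circ. Qed.

Let fcirc_cont t : rcont (fun t => f (circ t)) t.
Proof. exact: (cont_comp (holo_cont hf (circ_in t)) (circ_cont t)). Qed.

Let phi t := f (circ t) * circ' t.

Let phi_cont t : rcont phi t.
Proof. by apply: contM; [exact: fcirc_cont|exact: circ'_cont]. Qed.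

(** The difference quotient of f at b has a primitive by [primitive_exceptional], so its integral
    over the closed circle is 0; the part containing f b is evaluated by [winding]. *)
Lemma cauchy_formula b : disc a r b -> f b = ctrans phi circ 1 b / twopi_i R.
Proof.
move=> hb; have hb' : disc a rho b by exact: lt_trans hb r_rho.
have [p [hp p0 cp]] := der_slope (holo_der hf hb').
have cpU z : disc a rho z -> ccont p z.
  move=> hz; have [->|zb] := eqVneq z b; first by [].
  have zb0 : 0 < cmod (z - b) by rewrite cmod_gt0 subr_eq0.
  apply: (cont_near (f := fun z => (f z - f b) / (z - b))).
    apply: contM; first by apply: contB; [exact: holo_cont hf hz|exact: cont_cst].
    by apply: contV; [apply: contB; [exact: cont_i|exact: cont_cst]|rewrite subr_eq0].
  exists (cmod (z - b)) => // w wz; rewrite hp mulfK// subr_eq0.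
  by apply: contraTneq wz => ->; rewrite cmodBC ltxx.
have dpU z : disc a rho z -> z != b -> exists l, cder p z l.
  move=> hz zb; have zb0 : 0 < cmod (z - b) by rewrite cmod_gt0 subr_eq0.
  have d := derM (derB (holo_der hf hz) (der_cst _ (f b) z))
    (derV (derB (der_i _ z) (der_cst _ b z)) (_ : z - b != 0)).
  eexists; apply: der_near; first by apply: d; rewrite subr_eq0.
  exists (cmod (z - b)) => // w wz; rewrite hp mulfK// subr_eq0.
  by apply: contraTneq wz => ->; rewrite cmodBC ltxx.
have [G dG] := primitive_exceptional (disc_convex (a := a) (r := rho)) cpU dpU hb' (disc_open (a := a) (r := rho)).
have I0 : cint (fun t => p (circ t) * circ' t) = 0.
  rewrite (@cint_eq _ (fun t => G (circ t))); first by rewrite circ_closed subrr.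
  by move=> t _; apply: (@der_comp R _ (@rc R) G circ); [exact: dG|exact: circ_der].
have cc t : rcont (fun t => (circ t - b)^-1) t.
  apply: contV; last exact: circ_neq.
  by apply: contB; [exact: circ_cont|exact: cont_cst].
have E : cint (fun t => p (circ t) * circ' t) = ctrans phi circ 1 b - f b * twopi_i R.
  rewrite -(winding hb) -cintZ; last by move=> t _; apply: contM; [exact: circ'_cont|exact: cc].
  rewrite /ctrans -cintB; last 2 first.
  - by move=> t _; rewrite /=; under [X in rcont X]funext => u do rewrite expr1; apply: contM; [exact: phi_cont|exact: cc].
  - move=> t _; apply: contM; first exact: cont_cst.
    by apply: contM; [exact: circ'_cont|exact: cc].
  congr cint; apply/funext => t; rewrite expr1 /phi.
  have nb := circ_neq t hb.
  apply: (mulIf nb); rewrite mulrAC -hp mulrBl mulrBl.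
  by rewrite !mulrA !mulfVK.
move: I0; rewrite E => /eqP; rewrite subr_eq0 => /eqP ->.
by rewrite mulfK// twopi_i_neq0.
Qed.

(** Cauchy's formula is differentiated twice: once to express f', once more to see that f' is
    differentiable. *)
Lemma derive_cauchy b : disc a r b ->
  derive1 f b = ctrans phi circ 2 b / twopi_i R /\
  exists l, cder (derive1 f) b l.
Proof.
have eqf z : disc a r z -> exists2 d : R, 0 < d & forall x, cmod (x - z) < d ->
    disc a r x.
  by move=> /(@disc_open a r) [d d0 hd]; exists d.
have D1 z : disc a r z -> derive1 f z = ctrans phi circ 2 z / twopi_i R.
  move=> hz; apply: cder_derive1.
  have rz : 0 < r - cmod (z - a) by rewrite subr_gt0.
  have d1 := @ctrans_der1 phi circ _ z (fun t _ => phi_cont t) (fun t _ => circ_cont t) rz (fun t _ => circ_dist t hz).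
  have d2 := derM d1 (der_cst _ (twopi_i R)^-1 z).
  apply: (der_near (der_eq d2 _)); first by rewrite mulr0 addr0.
  have [d d0 hd] := eqf _ hz; exists d => // x /hd xr.
  by rewrite -cauchy_formula.
move=> hb; split; first exact: D1.
have rb : 0 < r - cmod (b - a) by rewrite subr_gt0.
have d1 := @ctrans_der2 phi circ _ b (fun t _ => phi_cont t) (fun t _ => circ_cont t) rb (fun t _ => circ_dist t hb).
have d2 := derM d1 (der_cst _ (twopi_i R)^-1 b).
eexists; apply: der_near; first exact: d2.
have [d d0 hd] := eqf _ hb; exists d => // x /hd xr.
by rewrite D1.
Qed.

End Circle.

Lemma holo_derive (U : C -> Prop) f : open_set U -> holo U f -> holo U (derive1 f).
Proof.
move=> oU hf z Uz; have [d d0 hd] := oU _ Uz.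
have d2 : 0 < d / 2 by rewrite divr_gt0.
have dd : d / 2 < d by lra.
have hf' : holo (disc z d) f by move=> w /hd; exact: hf.
by have [_] := derive_cauchy d2 dd hf' (disc_center z d2).
Qed.

End CauchyFormula.

(** * Maximum principle, division by z - a, Taylor bounds and orders of zeros *)

Section MaximumPrinciple.
Variables (R : realType).
Local Notation C := (Cplx R).
Local Notation cder := (der (fun z : C => z)).
Local Notation ccont := (cont (fun z : C => z)).
Implicit Types (U V : C -> Prop) (f g : C -> C).

Lemma holo_eq U f g : open_set U -> holo U f -> (forall z, U z -> f z = g z) -> holo U g.
Proof.
move=> oU hf fg z Uz; have [l dl] := hf z Uz; have [d d0 hd] := oU _ Uz.
by exists l; apply: (der_near dl); exists d => // w /hd /fg.
Qed.

Lemma holo_cst U (c : C) : holo U (fun=> c).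
Proof. by move=> z _; exists 0; exact: der_cst. Qed.

Lemma holo_id U : holo U (fun z => z).
Proof. by move=> z _; exists 1; exact: der_i. Qed.

Lemma holoD U f g : holo U f -> holo U g -> holo U (fun z => f z + g z).
Proof.
move=> hf hg z Uz; have [l dl] := hf z Uz; have [m dm] := hg z Uz.
by exists (l + m); exact: derD.
Qed.

Lemma holoB U f g : holo U f -> holo U g -> holo U (fun z => f z - g z).
Proof.
move=> hf hg z Uz; have [l dl] := hf z Uz; have [m dm] := hg z Uz.
by exists (l - m); exact: derB.
Qed.

Lemma holoM U f g : holo U f -> holo U g -> holo U (fun z => f z * g z).
Proof.
move=> hf hg z Uz; have [l dl] := hf z Uz; have [m dm] := hg z Uz.
by eexists; exact: derM dl dm.
Qed.

Lemma holoX U f n : holo U f -> holo U (fun z => f z ^+ n).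
Proof. by move=> hf z Uz; have [l dl] := hf z Uz; eexists; exact: derX dl. Qed.

Lemma holoV U f : holo U f -> (forall z, U z -> f z != 0) -> holo U (fun z => (f z)^-1).
Proof.
by move=> hf f0 z Uz; have [l dl] := hf z Uz; eexists; exact: derV dl (f0 z Uz).
Qed.

Lemma disc_sub (a p : C) (r d z : _) : d + cmod (p - a) <= r -> disc p d z -> disc a r z.
Proof.
move=> h; rewrite /disc => zp; apply: le_lt_trans (cmod_tri _ p _) _.
by apply: lt_le_trans h; rewrite ltrD2r.
Qed.

Lemma disc_le (a : C) (r d z : _) : d <= r -> disc a d z -> disc a r z.
Proof. by move=> h zp; exact: lt_le_trans zp h. Qed.

Lemma bernoulli (y : R) n : 0 <= y -> 1 + n%:R * y <= (1 + y) ^+ n.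
Proof.
move=> y0; elim: n => [|n IH]; first by rewrite mul0r addr0 expr0.
rewrite exprSr; apply: (@le_trans _ _ ((1 + n%:R * y) * (1 + y))).
  rewrite -natr1; have : 0 <= n%:R * y * y by rewrite !mulr_ge0.
  by lra.
by rewrite ler_wpM2r// addr_ge0.
Qed.

Lemma pow_unbounded (y K : R) : 1 < y -> exists n, K < y ^+ n.
Proof.
move=> y1; have y0 : 0 < y - 1 by rewrite subr_gt0.
have [N /(_ N (leqnn _)) hN] := archi (K / (y - 1)); exists N.
have := bernoulli N (ltW y0); rewrite (_ : 1 + (y - 1) = y); last by ring.
apply: lt_le_trans.
by move: hN; rewrite ltr_pdivrMr//; lra.
Qed.

Lemma pow_le_cst (x M K : R) : 0 <= x -> 0 <= M -> (forall n, x ^+ n <= K * M ^+ n) -> x <= M.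
Proof.
move=> x0; rewrite le_eqVlt => /orP[/eqP <-|M0] h.
  by have := h 1%N; rewrite !expr1 mulr0.
rewrite leNgt; apply/negP => Mx.
have [|n] := @pow_unbounded (x / M) K; first by rewrite ltr_pdivlMr// mul1r.
by rewrite expr_div_n ltr_pdivlMr ?exprn_gt0// ltNge h.
Qed.

Lemma geometric_small (q e : R) (K : R) : 0 <= q -> q < 1 -> 0 < e -> exists n, K * q ^+ n < e.
Proof.
rewrite le_eqVlt => /orP[/eqP <- _ e0|q0 q1 e0]; first by exists 1%N; rewrite expr1 mulr0.
have [|n hn] := @pow_unbounded q^-1 (K / e); first by rewrite invf_gt1.
exists n; move: hn; rewrite exprVn ltr_pdivrMr// mulrC => h.
by rewrite -ltr_pdivlMr ?exprn_gt0.
Qed.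

Section Circle.
Variables (a : C) (r rho : R) (f : C -> C).
Hypotheses (r0 : 0 < r) (r_rho : r < rho) (hf : holo (disc a rho) f).

(* Applied to the powers of f, the crude bound coming from Cauchy's formula
   becomes sharp. *)
Lemma max_principle M b : (forall t, cmod (f (circ a r t)) <= M) -> disc a r b ->
  cmod (f b) <= M.
Proof.
move=> hM hb.
have M0 : 0 <= M by apply: le_trans (hM 0); exact: cmod_ge0.
have db : 0 < r - cmod (b - a) by rewrite subr_gt0; exact: hb.
apply: (@pow_le_cst _ _ (r / (r - cmod (b - a)))) => // [|n]; first exact: cmod_ge0.
have hfn : holo (disc a rho) (fun z => f z ^+ n) by exact: holoX.
rewrite -cmodX (cauchy_formula r0 r_rho hfn hb) cmodM cmodV.
have w0 : 0 < cmod (twopi_i R) by rewrite cmod_gt0 twopi_i_neq0.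
rewrite ler_pdivrMr//; apply: cint_bound => t ht.
  apply: contM; first apply: contM.
  - apply: (@cont_comp R R (@rc R) (fun z => f z ^+ n) (circ a r)); last exact: circ_cont.
    by apply: holo_cont hfn _; rewrite /disc cmod_circ.
  - exact: circ'_cont.
  - apply: contV; last by rewrite expr1; exact: circ_neq.
    by apply: contX; apply: contB; [exact: circ_cont|exact: cont_cst].
rewrite expr1 cmodM cmodV cmodM cmodX /circ' cmodM cmod_circ//.
have cd := circ_dist r0 t hb.
rewrite ler_pdivrMr ?(lt_le_trans db)//.
have fM : cmod (f (circ a r t)) ^+ n <= M ^+ n by rewrite lerXn2r ?nnegrE ?cmod_ge0.
rewrite (mulrC (cmod (twopi_i R))) mulrA (_ : _ * cmod (circ a r t - b) = (M ^+ n * r * cmod (twopi_i R)) * (cmod (circ a r t - b) / (r - cmod (b - a)))); last by ring.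
apply: (@le_trans _ _ (M ^+ n * r * cmod (twopi_i R))).
  by apply: ler_wpM2r; [exact: ltW|apply: ler_wpM2r; [exact: ltW|]].
rewrite ler_peMr//; last by rewrite ler_pdivlMr// mul1r.
by rewrite !mulr_ge0// ?exprn_ge0// ltW.
Qed.

Lemma circle_bounded : exists2 M, 0 < M & forall t, cmod (f (circ a r t)) <= M.
Proof.
have cf t : cont (@rc R) (fun t => f (circ a r t)) t.
  apply: (@cont_comp R R (@rc R) f (circ a r)); last exact: circ_cont.
  by apply: holo_cont hf _; rewrite /disc cmod_circ.
have [M M0 hM] := @curve_bounded R _ (fun t _ => cf t).
exists M => // t.
(* [curve_bounded] covers only [0, 1]; other t are reduced to their fractional part by
   periodicity. *)
have tf := floor_itv t.
rewrite (_ : circ a r t = circ a r (t - (Num.floor t)%:~R)).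
  by apply: hM; move: tf => /andP[t1 t2]; rewrite intrD in t2; apply/andP; split; lra.
have per (m : int) : cexp (rc m%:~R * twopi_i R) = 1.
  have nat n : cexp (rc n%:R * twopi_i R) = 1 by rewrite rc_nat cexp_nat cexp_2pi expr1n.
  case: m => n; first exact: nat.
  by rewrite NegzE rmorphN /= rcN mulNr cexpN nat invr1.
by rewrite /circ rcB mulrBl cexpD cexpN per invr1 mulr1.
Qed.

End Circle.

(** The quotient is continuous with at most one exceptional point, so it has a primitive G, and it
    is holomorphic as the derivative of G. *)
Lemma holo_division (a b : C) rho f : holo (disc a rho) f -> disc a rho b ->
  exists g, [/\ holo (disc a rho) g, forall z, f z = f b + (z - b) * g z & g b = derive1 f b].
Proof.
move=> hf hb.
have [p [hp p0 cp]] := der_slope (holo_der hf hb).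
exists p; split=> // [|z]; last by rewrite mulrC -hp addrC subrK.
have cpU z : disc a rho z -> ccont p z.
  move=> hz; have [->|zb] := eqVneq z b; first by [].
  have zb0 : 0 < cmod (z - b) by rewrite cmod_gt0 subr_eq0.
  apply: (cont_near (f := fun z => (f z - f b) / (z - b))).
    apply: contM; first by apply: contB; [exact: holo_cont hf hz|exact: cont_cst].
    by apply: contV; [apply: contB; [exact: cont_i|exact: cont_cst]|rewrite subr_eq0].
  exists (cmod (z - b)) => // w wz; rewrite hp mulfK// subr_eq0.
  by apply: contraTneq wz => ->; rewrite cmodBC ltxx.
have dpU z : disc a rho z -> z != b -> exists l, cder p z l.
  move=> hz zb; have zb0 : 0 < cmod (z - b) by rewrite cmod_gt0 subr_eq0.
  have d := derM (derB (holo_der hf hz) (der_cst _ (f b) z))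
    (derV (derB (der_i _ z) (der_cst _ b z)) (_ : z - b != 0)).
  eexists; apply: der_near; first by apply: d; rewrite subr_eq0.
  exists (cmod (z - b)) => // w wz; rewrite hp mulfK// subr_eq0.
  by apply: contraTneq wz => ->; rewrite cmodBC ltxx.
have [G dG] := primitive_exceptional (disc_convex (a := a) (r := rho)) cpU dpU hb (disc_open (a := a) (r := rho)).
have hG : holo (disc a rho) G by move=> z hz; exists (p z); exact: dG.
apply: (holo_eq (@disc_open R a rho) (holo_derive (@disc_open R a rho) hG)) => z hz.
exact: cder_derive1 (dG z hz).
Qed.

Lemma division_bound_gen (a : C) rho f g M : 0 < rho -> holo (disc a rho) g ->
  (forall z, disc a rho z -> f z = f a + (z - a) * g z) ->
  (forall z, disc a rho z -> cmod (f z - f a) <= M) ->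
  forall z, disc a rho z -> cmod (g z) <= M / rho.
Proof.
move=> rho0 hg fg hM z hz.
have M0 : 0 <= M by apply: le_trans (hM a (disc_center a rho0)); exact: cmod_ge0.
have key r : cmod (z - a) < r -> r < rho -> cmod (g z) * r <= M.
  move=> zr rrho; have r0 : 0 < r by apply: le_lt_trans zr; exact: cmod_ge0.
  rewrite -ler_pdivlMr//.
  apply: (max_principle r0 rrho hg) => // t.
  have ct : disc a rho (circ a r t) by rewrite /disc cmod_circ.
  rewrite ler_pdivlMr// -[X in _ * X <= _](cmod_circ a r0 t) -cmodM mulrC.
  rewrite (_ : _ * g _ = f (circ a r t) - f a); last by rewrite (fg _ ct); ring.
  exact: hM.
rewrite ler_pdivlMr// leNgt; apply/negP => hc.
have g0 : 0 < cmod (g z).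
  rewrite lt_def cmod_ge0 andbT; apply: contraTneq hc => ->.
  by rewrite mul0r -leNgt.
(* This r is below rho but above both |z - a| and M / |g z|, so [key] fails for it. *)
pose r := Num.max ((cmod (z - a) + rho) / 2) ((M / cmod (g z) + rho) / 2).
have hz' : cmod (z - a) < rho by exact: hz.
have h2 : M / cmod (g z) < rho by rewrite ltr_pdivrMr// [rho * _]mulrC.
have r1 : cmod (z - a) < r by rewrite lt_max; apply/orP; left; lra.
have r2 : r < rho by rewrite gt_max; apply/andP; split; lra.
have := key _ r1 r2; rewrite leNgt => /negP; apply.
have r3 : M / cmod (g z) < r by rewrite lt_max; apply/orP; right; lra.
by rewrite [cmod _ * _]mulrC -ltr_pdivrMr.
Qed.

Lemma division_bound (a : C) rho f g M : 0 < rho -> holo (disc a rho) g ->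
  (forall z, disc a rho z -> f z = f a + (z - a) * g z) ->
  (forall z, disc a rho z -> cmod (f z) <= M) ->
  forall z, disc a rho z -> cmod (g z) <= 2 * M / rho.
Proof.
move=> rho0 hg fg hM; apply: (division_bound_gen rho0 hg fg) => z hz.
apply: (le_trans (cmodB_le _ _)).
by have := hM _ hz; have := hM _ (disc_center a rho0); lra.
Qed.

Lemma schwarz (a : C) rho f M : 0 < rho -> holo (disc a rho) f -> f a = 0 ->
  (forall z, disc a rho z -> cmod (f z) <= M) ->
  forall z, disc a rho z -> cmod (f z) <= M * (cmod (z - a) / rho).
Proof.
move=> rho0 hf fa hM z hz; have ca := disc_center a rho0.
have [g [hg fg _]] := holo_division hf ca.
have gM := division_bound_gen rho0 hg (fun z _ => fg z) (M := M).
rewrite fg fa add0r cmodM (_ : M * _ = cmod (z - a) * (M / rho)); last by ring.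
by rewrite ler_wpM2l ?cmod_ge0// gM// => w hw; rewrite fa subr0 hM.
Qed.

(** Two successive divisions by z - a, each costing a factor 2 / rho. The first conjunct is Cauchy's
    estimate up to a factor 2. *)
Lemma taylor2 (a : C) rho f M : 0 < rho -> holo (disc a rho) f ->
  (forall z, disc a rho z -> cmod (f z) <= M) ->
  cmod (derive1 f a) <= 2 * M / rho /\
  forall z, disc a rho z ->
    cmod (f z - f a - derive1 f a * (z - a)) <= 4 * M / rho ^+ 2 * cmod (z - a) ^+ 2.
Proof.
move=> rho0 hf hM; have ca := disc_center a rho0.
have [g [hg fg ga]] := holo_division hf ca.
have gM := division_bound rho0 hg (fun z _ => fg z) hM.
have [h [hh gh _]] := holo_division hg ca.
have hM' := division_bound rho0 hh (fun z _ => gh z) gM.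
split=> [|z hz]; first by rewrite -ga; exact: gM.
rewrite fg gh ga (_ : _ - _ = h z * (z - a) ^+ 2); last by ring.
rewrite cmodM cmodX ler_wpM2r ?exprn_ge0 ?cmod_ge0//.
apply: (le_trans (hM' z hz)); rewrite le_eqVlt; apply/orP; left; apply/eqP.
by field; rewrite gt_eqF.
Qed.

(** If z - a can be divided out n times for every n, the maximum principle bounds the cofactor by M
    / r^n, so |f z| <= M (|z - a| / r)^n, which tends to 0. The exponent m may be 0. *)
Lemma zero_factor (a : C) rho f : 0 < rho -> holo (disc a rho) f ->
  (forall z, disc a rho z -> f z = 0) \/
  exists m g, [/\ holo (disc a rho) g, g a != 0 &
    forall z, disc a rho z -> f z = (z - a) ^+ m * g z].
Proof.
move=> rho0 hf; have ca := disc_center a rho0.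
pose D m := exists2 g, holo (disc a rho) g & forall z, disc a rho z -> f z = (z - a) ^+ m * g z.
have [hD|] := pselect (forall m, D m); last first.
  move=> /existsNP[m nD].
  have [m' [[g hg fg] nD']] : exists m, D m /\ ~ D m.+1.
    elim: m nD => [nD|m IH nD]; first by case: nD; exists f => // z _; rewrite expr0 mul1r.
    by have [Dm|/IH//] := pselect (D m); exists m.
  right; exists m', g; split=> //; apply/eqP => ga; apply: nD'.
  have [h [hh gh _]] := holo_division hg ca.
  by exists h => // z hz; rewrite (fg z hz) gh ga add0r exprSr mulrA.
left=> z hz.
pose r := (cmod (z - a) + rho) / 2.
have hz' : cmod (z - a) < rho by exact: hz.
have r1 : cmod (z - a) < r by rewrite /r; lra.
have r2 : r < rho by rewrite /r; lra.
have r0 : 0 < r by apply: le_lt_trans r1; exact: cmod_ge0.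
have [M M0 hM] := circle_bounded r0 r2 hf.
apply/eqP; rewrite -cmod_eq0 eq_le cmod_ge0 andbT leNgt; apply/negP => fz0.
have [||n] := @geometric_small (cmod (z - a) / r) _ M _ _ fz0.
- by rewrite divr_ge0 ?cmod_ge0// ltW.
- by rewrite ltr_pdivrMr// mul1r.
have [g hg fg] := hD n.
rewrite ltNge => /negP; apply; rewrite (fg z hz) cmodM cmodX expr_div_n mulrCA ler_wpM2l ?exprn_ge0 ?cmod_ge0//.
apply: (max_principle r0 r2 hg) => // t.
have ct : disc a rho (circ a r t) by rewrite /disc cmod_circ.
rewrite ler_pdivlMr ?exprn_gt0//; have := hM t.
by rewrite (fg _ ct) cmodM cmodX cmod_circ// mulrC.
Qed.

Lemma identity_disc (a : C) rho f (d : R) : 0 < rho -> holo (disc a rho) f -> 0 < d ->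
  (forall z, disc a d z -> f z = 0) -> forall z, disc a rho z -> f z = 0.
Proof.
move=> rho0 hf d0 f0; have [//|[m [g [hg ga fg]]]] := zero_factor rho0 hf.
have ca := disc_center a rho0.
have ga0 : 0 < cmod (g a) by rewrite cmod_gt0.
have [e e0 he] := cont_cmod_gt (holo_cont hg ca) ga0.
pose x := a + rc (Num.min d (Num.min e rho) / 2).
have m0 : 0 < Num.min d (Num.min e rho) by rewrite !lt_min d0 e0 rho0.
have xa : cmod (x - a) = Num.min d (Num.min e rho) / 2.
  by rewrite /x addrC addKr cmod_rc gtr0_norm// divr_gt0.
have : cmod (x - a) < Num.min d (Num.min e rho) by rewrite xa; lra.
rewrite !lt_min => /andP[x1 /andP[x2 x3]].
have := f0 x x1; rewrite fg// => /eqP; rewrite mulf_eq0 expf_eq0 => /orP[/andP[_]|].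
  by rewrite -cmod_eq0 xa gt_eqF// divr_gt0.
by rewrite -cmod_eq0 gt_eqF//; apply: he.
Qed.

Lemma derive1_eq U f g : open_set U -> holo U f -> (forall z, U z -> f z = g z) ->
  forall z, U z -> derive1 f z = derive1 g z.
Proof.
move=> oU hf fg z Uz; have [d d0 hd] := oU _ Uz; apply/esym/cder_derive1.
by apply: (der_near (holo_der hf Uz)); exists d => // w /hd /fg.
Qed.

Lemma holo_derive1n U f n : open_set U -> holo U f -> holo U (derive1n n f).
Proof.
move=> oU hf; elim: n => [|n IH]; first by rewrite derive1n0.
by rewrite derive1nS; exact: holo_derive.
Qed.

Lemma derive1n_eq U f g n : open_set U -> holo U f -> (forall z, U z -> f z = g z) ->
  forall z, U z -> derive1n n f z = derive1n n g z.
Proof.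
move=> oU hf fg; elim: n => [|n IH]; first by rewrite !derive1n0.
rewrite !derive1nS; apply: derive1_eq => //; exact: holo_derive1n.
Qed.

(** Differentiating lowers the exponent by one and replaces g by a holomorphic cofactor whose value
    at a is the old exponent times g a. *)
Lemma derive1n_factor U m f g (a : C) : open_set U -> U a -> holo U g ->
  (forall z, U z -> f z = (z - a) ^+ m * g z) ->
  (forall j, (j < m)%N -> derive1n j f a = 0) /\ derive1n m f a = m`!%:R * g a.
Proof.
move=> oU Ua; elim: m f g => [|m IH] f g hg fg.
  by split=> //; rewrite derive1n0 fg// expr0 fact0 !mul1r.
have hfac : holo U (fun z => (z - a) ^+ m.+1 * g z).
  by apply: holoM => //; apply: holoX; apply: holoB; [exact: holo_id|exact: holo_cst].
have hf : holo U f by apply: (holo_eq oU hfac) => z Uz; rewrite fg.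
have hg' := holo_derive oU hg.
have df z : U z -> derive1 f z = (z - a) ^+ m * (m.+1%:R * g z + (z - a) * derive1 g z).
  move=> Uz; apply: cder_derive1.
  have d := derM (derX m.+1 (derB (der_i _ z) (der_cst _ a z))) (holo_der hg Uz).
  apply: (der_near (der_eq d _)).
    by rewrite /= subr0 mulr1 exprS; ring.
  by have [d' d'0 hd] := oU _ Uz; exists d' => // w /hd Uw; rewrite fg.
have [|h1 h2] := IH (derive1 f) (fun z => m.+1%:R * g z + (z - a) * derive1 g z) _ df.
  apply: holoD; first by apply: holoM => //; exact: holo_cst.
  by apply: holoM => //; apply: holoB; [exact: holo_id|exact: holo_cst].
split=> [[|j] jm|].
- by rewrite derive1n0 fg// subrr expr0n mul0r.
- by rewrite derive1Sn h1.
by rewrite derive1Sn h2 subrr mul0r addr0 factS natrM mulrA [m`!%:R * _]mulrC.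
Qed.

End MaximumPrinciple.

(** * Locally uniform convergence and normality *)

Section Convergence.
Variables (R : realType).
Local Notation C := (Cplx R).
Local Notation cder := (der (fun z : C => z)).
Local Notation ccont := (cont (fun z : C => z)).
Implicit Types (U V : C -> Prop) (f : nat -> C -> C) (g : C -> C).

Definition ucvg U f g := forall e : R, 0 < e -> exists N, forall n, (N <= n)%N ->
  forall z, U z -> cmod (f n z - g z) < e.

(** Rescaled functions live on discs growing with n, so holomorphy can only be asked from some index
    on. *)
Definition eholo U f := exists N, forall n, (N <= n)%N -> holo U (f n).

Definition hluc U f g := forall p, U p -> exists d : R,
  [/\ 0 < d, eholo (disc p d) f & ucvg (disc p d) f g].

Definition linf U f := forall p, U p -> exists2 d : R, 0 < d &
  forall M : R, exists N, forall n, (N <= n)%N -> forall z, disc p d z -> M <= cmod (f n z).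

Lemma ucvg_sub U V f g : (forall z, V z -> U z) -> ucvg U f g -> ucvg V f g.
Proof. by move=> VU h e /h[N hN]; exists N => n Nn z /VU; exact: hN. Qed.

Lemma eholo_sub U V f : (forall z, V z -> U z) -> eholo U f -> eholo V f.
Proof. by move=> VU [N hN]; exists N => n Nn; apply: holo_sub (hN n Nn). Qed.

Lemma ucvg_pt U f g z : ucvg U f g -> U z -> cvc (f^~ z) (g z).
Proof. by move=> h Uz e /h[N hN]; exists N => n Nn; exact: hN. Qed.

Lemma hluc_pt U f g z : hluc U f g -> U z -> cvc (f^~ z) (g z).
Proof. by move=> h /[dup] Uz /h[d [d0 _ h']]; apply: ucvg_pt h' _; exact: disc_center. Qed.

Lemma hluc_subset U V f g : (forall z, V z -> U z) -> hluc U f g -> hluc V f g.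
Proof. by move=> VU h p /VU /h. Qed.

(** Weierstrass' theorem at one point: the second-order Taylor remainders are bounded uniformly in
    n, and the bound passes to the limit. *)
Lemma ucvg_der (a : C) rho f g : 0 < rho -> eholo (disc a rho) f -> ucvg (disc a rho) f g ->
  exists l, cder g a l /\ cvc (fun n => derive1 (f n) a) l.
Proof.
move=> rho0 [N0 hN0] cv; have ca := disc_center a rho0.
have [N1 hN1] := cv 1 ltr01.
pose m := maxn N0 N1.
have lt1 : cmod (f m a) < cmod (f m a) + 1 by rewrite ltrDl.
have [d d0 hd] := cont_cmod_lt (holo_cont (hN0 m (leq_maxl _ _)) ca) lt1.
(* The fixed function f m is the reference, since g is not yet known to be continuous: 1 for the
   variation of f m near a, and 1 for each of the passages from f m to g and from g to f n. *)
pose M := cmod (f m a) + 3.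
pose r := Num.min d rho.
have r0 : 0 < r by rewrite lt_min d0.
have rrho z : disc a r z -> disc a rho z by apply: disc_le; rewrite ge_min lexx orbT.
have rd z : disc a r z -> cmod (z - a) < d by apply: disc_le; rewrite ge_min lexx.
have hM n : (m <= n)%N -> forall z, disc a r z -> cmod (f n z) <= M.
  move=> mn z zr; have := hd z (rd z zr).
  have := hN1 n (leq_trans (leq_maxr _ _) mn) z (rrho z zr).
  have := hN1 m (leq_maxr _ _) z (rrho z zr).
  have := cmod_tri (f n z) (g z) (f m z); rewrite (cmodBC (g z)).
  by have := cmod_sub_ge (f n z) (f m z); rewrite /M; lra.
have hh n : (m <= n)%N -> holo (disc a r) (f n).
  by move=> mn; apply: holo_sub rrho _; apply: hN0; exact: leq_trans (leq_maxl _ _) mn.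
have [l hl] : exists l, cvc (fun n => derive1 (f n) a) l.
  apply: cauchyc_cvc => e e0.
  have [|N hN] := cv (e * r / 8); first by rewrite divr_gt0// mulr_gt0.
  exists (maxn N m) => i j; rewrite geq_max => /andP[Ni mi]; rewrite geq_max => /andP[Nj mj].
  have hB := holoB (hh i mi) (hh j mj).
  have ca' := disc_center a r0.
  have -> : derive1 (f i) a - derive1 (f j) a = derive1 (fun z => f i z - f j z) a.
    apply/esym/cder_derive1; apply: derB; apply: holo_der ca'; exact: hh.
  have [|h _] := taylor2 r0 hB (M := e * r / 4).
    move=> z zr; apply: (le_trans (cmod_tri _ (g z) _)).
    have := hN i Ni z (rrho z zr); have := hN j Nj z (rrho z zr); rewrite (cmodBC (g z)).
    by lra.
  apply: (le_lt_trans h); rewrite (_ : _ / r = e / 2); last by field; rewrite gt_eqF.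
  by rewrite ltr_pdivrMr//; lra.
exists l; split=> //.
have key z : disc a r z -> cmod (g z - g a - l * (z - a)) <= 4 * M / r ^+ 2 * cmod (z - a) ^+ 2.
  move=> zr.
  have cz := ucvg_pt cv (rrho z zr); have cga := ucvg_pt cv ca.
  have cc : cvc (fun n => f n z - f n a - derive1 (f n) a * (z - a)) (g z - g a - l * (z - a)).
    move=> e e0; pose K := 2 + cmod (z - a).
    have K0 : 0 < K by rewrite /K; have := cmod_ge0 (z - a); lra.
    have eK : 0 < e / K by rewrite divr_gt0.
    have [n1 h1] := cz _ eK; have [n2 h2] := cga _ eK; have [n3 h3] := hl _ eK.
    exists (maxn n1 (maxn n2 n3)) => n; rewrite !geq_max => /andP[/h1 k1 /andP[/h2 k2 /h3 k3]].
    rewrite (_ : _ - _ = (f n z - g z) - (f n a - g a) - (derive1 (f n) a - l) * (z - a)); last by ring.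
    apply: (le_lt_trans (cmodB_le _ _)); rewrite cmodM.
    have := cmodB_le (f n z - g z) (f n a - g a).
    have E : e / K * K = e by rewrite divfK// gt_eqF.
    have : cmod (derive1 (f n) a - l) * cmod (z - a) <= e / K * cmod (z - a).
      by rewrite ler_wpM2r ?cmod_ge0// ltW.
    by move: E; rewrite /K mulrDr; lra.
  apply: (cvc_le cc); exists m => n mn.
  by have [_] := taylor2 r0 (hh n mn) (hM n mn); apply.
have M0 : 0 < M by rewrite /M; have := cmod_ge0 (f m a); lra.
have K0 : 0 < 4 * M / r ^+ 2 by rewrite divr_gt0 ?exprn_gt0// mulr_gt0.
move=> e e0; exists (Num.min r (e / (4 * M / r ^+ 2))); first by rewrite lt_min r0 divr_gt0.
move=> z; rewrite lt_min => /andP[zr ze]; apply: (le_trans (key z zr)).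
by rewrite expr2 mulrA ler_wpM2r ?cmod_ge0// mulrC -ler_pdivlMr// ltW.
Qed.

Lemma hluc_holo U f g : hluc U f g -> holo U g.
Proof.
move=> h p /h[d [d0 ef cv]]; have [l [dl _]] := ucvg_der d0 ef cv.
by exists l.
Qed.

Lemma hluc_discs U f g p : hluc U f g -> U p -> exists d : R,
  [/\ 0 < d, eholo (disc p d) f, holo (disc p d) g & ucvg (disc p d) f g].
Proof.
move=> h /h[d [d0 ef cv]]; exists d; split=> //; apply: (hluc_holo (f := f)) => q hq.
exists (d - cmod (q - p)); split; first by rewrite subr_gt0; exact: hq.
- by apply: eholo_sub ef => z; apply: disc_sub; rewrite subrK.
- by apply: ucvg_sub cv => z; apply: disc_sub; rewrite subrK.
Qed.

Lemma hluc_derive U f g : hluc U f g -> hluc U (fun n => derive1 (f n)) (derive1 g).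
Proof.
move=> h p Up; have [d [d0 [N0 ef] hg cv]] := hluc_discs h Up.
have d2 : 0 < d / 2 by rewrite divr_gt0.
have sub z : disc p (d / 2) z -> disc p d z by apply: disc_le; lra.
exists (d / 2); split=> //.
  by exists N0 => n /ef hn; apply: holo_sub sub _; apply: holo_derive => //; exact: disc_open.
(* Cauchy's estimate on radius d / 2 then gives 2 (e d / 16) / (d / 2) = e / 4. *)
move=> e e0; have [|N hN] := cv (e * d / 16); first by rewrite divr_gt0// mulr_gt0.
exists (maxn N N0) => n; rewrite geq_max => /andP[Nn N0n] z hz.
have hB := holoB (ef n N0n) hg.
have sub' w : disc z (d / 2) w -> disc p d w.
  by apply: disc_sub; move: hz; rewrite /disc; lra.
have hz' := sub z hz.
have -> : derive1 (f n) z - derive1 g z = derive1 (fun w => f n w - g w) z.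
  by apply/esym/cder_derive1; apply: derB; [exact: holo_der (ef n N0n) hz'|exact: holo_der hg hz'].
have [|k _] := taylor2 d2 (holo_sub sub' hB) (M := e * d / 16).
  by move=> w /sub' hw; apply: ltW; exact: hN.
apply: (le_lt_trans k); rewrite (_ : _ / (d / 2) = e / 4); last by field; rewrite gt_eqF.
by rewrite ltr_pdivrMr//; lra.
Qed.

Lemma hluc_derive1n U f g k : hluc U f g -> hluc U (fun n => derive1n k (f n)) (derive1n k g).
Proof.
move=> h; elim: k => [|k IH]; first by rewrite derive1n0.
under [X in hluc _ X]funext => n do rewrite derive1nS.
by rewrite derive1nS; exact: hluc_derive.
Qed.

Lemma hluc_cst U c : hluc U (fun=> fun=> c) (fun=> c).
Proof.
move=> p _; exists 1; split=> //; first by exists 0%N => n _; exact: holo_cst.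
by move=> e e0; exists 0%N => n _ z _; rewrite subrr cmod0.
Qed.

Lemma hluc_bounded U f g p : hluc U f g -> U p -> exists d M : R,
  [/\ 0 < d, 0 < M, forall z, disc p d z -> cmod (g z) <= M &
    exists N, forall n, (N <= n)%N -> forall z, disc p d z -> cmod (f n z) <= M].
Proof.
move=> h Up; have [d [d0 ef hg cv]] := hluc_discs h Up.
have cp := disc_center p d0.
have lt1 : cmod (g p) < cmod (g p) + 1 by rewrite ltrDl.
have [d' d'0 hd'] := cont_cmod_lt (holo_cont hg cp) lt1.
have [N hN] := cv 1 ltr01.
have sub z : disc p (Num.min d d') z -> disc p d z /\ cmod (z - p) < d'.
  by rewrite /disc lt_min => /andP.
exists (Num.min d d'), (cmod (g p) + 2); split; first by rewrite lt_min d0.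
- by rewrite ltr_wpDl// cmod_ge0.
- by move=> z /sub[_ /hd']; lra.
- exists N => n Nn z /sub[z1 /hd']; have := hN n Nn z z1.
  by have := cmod_sub_ge (f n z) (g z); lra.
Qed.

Lemma hlucM U f f' g g' : hluc U f g -> hluc U f' g' ->
  hluc U (fun n z => f n z * f' n z) (fun z => g z * g' z).
Proof.
move=> h h' p Up.
have [d1 [d10 [N1 ef1] _ cv1]] := hluc_discs h Up.
have [d2 [d20 [N2 ef2] _ cv2]] := hluc_discs h' Up.
have [d3 [M3 [d30 M30 _ [N3 hM3]]]] := hluc_bounded h Up.
have [d4 [M4 [d40 M40 hM4 _]]] := hluc_bounded h' Up.
pose d := Num.min d1 (Num.min d2 (Num.min d3 d4)).
have sub z : disc p d z -> [/\ disc p d1 z, disc p d2 z, disc p d3 z & disc p d4 z].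
  by rewrite /disc /d !lt_min => /andP[? /andP[? /andP[? ?]]].
exists d; split.
- by rewrite !lt_min d10 d20 d30.
- exists (maxn N1 N2) => n; rewrite geq_max => /andP[/ef1 k1 /ef2 k2].
  by apply: holoM => z /sub[? ? _ _]; [exact: k1|exact: k2].
- move=> e e0; have M34 : 0 < M3 + M4 by rewrite addr_gt0.
  have eM : 0 < e / (M3 + M4) by rewrite divr_gt0.
  have [n1 h1] := cv1 _ eM; have [n2 h2] := cv2 _ eM.
  exists (maxn N3 (maxn n1 n2)) => n; rewrite !geq_max => /andP[Nn /andP[n1n n2n]] z /sub[z1 z2 z3 z4].
  rewrite (_ : _ - _ = f n z * (f' n z - g' z) + (f n z - g z) * g' z); last by ring.
  apply: (le_lt_trans (cmodD _ _)); rewrite !cmodM.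
  have k1 := h1 n n1n z z1; have k2 := h2 n n2n z z2.
  have k3 := hM3 n Nn z z3; have k4 := hM4 z z4.
  have E : e / (M3 + M4) * (M3 + M4) = e by rewrite divfK// gt_eqF.
  rewrite -E mulrDr; apply: ler_ltD.
    by rewrite mulrC ler_pM ?cmod_ge0// ltW.
  apply: (@le_lt_trans _ _ (cmod (f n z - g z) * M4)).
    by rewrite ler_wpM2l// cmod_ge0.
  by rewrite ltr_pM2r.
Qed.

Lemma hlucX U f g k : hluc U f g -> hluc U (fun n z => f n z ^+ k) (fun z => g z ^+ k).
Proof.
move=> h; elim: k => [|k IH]; first exact: hluc_cst.
have -> : (fun n z => f n z ^+ k.+1) = (fun n z => f n z * f n z ^+ k).
  by apply/funext => n; apply/funext => z; rewrite exprS.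
have -> : (fun z => g z ^+ k.+1) = (fun z => g z * g z ^+ k).
  by apply/funext => z; rewrite exprS.
exact: hlucM.
Qed.

Lemma hlucB U f f' g g' : hluc U f g -> hluc U f' g' ->
  hluc U (fun n z => f n z - f' n z) (fun z => g z - g' z).
Proof.
move=> h h' p Up.
have [d1 [d10 [N1 ef1] _ cv1]] := hluc_discs h Up.
have [d2 [d20 [N2 ef2] _ cv2]] := hluc_discs h' Up.
pose d := Num.min d1 d2.
have sub z : disc p d z -> disc p d1 z /\ disc p d2 z.
  by rewrite /disc /d !lt_min => /andP.
exists d; split.
- by rewrite !lt_min d10 d20.
- exists (maxn N1 N2) => n; rewrite geq_max => /andP[/ef1 k1 /ef2 k2].
  by apply: holoB => z /sub[? ?]; [exact: k1|exact: k2].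
- move=> e e0; have e2 : 0 < e / 2 by rewrite divr_gt0.
  have [n1 h1] := cv1 _ e2; have [n2 h2] := cv2 _ e2.
  exists (maxn n1 n2) => n; rewrite !geq_max => /andP[n1n n2n] z /sub[z1 z2].
  rewrite (_ : _ - _ = (f n z - g z) - (f' n z - g' z)); last by ring.
  by apply: (le_lt_trans (cmodB_le _ _)); rewrite (splitr e) ltrD// ?h1// h2.
Qed.

(** Minimum principle: without zeros, 1 / f would be at most 1 / c on the circle but larger than 1 /
    c at the centre. *)
Lemma zero_in_disc (p : C) (rho r c : R) (f : C -> C) : 0 < r -> r < rho -> holo (disc p rho) f ->
  0 < c -> (forall t, c <= cmod (f (circ p r t))) -> cmod (f p) < c ->
  exists2 z, cmod (z - p) <= r & f z = 0.
Proof.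
move=> r0 rrho hf c0 hc fp; apply: contrapT => hn.
have fp0 : f p != 0.
  by apply/eqP => h; apply: hn; exists p => //; rewrite subrr cmod0 ltW.
(* on a slightly larger disc f has no zero either, by compactness *)
have [rho' [rr' r'rho f0]] : exists rho', [/\ r < rho', rho' <= rho & forall z, disc p rho' z -> f z != 0].
  apply: contrapT => hn'.
  have /choice[u hu] : forall n : nat, exists z, cmod (z - p) < Num.min rho (r + n.+1%:R^-1) /\ f z = 0.
    move=> n; apply: contrapT => hz; apply: hn'; exists (Num.min rho (r + n.+1%:R^-1)); split.
    - by rewrite lt_min rrho ltrDl invr_gt0 ltr0n.
    - by rewrite ge_min lexx.
    - by move=> z zr; apply/eqP => fz; apply: hz; exists z.
  have [|s hs [l hl]] := @bw R u (rho + cmod p).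
    move=> n; have [+ _] := hu n; rewrite lt_min => /andP[h _].
    by have := cmod_sub_ge (u n) p; lra.
  have lp : cmod (l - p) <= r.
    apply/ler_addgt0Pr => e e0; have e2 : 0 < e / 2 by rewrite divr_gt0.
    have [N1 h1] := hl _ e2; have [N2 h2] := inv_lt e2.
    pose n := maxn N1 N2; have k1 := h1 n (leq_maxl _ _).
    have k2 := h2 _ (leq_trans (leq_maxr N1 N2) (inc_ge hs n)).
    have [+ _] := hu (s n); rewrite lt_min => /andP[_ k3].
    have := cmod_tri l (u (s n)) p; rewrite (cmodBC l (u (s n))); move: k1 k2 k3 => /=.
    by move: ((s n).+1%:R^-1) => y k1 k2 k3; lra.
  apply: hn; exists l => //.
  have hl' : disc p rho l by exact: le_lt_trans lp rrho.
  apply/eqP; apply: contraT => fl.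
  have fl0 : 0 < cmod (f l) by rewrite cmod_gt0.
  have [d d0 hd] := cont_cmod_gt (holo_cont hf hl') fl0.
  have [N hN] := hl _ d0; have := hd _ (hN N (leqnn _)).
  by have [_ /= ->] := hu (s N); rewrite cmod0 ltxx.
have hV : holo (disc p rho') (fun z => (f z)^-1).
  by apply: holoV => //; apply: holo_sub hf => z; exact: disc_le.
have := max_principle r0 rr' hV (M := c^-1) _ (disc_center p r0).
rewrite cmodV lef_pV2 ?posrE ?cmod_gt0// => h.
have : c <= cmod (f p).
  by apply: h => t; rewrite cmodV lef_pV2 ?posrE// (lt_le_trans c0).
by rewrite leNgt fp.
Qed.

Lemma circle_isolated (p : C) (rho e : R) g : 0 < rho -> holo (disc p rho) g ->
  ~ (forall z, disc p rho z -> g z = 0) -> 0 < e ->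
  exists r c : R, [/\ 0 < r, r < e, r < rho, 0 < c & forall z, cmod (z - p) = r -> c <= cmod (g z)].
Proof.
move=> rho0 hg gn0 e0; have [//|[m [h [hh ha gh]]]] := zero_factor rho0 hg.
have cp := disc_center p rho0.
have hp0 : 0 < cmod (h p) by rewrite cmod_gt0.
have lt2 : cmod (h p) / 2 < cmod (h p) by lra.
have [d d0 hd] := cont_cmod_gt (holo_cont hh cp) lt2.
pose r := Num.min rho (Num.min e d) / 2.
have m0 : 0 < Num.min rho (Num.min e d) by rewrite !lt_min rho0 e0.
have r0 : 0 < r by rewrite divr_gt0.
have : r < Num.min rho (Num.min e d) by rewrite /r; lra.
rewrite !lt_min => /andP[r1 /andP[r2 r3]].
exists r, (r ^+ m * (cmod (h p) / 2)); split=> //.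
  by rewrite mulr_gt0 ?exprn_gt0// divr_gt0// cmod_gt0.
move=> z zr; rewrite gh; last by rewrite /disc zr.
by rewrite cmodM cmodX zr ler_wpM2l ?exprn_ge0 ?ltW//; apply: hd; rewrite zr.
Qed.

(** Unless g vanishes near p, some small circle carries |g| >= c > 0; eventually |f n| >= c / 2 on
    it while |f n p| < c / 2. *)
Lemma hurwitz U f g p : hluc U f g -> U p -> g p = 0 ->
  (exists2 d : R, 0 < d & forall z, disc p d z -> g z = 0) \/
  forall e : R, 0 < e -> exists N, forall n, (N <= n)%N -> exists2 z, cmod (z - p) < e & f n z = 0.
Proof.
move=> h Up gp; have [d [d0 [N0 ef] hg cv]] := hluc_discs h Up.
have [g0|gn0] := pselect (forall z, disc p d z -> g z = 0); first by left; exists d.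
right=> e e0; have [r [c [r0 re rd c0 hc]]] := circle_isolated d0 hg gn0 e0.
have c2 : 0 < c / 2 by rewrite divr_gt0.
have [N hN] := cv _ c2.
exists (maxn N N0) => n; rewrite geq_max => /andP[Nn N0n].
have [||z zr fz] := zero_in_disc r0 rd (ef n N0n) c2 _ _.
- move=> t; have ct : disc p d (circ p r t) by rewrite /disc cmod_circ.
  have := hc _ (cmod_circ p r0 t); have := hN n Nn _ ct; rewrite cmodBC.
  by have := cmod_sub_ge (g (circ p r t)) (f n (circ p r t)); lra.
- have := hN n Nn _ (disc_center p d0); rewrite gp subr0; lra.
by exists z => //; exact: le_lt_trans zr re.
Qed.

End Convergence.

(** * Diagonal extraction of subsequences *)

Section Diagonal.

(** Weaker than being a subsequence from some index on, as r need not increase: n <= r n is all that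
    a statement about large indices requires. *)
Definition esub (t s : nat -> nat) := exists N r, (forall n : nat, n <= r n)%N /\
  forall n, (N <= n)%N -> t n = s (r n).

Lemma diagonal (P : nat -> (nat -> nat) -> Prop) (s0 : nat -> nat) :
  (forall i s t, P i s -> esub t s -> P i t) ->
  (forall i s, inc s -> exists2 r, inc r & P i (s \o r)) -> inc s0 ->
  exists2 r, inc r & forall i, P i (s0 \o r).
Proof.
move=> hered ext is0.
have /choice[nx hnx] : forall si : (nat -> nat) * nat, exists r, inc si.1 -> inc r /\ P si.2 (si.1 \o r).
  move=> [s i]; have [ics|] := pselect (inc s); last by exists id.
  by have [r ir Pr] := ext i s ics; exists r.
(* rho k composes the first k refinements *)
pose rho := fix rho k := if k is j.+1 then rho j \o nx (s0 \o rho j, j) else id.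
have irho k : inc (rho k).
  elim: k => [|k IH] //=; apply: inc_comp => //.
  by have [] := hnx (s0 \o rho k, k) (inc_comp is0 IH).
have Prho k : P k (s0 \o rho k.+1).
  by have [_] := hnx (s0 \o rho k, k) (inc_comp is0 (irho k)).
have tail i k : exists2 r, (forall n, n <= r n)%N & rho (i + k)%N =1 rho i \o r.
  elim: k => [|k [r hr e]]; first by exists id => // n; rewrite addn0.
  exists (r \o nx (s0 \o rho (i + k)%N, (i + k)%N)).
    have [ir _] := hnx (s0 \o rho (i + k)%N, (i + k)%N) (inc_comp is0 (irho _)).
    by move=> n /=; exact: leq_trans (inc_ge ir n) (hr _).
  by move=> n; rewrite addnS /= e.
exists (fun n => rho n n).
  apply: inc_succ => n; have [ir _] := hnx (s0 \o rho n, n) (inc_comp is0 (irho n)).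
  by rewrite /=; apply: irho; apply: leq_ltn_trans (inc_ge ir n) _; exact: ir.
move=> i; apply: hered (Prho i) _.
have /choice[r hr] : forall n, exists m, (n <= m)%N /\ ((i.+1 <= n)%N -> rho n n = rho i.+1 m).
  move=> n; have [h|h] := leqP i.+1 n; last by exists n.
  have [r hr e] := tail i.+1 (n - i.+1)%N; exists (r n); split=> // _.
  by have := e n; rewrite subnKC.
exists i.+1, r; split=> [n|n hn]; first by have [] := hr n.
by rewrite /=; have [_ ->] := hr n.
Qed.

End Diagonal.

(** * Montel's theorem and local normality from a gradient bound *)

Section Montel.
Variables (R : realType).
Local Notation C := (Cplx R).
Local Notation cder := (der (fun z : C => z)).
Local Notation ccont := (cont (fun z : C => z)).
Implicit Types (U V : C -> Prop) (f : nat -> C -> C) (g : C -> C).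

Definition oscil (a : C) (rho : R) (f : nat -> C -> C) (K : R) (s : nat -> nat) :=
  exists N, forall m n, (N <= m)%N -> (N <= n)%N -> forall z, disc a rho z ->
    cmod (f (s m) z - f (s n) z) <= K.

Lemma oscil_esub a rho f K s t : oscil a rho f K s -> esub t s -> oscil a rho f K t.
Proof.
move=> [N hN] [N' [r [hr e]]]; exists (maxn N N') => m n.
rewrite !geq_max => /andP[Nm N'm] /andP[Nn N'n] z hz; rewrite !e//.
by apply: hN => //; [exact: leq_trans Nm (hr m)|exact: leq_trans Nn (hr n)].
Qed.

(* The oscillation is improved by splitting off the value at the centre: the
   quotients (f - f a) / (z - a) are again bounded, and |z - a| < rho / 4. *)
Lemma oscil_step (a : C) (rho : R) : 0 < rho -> forall k f M, 0 < M ->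
  (forall n, holo (disc a rho) (f n)) ->
  (forall n z, disc a rho z -> cmod (f n z) <= M) ->
  exists2 s, inc s & oscil a (rho / 4) f (2 * (3 / 4) ^+ k * M) s.
Proof.
move=> rho0; have ca := disc_center a rho0.
have sub z : disc a (rho / 4) z -> disc a rho z by apply: disc_le; lra.
elim=> [|k IH] f M M0 hf hM.
  exists id => //; exists 0%N => m n _ _ z /sub hz; rewrite expr0 mulr1.
  by apply: (le_trans (cmodB_le _ _)); have := hM m z hz; have := hM n z hz; lra.
have /choice[g hg] : forall n, exists g, [/\ holo (disc a rho) g,
    forall z, f n z = f n a + (z - a) * g z & g a = derive1 (f n) a].
  by move=> n; exact: holo_division.
have [s ics [l hl]] : exists2 s, inc s & exists l, cvc ((fun n => f n a) \o s) l.
  by apply: (bw (M := M)) => n; exact: hM.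
have M'0 : 0 < 2 * M / rho by rewrite divr_gt0// mulr_gt0.
have [||t it [N hN]] := IH (g \o s) (2 * M / rho) M'0.
- by move=> n; have [] := hg (s n).
- move=> n; have [hgn fg _] := hg (s n).
  exact: (division_bound rho0 hgn (fun z _ => fg z) (hM (s n))).
exists (s \o t); first exact: inc_comp.
pose q := (3 / 4 : R) ^+ k.
have q0 : 0 < q by rewrite exprn_gt0// divr_gt0.
(* The values at a contribute 2 (q M / 4), the quotients (rho / 4) (2 q) (2 M / rho) = q M; the sum
   is 2 (3/4) q M. *)
have e0 : 0 < q * M / 4 by rewrite divr_gt0// mulr_gt0.
have [N' hN'] := cvc_sub hl it e0.
exists (maxn N N') => m n; rewrite !geq_max => /andP[Nm N'm] /andP[Nn N'n] z hz /=.
have [_ e1 _] := hg (s (t m)); have [_ e2 _] := hg (s (t n)).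
rewrite (e1 z) (e2 z) (_ : _ - _ = (f (s (t m)) a - f (s (t n)) a) + (z - a) * (g (s (t m)) z - g (s (t n)) z)); last by ring.
apply: (le_trans (cmodD _ _)); rewrite cmodM.
have k1 := hN' m N'm; have k2 := hN' n N'n; have k3 := hN m n Nm Nn z hz.
have := cmod_tri (f (s (t m)) a) l (f (s (t n)) a); rewrite (cmodBC l) => k4.
have k5 : cmod (z - a) * cmod (g (s (t m)) z - g (s (t n)) z) <= rho / 4 * (2 * q * (2 * M / rho)).
  by rewrite ler_pM ?cmod_ge0//; exact: ltW.
move: k5; rewrite (_ : rho / 4 * _ = q * M); last by field; rewrite gt_eqF.
rewrite /= in k1 k2; rewrite exprSr -/q (_ : 2 * (q * (3 / 4)) * M = q * M * (3 / 2)); last by field.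
by lra.
Qed.

(** A diagonal sequence satisfies [oscil_step] for all k at once, so it is uniformly Cauchy. *)
Lemma montel (a : C) (rho M : R) f : 0 < rho -> 0 < M ->
  (forall n, holo (disc a rho) (f n)) ->
  (forall n z, disc a rho z -> cmod (f n z) <= M) ->
  exists2 s, inc s & exists g, hluc (disc a (rho / 4)) (f \o s) g.
Proof.
move=> rho0 M0 hf hM.
have sub z : disc a (rho / 4) z -> disc a rho z by apply: disc_le; lra.
have [|||s ics hs] := @diagonal (fun k s => oscil a (rho / 4) f (2 * (3 / 4) ^+ k * M) s) id.
- by move=> i s t; exact: oscil_esub.
- move=> k s ics; have [r ir hr] := oscil_step rho0 k M0 (fun n => hf (s n)) (fun n => hM (s n)).
  by exists r.
- exact: inc_id.
exists s => //.
have uc e : 0 < e -> exists N, forall m n, (N <= m)%N -> (N <= n)%N -> forall z, disc a (rho / 4) z ->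
    cmod (f (s m) z - f (s n) z) < e.
  move=> e0; have [|||k hk] := @geometric_small R (3 / 4) e (2 * M) => //; try lra.
  have [N hN] := hs k; exists N => m n Nm Nn z hz; apply: le_lt_trans (hN m n Nm Nn z hz) _.
  by move: hk; rewrite (_ : 2 * M * _ = 2 * (3 / 4) ^+ k * M)//; ring.
have /choice[g hg] : forall z, exists l, disc a (rho / 4) z -> cvc (fun n => f (s n) z) l.
  move=> z; have [hz|] := pselect (disc a (rho / 4) z); last by exists 0.
  have [|l hl] := @cauchyc_cvc R (fun n => f (s n) z); last by exists l.
  by move=> e /uc[N hN]; exists N => m n Nm Nn; exact: hN.
have cv : ucvg (disc a (rho / 4)) (f \o s) g.
  move=> e e0; have e2 : 0 < e / 2 by rewrite divr_gt0.
  have [N hN] := uc _ e2; exists N => n Nn z hz /=.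
  apply: (@le_lt_trans _ _ (e / 2)); last by lra.
  have cc : cvc (fun m => f (s m) z - f (s n) z) (g z - f (s n) z).
    move=> e' /(hg z hz)[N' hN']; exists N' => m /hN'.
    by rewrite (_ : _ - _ - _ = f (s m) z - g z)//; ring.
  rewrite cmodBC; apply: (cvc_le cc); exists N => m Nm; apply: ltW; exact: hN.
exists g => p hp; exists (rho / 4 - cmod (p - a)); split.
- by rewrite subr_gt0; exact: hp.
- exists 0%N => n _; apply: holo_sub (hf (s n)) => z hz; apply: sub.
  by apply: disc_sub hz; rewrite subrK.
- by apply: ucvg_sub cv => z; apply: disc_sub; rewrite subrK.
Qed.

(* Along a segment leaving a point where |f| < e / 2, the modulus cannot exceed
   e, because |f'| <= L as long as |f| <= e. *)
Lemma small_stays_small (p : C) (rho e L : R) g : holo (disc p rho) g -> 0 < L ->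
  4 * L * rho <= e ->
  (forall z, disc p rho z -> cmod (g z) <= e -> cmod (derive1 g z) <= L) ->
  forall z w, disc p rho z -> disc p rho w -> cmod (g z) < e / 2 -> cmod (g w) <= e.
Proof.
move=> hg L0 Lr hL z w hz hw gz.
have rho0 : 0 < rho by apply: le_lt_trans hz; exact: cmod_ge0.
have e0 : 0 < e by apply: lt_le_trans Lr; rewrite !mulr_gt0.
have sd t : 0 <= t <= 1 -> disc p rho (segm z w t) by exact: disc_convex.
pose h t := g (segm z w t).
have dh t : 0 <= t <= 1 -> der (@rc R) h t (derive1 g (segm z w t) * (w - z)).
  move=> ht; apply: (@der_comp R R (@rc R) g (segm z w)); last exact: segm_der.
  by apply: holo_der hg _; exact: sd.
pose A := [set t : R | 0 <= t <= 1 /\ forall u, 0 <= u <= t -> cmod (h u) <= e].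
have A0 : A 0.
  split; first by rewrite lexx ler01.
  move=> u /andP[u0 u1]; have -> : u = 0 by apply: le_anti; rewrite u0 u1.
  by rewrite /h segm0; lra.
have supA : has_sup A by split; [exists 0|exists 1 => t [/andP[]]].
pose s := sup A.
have s0 : 0 <= s by apply: ub_le_sup A0; case: supA.
have s1 : s <= 1 by apply: ge_sup => [|t [/andP[]]//]; exists 0.
have hs : 0 <= s <= 1 by rewrite s0.
have below u : 0 <= u -> u < s -> cmod (h u) <= e.
  move=> u0 us; have su : 0 < s - u by rewrite subr_gt0.
  have [t [ht At] st] := sup_adherent su supA.
  by apply: At; rewrite u0/=; move: st; rewrite -/s; lra.
have cs := der_cont (dh s hs).
have hse : cmod (h s) <= e.
  rewrite leNgt; apply/negP => he; have [d d0 hd] := cont_cmod_gt cs he.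
  have [s00|s00] := eqVneq s 0; first by case: A0 => _ /(_ 0); rewrite lexx -s00 => /(_ isT); rewrite leNgt he.
  have sp : 0 < s by rewrite lt_def s00.
  pose u := Num.max 0 (s - d / 2).
  have us : u < s by rewrite gt_max sp/=; lra.
  have u0 : 0 <= u by rewrite le_max lexx.
  have := below u u0 us; rewrite leNgt => /negP; apply; apply: hd.
  rewrite -rcB cmod_rc ltr0_norm ?subr_lt0//.
  have : s - d / 2 <= u by rewrite le_max lexx orbT.
  by lra.
have hall u : 0 <= u <= s -> cmod (h u) <= e.
  move=> /andP[u0]; rewrite le_eqVlt => /orP[/eqP->//|]; exact: below.
have hlt : cmod (h s) < e.
  have dhs t : 0 <= t <= s -> der (@rc R) h t (derive1 g (segm z w t) * (w - z)).
    by move=> ht; apply: dh; lra.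
  have := mvt_ineq s0 dhs (M := L * (2 * rho)); rewrite subr0 => k.
  have {}k : cmod (h s - h 0) <= L * (2 * rho) * s.
    apply: k => t ht; rewrite cmodM; apply: ler_pM; rewrite ?cmod_ge0//.
      by apply: hL; [apply: sd; lra|exact: hall].
    have := cmod_tri w p z; rewrite (cmodBC p z); move: hz hw; rewrite /disc; lra.
  have := cmod_sub_ge (h s) (h 0); rewrite {2}/h segm0 in k *.
  have : L * (2 * rho) * s <= L * (2 * rho) * 1 by rewrite ler_pM2l// !mulr_gt0.
  rewrite /h segm0; move: k; rewrite /h; lra.
have [s1e|s1n] := eqVneq s 1; first by have := hall 1; rewrite s1e /h segm1; apply; rewrite lexx ler01.
have s1' : s < 1 by rewrite lt_def eq_sym s1n.
have [d d0 hd] := cont_cmod_lt cs hlt.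
pose u := Num.min 1 (s + d / 2).
have su : s < u by rewrite lt_min s1'; lra.
have u1 : u <= 1 by rewrite ge_min lexx.
have ud : u <= s + d / 2 by rewrite ge_min lexx orbT.
have : A u.
  split; first by rewrite u1; lra.
  move=> v /andP[v0 vu]; have [vs|sv] := leP v s; first by apply: hall; rewrite v0.
  apply/ltW/hd; rewrite -rcB cmod_rc gtr0_norm ?subr_gt0//; lra.
by move=> /(ub_le_sup (proj2 supA)); rewrite -/s leNgt su.
Qed.

(** By [small_stays_small] each f n is at most e or at least e / 2 on the whole disc. Infinitely
    many of the first kind yield a finite limit by Montel. Otherwise Montel applies to 1 / f n, and
    by Hurwitz the limit k is identically 0 or zero-free near p. *)
Lemma local_normal (p : C) (rho e L : R) f : 0 < rho -> 0 < e -> 0 < L -> 4 * L * rho <= e ->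
  (forall n, holo (disc p rho) (f n)) ->
  (forall n z, disc p rho z -> cmod (f n z) <= e -> cmod (derive1 (f n) z) <= L) ->
  exists2 s, inc s & (exists g, hluc (disc p (rho / 16)) (f \o s) g) \/ linf (disc p (rho / 16)) (f \o s).
Proof.
move=> rho0 e0 L0 Lr hf hL.
have sub16 z : disc p (rho / 16) z -> disc p (rho / 4) z by apply: disc_le; lra.
pose small n := forall z, disc p rho z -> cmod (f n z) <= e.
have dich n : small n \/ forall z, disc p rho z -> e / 2 <= cmod (f n z).
  have [h|h] := pselect (exists2 z, disc p rho z & cmod (f n z) < e / 2).
    left=> w hw; case: h => z hz fz.
    exact: small_stays_small (hf n) L0 Lr (hL n) _ _ hz hw fz.
  by right=> z hz; rewrite leNgt; apply/negP => fz; apply: h; exists z.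
have [io|nio] := pselect (forall N, exists2 n, (N <= n)%N & small n).
  have [s ics hs] := extract_io io.
  have [t it [g hg]] := montel rho0 e0 (fun n => hf (s n)) hs.
  by exists (s \o t); [exact: inc_comp|left; exists g; apply: hluc_subset hg].
have {nio} [N hN] : exists N, forall n, (N <= n)%N -> forall z, disc p rho z -> e / 2 <= cmod (f n z).
  apply: contrapT => hn; apply: nio => N; apply: contrapT => hn'; apply: hn.
  by exists N => n Nn; have [sn|//] := dich n; case: hn'; exists n.
pose f' n := f (N + n)%N.
have f'0 n z : disc p rho z -> f' n z != 0.
  move=> hz; rewrite -cmod_gt0; apply: lt_le_trans (hN _ (leq_addr _ _) _ hz).
  by rewrite divr_gt0.
have e2 : 0 < (e / 2)^-1 by rewrite invr_gt0 divr_gt0.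
have [||t it [k hk]] := @montel p rho (e / 2)^-1 (fun n z => (f' n z)^-1) rho0 e2.
- by move=> n; apply: holoV => //; [exact: hf|exact: f'0].
- move=> n z hz; rewrite cmodV lef_pV2 ?posrE ?divr_gt0 ?cmod_gt0 ?f'0//.
  by apply: hN => //; exact: leq_addr.
have ics : inc (fun n => (N + t n)%N) by move=> i j /it; rewrite ltn_add2l.
exists (fun n => (N + t n)%N) => //.
have hol := hluc_holo hk.
have s4 z : disc p (rho / 4) z -> disc p rho z by apply: disc_le; lra.
have [[q hq kq]|k0] := pselect (exists2 q, disc p (rho / 16) q & k q = 0).
  right=> z hz.
  have kz w : disc p (rho / 16) w -> k w = 0.
    move=> hw; have [[d d0 kd]|h] := hurwitz hk (sub16 _ hq) kq.
      (* The disc of radius 3 rho / 16 about q covers the disc of radius rho / 16 about p and stays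
         inside the one of radius rho / 4. *)
      have r8 : 0 < 3 * rho / 16 by rewrite divr_gt0// mulr_gt0.
      have sub' v : disc q (3 * rho / 16) v -> disc p (rho / 4) v.
        by apply: disc_sub; move: hq; rewrite /disc; lra.
      apply: (identity_disc r8 (holo_sub sub' hol) d0 kd).
      have := cmod_tri w p q; rewrite (cmodBC p q); move: hw hq; rewrite /disc; lra.
    have r0 : 0 < rho / 4 - cmod (q - p) by rewrite subr_gt0; exact: sub16 _ hq.
    have [n /(_ n (leqnn _)) [v hv fv]] := h _ r0.
    have hv' : disc p rho v by apply: s4; apply: disc_sub hv; rewrite subrK.
    have fv' : (f' (t n) v)^-1 = 0 := fv.
    by have := f'0 (t n) v hv'; rewrite -invr_eq0 fv' eqxx.
  have [d [d0 ef cv]] := hk z (sub16 _ hz).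
  pose d' := Num.min d (rho / 16 - cmod (z - p)).
  have d'0 : 0 < d' by rewrite lt_min d0 subr_gt0; exact: hz.
  have sd w : disc z d' w -> disc z d w by apply: disc_le; rewrite ge_min lexx.
  have sp w : disc z d' w -> disc p (rho / 16) w.
    by apply: disc_sub; rewrite -lerBrDr ge_min lexx orbT.
  exists d' => // M; have M1 : 0 < (`|M| + 1)^-1 by rewrite invr_gt0 ltr_wpDl.
  have [n0 hn0] := cv _ M1; exists n0 => n hn w hw.
  have := hn0 n hn w (sd w hw); rewrite kz ?subr0; last exact: sp.
  have fn0 : 0 < cmod (f' (t n) w) by rewrite cmod_gt0; apply/f'0/s4/sub16/sp.
  rewrite /= cmodV ltf_pV2 ?posrE ?ltr_wpDl// => /ltW; apply: le_trans.
  by have := ler_norm M; lra.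
left; exists (fun z => (k z)^-1) => z hz.
have [d [d0 ef cv]] := hk z (sub16 _ hz).
have kz : 0 < cmod (k z) by rewrite cmod_gt0; apply/eqP => kz; apply: k0; exists z.
have lt2 : cmod (k z) / 2 < cmod (k z) by lra.
have [d1 d10 hd1] := cont_cmod_gt (holo_cont hol (sub16 _ hz)) lt2.
pose d' := Num.min d (Num.min d1 (rho / 16 - cmod (z - p))).
have d'0 : 0 < d' by rewrite !lt_min d0 d10 subr_gt0; exact: hz.
have sd w : disc z d' w -> [/\ disc z d w, cmod (w - z) < d1 & disc p (rho / 16) w].
  rewrite /disc !lt_min => /andP[h1 /andP[h2 h3]]; split=> //.
  by have := cmod_tri w z p; lra.
exists d'; split=> //.
  exists 0%N => n _; apply: holo_sub (hf (N + t n)%N) => w /sd[_ _ hw]; exact/s4/sub16.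
pose c := cmod (k z) / 2.
have c0 : 0 < c by rewrite divr_gt0.
move=> e' e'0; have c2 : 0 < c / 2 by rewrite divr_gt0.
have ec : 0 < e' * (c * (c / 2)) by rewrite !mulr_gt0.
have [n1 h1] := cv _ c2; have [n2 h2] := cv _ ec.
exists (maxn n1 n2) => n; rewrite geq_max => /andP[n1n n2n] w /sd[w1 w2 w3].
have k1 := h1 n n1n w w1; have k2 := h2 n n2n w w1; rewrite /= in k1 k2.
have kw := hd1 w w2; rewrite -/c in kw.
have fw0 := f'0 (t n) w (s4 _ (sub16 _ w3)); set F := f' (t n) w in fw0 k1 k2 *.
have Fi : c / 2 < cmod F^-1.
  by have := cmod_sub_ge (k w) F^-1; rewrite (cmodBC (k w)); lra.
have kw0 : k w != 0 by rewrite -cmod_gt0; lra.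
rewrite /= -/(f' (t n) w) -/F (_ : _ - _ = (k w - F^-1) / (k w * F^-1)); last first.
  by field; rewrite kw0 fw0.
rewrite cmodM (cmodBC (k w)) cmodV cmodM ltr_pdivrMr; last by rewrite mulr_gt0 ?cmod_gt0 ?invr_eq0.
apply: (lt_le_trans k2); rewrite ler_pM2l// ler_pM// ltW//.
Qed.

End Montel.

(** * Gluing local limits over connected sets *)

Section Gluing.
Variables (R : realType).
Local Notation C := (Cplx R).
Local Notation cder := (der (fun z : C => z)).
Implicit Types (U V : C -> Prop) (f : nat -> C -> C) (g : C -> C).

(* The cover U (restricted to the indices in G) is connected when every
   predicate that is constant on its members is constant. *)
Lemma glue (T : Type) (Om : T -> Prop) (G : nat -> Prop) (U : nat -> T -> Prop)
    (A B : nat -> (nat -> nat) -> Prop) :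
  (forall i s t, A i s -> esub t s -> A i t) ->
  (forall i s t, B i s -> esub t s -> B i t) ->
  (forall i s, G i -> inc s -> exists2 r, inc r & A i (s \o r) \/ B i (s \o r)) ->
  (forall i j x s, inc s -> U i x -> U j x -> A i s -> B j s -> False) ->
  (forall x, Om x -> exists2 i, G i & U i x) ->
  (forall P : T -> Prop, (forall i x y, G i -> U i x -> U i y -> P x -> P y) ->
     forall x y, Om x -> Om y -> P x -> P y) ->
  exists2 s, inc s & (forall x, Om x -> exists i, [/\ G i, U i x & A i s]) \/
                     (forall x, Om x -> exists i, [/\ G i, U i x & B i s]).
Proof.
move=> hA hB ext excl cov conn.
have [|||s si hs] := @diagonal (fun i s => G i -> A i s \/ B i s) id.
- by move=> i s t h ts /h[h'|h']; [left; exact: hA h' ts|right; exact: hB h' ts].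
- move=> i s si; have [Gi|nG] := pselect (G i); last by exists id.
  by have [r ri h] := ext i s Gi si; exists r.
- exact: inc_id.
exists s => //; pose P x := exists i, [/\ G i, U i x & A i s].
have cP i x y : G i -> U i x -> U i y -> P x -> P y.
  move=> Gi Uix Uiy [j [Gj Ujx Aj]]; exists i; split=> //.
  by have [//|Bi] := hs i Gi; have := excl j i x s si Ujx Uix Aj Bi.
have [[x Ox Px]|nP] := pselect (exists2 x, Om x & P x).
  by left=> y Oy; exact: conn cP x y Ox Oy Px.
right=> y Oy; have [i Gi Uiy] := cov y Oy.
have [Ai|Bi] := hs i Gi; last by exists i.
by case: nP; exists y => //; exists i.
Qed.

(** The predicate is encoded as a curve chi with values 0 and 1; being locally constant, chi has
    derivative 0. Clamping makes it constant beyond [0, 1]. *)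
Lemma path_const (Q : R -> Prop) :
  (forall t, 0 <= t <= 1 -> exists2 d, 0 < d & forall u, 0 <= u <= 1 -> `|u - t| < d -> (Q u <-> Q t)) ->
  Q 0 -> Q 1.
Proof.
move=> lc Q0.
pose cl (t : R) := Num.max 0 (Num.min 1 t).
have clab t : 0 <= cl t <= 1.
  by rewrite /cl le_max lexx /= ge_max ler01 ge_min lexx.
have clid t : 0 <= t <= 1 -> cl t = t.
  by move=> /andP[h1 h2]; rewrite /cl min_r// max_r.
have clL x t : `|cl x - cl t| <= `|x - t|.
  rewrite /cl !maxEle !minEle; do ! case: ifP => /idP; rewrite ?subrr ?normr0 ?normr_ge0 //; move=> *; rewrite ler_norml; apply/andP; split;
  have := ler_norm (x - t); have := ler_norm (- (x - t)); rewrite normrN; lra.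
pose chi t : C := if `[< Q (cl t) >] then 1 else 0.
have := @rder0_cst R chi 0 1 ler01; rewrite /chi !clid ?lexx ?ler01//.
case: asboolP => // nQ1; case: asboolP => // _ h.
have : (0 : C) = 1.
  apply: h => t ht e e0; have [d d0 hd] := lc _ (clab t).
  exists d => // x; rewrite -rcB cmod_rc => xd.
  have := hd (cl x) (clab x) (le_lt_trans (clL x t) xd) => hq.
  rewrite mul0r subr0 (_ : (if `[< Q (cl x) >] then 1 else 0) = (if `[< Q (cl t) >] then 1 else 0) :> C).
    by rewrite subrr cmod0 mulr_ge0// ltW.
  by case: asboolP => h1; case: asboolP => h2 //; [case: h2; apply/hq|case: h1; apply/hq].
by move=> /eqP; rewrite eq_sym oner_eq0.
Qed.

Definition pconnected (Om : C -> Prop) := forall x y, Om x -> Om y ->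
  exists ga : R -> C, [/\ ga 0 = x, ga 1 = y &
    forall t, 0 <= t <= 1 -> Om (ga t) /\ cont (@rc R) ga t].

Lemma pconnected_convex (Om : C -> Prop) : is_convex Om -> pconnected Om.
Proof.
move=> cO x y Ox Oy; exists (segm x y); rewrite segm0 segm1; split=> // t ht.
by split; [exact: cO|exact: segm_cont].
Qed.

(** Two logarithms are joined by a segment; the modulus of its exponential is the exponential of a
    convex combination, hence stays above r. *)
Lemma pconnected_outside (r : R) : 0 <= r -> pconnected (fun z : C => r < cmod z).
Proof.
move=> r0 x y hx hy.
have x0 : x != 0 by rewrite -cmod_gt0 (le_lt_trans r0).
have y0 : y != 0 by rewrite -cmod_gt0 (le_lt_trans r0).
have [s es _] := cexp_surj x0; have [t et _] := cexp_surj y0.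
exists (fun u => cexp (segm s t u)); rewrite segm0 segm1; split=> // u /andP[u0 u1].
split; last first.
  by apply: (cont_comp (der_cont (cder_cexp (segm s t u)))); exact: segm_cont.
rewrite cmod_cexp; pose m := Num.min (Re s) (Re t).
have mr : r < expR m.
  by rewrite /m minEle; case: ifP => _; rewrite -cmod_cexp ?es ?et.
apply: (lt_le_trans mr); rewrite ler_expR /segm ReD Re_rcM ReB.
have m1 : m <= Re s by rewrite ge_min lexx.
have m2 : m <= Re t by rewrite ge_min lexx orbT.
nra.
Qed.

Lemma pconnected_cover (Om : C -> Prop) (G : nat -> Prop) (U : nat -> C -> Prop) :
  pconnected Om -> (forall i, G i -> open_set (U i)) ->
  (forall x, Om x -> exists2 i, G i & U i x) ->
  forall P : C -> Prop, (forall i x y, G i -> U i x -> U i y -> P x -> P y) ->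
     forall x y, Om x -> Om y -> P x -> P y.
Proof.
move=> pO oU cov P hP x y Ox Oy.
have [ga [<- <- hga]] := pO x y Ox Oy.
apply: (path_const (Q := fun t => P (ga t))) => t ht.
have [Og cg] := hga t ht; have [i Gi Ui] := cov _ Og.
have [d d0 hd] := oU i Gi _ Ui; have [d' d'0 hd'] := cg d d0.
exists d' => // u hu; rewrite -(@cmod_rc R) rcB => /hd' /hd Uu.
by split; exact: hP Gi _ _.
Qed.

(** Discs with rational data form a countable base, so a diagonal argument can run through them. *)
Lemma rat_disc (p : C) (d : R) : 0 < d -> exists q : rat * rat * rat,
  disc (Complex (ratr q.1.1) (ratr q.1.2)) (ratr q.2) p /\
  forall z, disc (Complex (ratr q.1.1) (ratr q.1.2)) (ratr q.2) z -> disc p d z.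
Proof.
move=> d0.
have [x hx] := @rat_in_itvoo R (Re p - d / 8) (Re p + d / 8) ltac:(lra).
have [y hy] := @rat_in_itvoo R (Im p - d / 8) (Im p + d / 8) ltac:(lra).
have [r hr] := @rat_in_itvoo R (d / 4) (d / 2) ltac:(lra).
move: hx hy hr; rewrite !in_itv /= => /andP[x1 x2] /andP[y1 y2] /andP[r1 r2].
exists (x, y, r) => /=; set c : C := Complex _ _.
have pc : cmod (p - c) < d / 4.
  apply: (le_lt_trans (cmod_le_ReIm _)); rewrite ReB ImB /=.
  have : `|Re p - ratr x| < d / 8 by rewrite ltr_norml; apply/andP; split; lra.
  have : `|Im p - ratr y| < d / 8 by rewrite ltr_norml; apply/andP; split; lra.
  by lra.
split; first by rewrite /disc; lra.
by move=> z; apply: disc_sub; rewrite cmodBC; lra.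
Qed.

Lemma linf_subset U V f : (forall z, V z -> U z) -> linf U f -> linf V f.
Proof. by move=> VU h p /VU /h. Qed.

Lemma hluc_esub U f g s t : hluc U (f \o s) g -> esub t s -> hluc U (f \o t) g.
Proof.
move=> h [N0 [r [hr e]]] p /h[d [d0 [N1 ef] cv]]; exists d; split=> //.
  exists (maxn N0 N1) => n; rewrite geq_max => /andP[n0 n1] /=; rewrite e//.
  by apply: ef; exact: leq_trans n1 (hr n).
move=> eps /cv[N hN]; exists (maxn N0 N) => n; rewrite geq_max => /andP[n0 n1] z hz /=.
by rewrite e//; apply: hN => //; exact: leq_trans n1 (hr n).
Qed.

Lemma linf_esub U f s t : linf U (f \o s) -> esub t s -> linf U (f \o t).
Proof.
move=> h [N0 [r [hr e]]] p /h[d d0 hd]; exists d => // M.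
have [N hN] := hd M; exists (maxn N0 N) => n; rewrite geq_max => /andP[n0 n1] z hz /=.
by rewrite e//; apply: hN => //; exact: leq_trans n1 (hr n).
Qed.

Lemma hluc_linf_disjoint U V f g p : hluc U f g -> linf V f -> U p -> V p -> False.
Proof.
move=> hf hl Up Vp; have [N hN] := hluc_pt hf Up ltr01.
have [d d0 hd] := hl p Vp; have [N' hN'] := hd (cmod (g p) + 1).
have := hN (maxn N N') (leq_maxl _ _); have := hN' (maxn N N') (leq_maxr _ _) p (disc_center p d0).
by have := cmod_sub_ge (f (maxn N N') p) (g p); lra.
Qed.

Lemma hluc_glue (Om : C -> Prop) (U : nat -> C -> Prop) (gg : nat -> C -> C) f (G : nat -> Prop) :
  (forall i, G i -> open_set (U i)) ->
  (forall x, Om x -> exists i, [/\ G i, U i x & exists g, hluc (U i) f g]) ->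
  exists g, hluc Om f g.
Proof.
move=> oU cov.
(* The global limit is chosen pointwise, so it agrees with every local limit without a compatibility
   check. *)
have /choice[g hg] : forall z, exists l, (exists l, cvc (f^~ z) l) -> cvc (f^~ z) l.
  by move=> z; have [[l hl]|n] := pselect (exists l, cvc (f^~ z) l); [exists l|exists 0].
exists g => p /cov[i [Gi Ui [g' hg']]].
have [d [d0 ef cv]] := hg' p Ui; have [d' d'0 hd'] := oU i Gi _ Ui.
have sd z : disc p (Num.min d d') z -> disc p d z /\ U i z.
  by rewrite /disc lt_min => /andP[? /hd'].
exists (Num.min d d'); split; first by rewrite lt_min d0.
  by apply: eholo_sub ef => z /sd[].
move=> e /cv[N hN]; exists N => n Nn z /sd[z1 z2].
have cz := hluc_pt hg' z2.
by rewrite (cvc_uniq (hg z (ex_intro _ _ cz)) cz); exact: hN.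
Qed.

(** Takes the place of Marty's criterion: the derivative is controlled only where f n is small, and
    from an index depending on the point. *)
Definition locally_lip (Om : C -> Prop) f := forall p, Om p -> exists r e L : R, exists N : nat,
  [/\ 0 < r, 0 < e, 0 < L, forall z, disc p r z -> Om z &
    forall n, (N <= n)%N -> holo (disc p r) (f n) /\
      forall z, disc p r z -> cmod (f n z) <= e -> cmod (derive1 (f n) z) <= L].

Theorem normal_on (Om : C -> Prop) f : pconnected Om -> locally_lip Om f ->
  exists2 s, inc s & (exists g, hluc Om (f \o s) g) \/ linf Om (f \o s).
Proof.
move=> pO hf.
pose U i z := if unpickle i is Some q then
  let q : rat * rat * rat := q in disc (Complex (ratr q.1.1) (ratr q.1.2) : C) (ratr q.2) z else False.
have oU i : open_set (U i).
  by rewrite /U; case: unpickle => [q|]; [exact: disc_open|move=> z []].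
(* The good discs are those on which every subsequence can be refined to one with a finite or an
   infinite limit. *)
pose G i := forall s, inc s -> exists2 r, inc r &
  (exists g, hluc (U i) (f \o (s \o r)) g) \/ linf (U i) (f \o (s \o r)).
have cov x : Om x -> exists2 i, G i & U i x.
  move=> Ox; have [r [e [L [N [r0 e0 L0 _ hN]]]]] := hf x Ox.
  pose rho := Num.min r (e / (4 * L)).
  have rho0 : 0 < rho by rewrite lt_min r0 divr_gt0// mulr_gt0.
  have sr z : disc x rho z -> disc x r z by apply: disc_le; rewrite ge_min lexx.
  have Lr : 4 * L * rho <= e.
    by rewrite mulrC -ler_pdivlMr ?mulr_gt0// ge_min lexx orbT.
  have r16 : 0 < rho / 16 by rewrite divr_gt0.
  have [q [qx qs]] := rat_disc x r16.
  exists (pickle q); last by rewrite /U pickleK.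
  move=> s si; pose f' n := f (s (N + n)%N).
  have big n : (N <= s (N + n))%N by rewrite (leq_trans (leq_addr n N))// inc_ge.
  have [||t ti h] := @local_normal R x rho e L f' rho0 e0 L0 Lr.
  - by move=> n; have [h _] := hN _ (big n); apply: holo_sub h.
  - by move=> n z /sr hz; have [_ h] := hN _ (big n); exact: h.
  exists (fun n => N + t n)%N; first by move=> i j /ti; rewrite ltn_add2l.
  have sU z : U (pickle q) z -> disc x (rho / 16) z by rewrite /U pickleK => /qs.
  have -> : f \o (s \o (fun n => N + t n)%N) = f' \o t by [].
  case: h => [[g hg]|h]; [left; exists g; exact: hluc_subset sU hg|right].
  exact: linf_subset sU h.
have [||||||s si h] := @glue C Om G U (fun i s => exists g, hluc (U i) (f \o s) g)
    (fun i s => linf (U i) (f \o s)).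
- by move=> i s t [g hg] ts; exists g; exact: hluc_esub hg ts.
- by move=> i s t; exact: linf_esub.
- by move=> i s Gi /Gi.
- by move=> i j x s _ Ui Uj [g hg] hl; exact: hluc_linf_disjoint hg hl Ui Uj.
- exact: cov.
- by apply: pconnected_cover => // i _; exact: oU.
exists s => //; case: h => h; [left|right].
  exact: (@hluc_glue Om U (fun=> id) (f \o s) G (fun i _ => oU i) h).
move=> p /h[i [_ Ui li]]; exact: li.
Qed.

End Gluing.

(** * Entire functions *)

Section EntireFunctions.
Variables (R : realType).
Local Notation C := (Cplx R).
Local Notation cder := (der (fun z : C => z)).
Local Notation ccont := (cont (fun z : C => z)).
Implicit Types (U : C -> Prop) (f g : C -> C).

Definition entire f := forall rho, holo (disc 0 rho) f.

Lemma entireP f : entire f <-> forall z, exists l, cder f z l.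
Proof.
split=> [h z|h rho z _]; last exact: h.
by apply: (h (cmod z + 1)); rewrite /disc subr0 ltrDl.
Qed.

Lemma entire_holo U f : entire f -> holo U f.
Proof. by move=> /entireP h z _; exact: h. Qed.

Lemma entire_der f z : entire f -> cder f z (derive1 f z).
Proof. by move=> /entireP /(_ z)[l dl]; rewrite (cder_derive1 dl). Qed.

Lemma entire_derive f : entire f -> entire (derive1 f).
Proof. by move=> h rho; apply: holo_derive; [exact: disc_open|exact: h]. Qed.

Lemma entire_derive1n f n : entire f -> entire (derive1n n f).
Proof.
by move=> h; elim: n => [|n IH]; rewrite ?derive1n0// derive1nS; exact: entire_derive.
Qed.

Lemma cder0_cst U f : is_convex U -> (forall z, U z -> cder f z 0) ->
  forall z w, U z -> U w -> f z = f w.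
Proof.
move=> cU df z w Uz Uw; apply/esym.
have := @rder0_cst R (fun t => f (segm z w t)) 0 1 ler01; rewrite segm0 segm1; apply.
move=> t ht; rewrite -(mul0r (w - z)).
by apply: (@der_comp R R (@rc R) f (segm z w)); [exact/df/cU|exact: segm_der].
Qed.

Lemma convex_all : is_convex (fun _ : C => True). Proof. by []. Qed.
Lemma open_all : open_set (fun _ : C => True). Proof. by move=> p _; exists 1. Qed.

(** With F a primitive of f' / f, the function f exp(-F) has derivative 0; a logarithm of its
    constant value corrects F. *)
Lemma holo_log U f z0 : is_convex U -> open_set U -> U z0 -> holo U f ->
  (forall z, U z -> f z != 0) ->
  exists2 h, holo U h & forall z, U z -> cexp (h z) = f z.
Proof.
move=> cU oU Uz0 hf f0.
have hq : holo U (fun z => derive1 f z * (f z)^-1).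
  by apply: holoM; [exact: holo_derive|exact: holoV].
have [F dF] := primitive_convex cU oU Uz0 hq.
pose k z := f z * cexp (- F z).
have dk z : U z -> cder k z 0.
  move=> Uz; have dE : cder (fun z => cexp (- F z)) z (cexp (- F z) * - (derive1 f z * (f z)^-1)).
    by apply: (@der_comp R C (fun z => z) (@cexp R) (fun z => - F z)); [exact: cder_cexp|apply: derN; exact: dF].
  apply: (der_eq (derM (holo_der hf Uz) dE)).
  by field; exact: f0.
have k0 : k z0 != 0 by rewrite mulf_neq0 ?f0 ?cexp_neq0.
have [w ew _] := cexp_surj k0.
exists (fun z => F z + w).
  by apply: holoD; [move=> z Uz; eexists; exact: dF|exact: holo_cst].
move=> z Uz; rewrite cexpD ew (cder0_cst cU dk Uz0 Uz) /k cexpN.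
by field; exact: cexp_neq0.
Qed.

Lemma liouville_linear f (A B : R) : entire f -> (forall z, cmod (f z) <= A + B * cmod z) ->
  0 <= A -> 0 <= B -> forall z, f z = f 0 + derive1 f 0 * z.
Proof.
move=> ef fb A0 B0 z; apply/eqP; rewrite -subr_eq0 -cmod_eq0 eq_le cmod_ge0 andbT.
apply/ler_addgt0Pr => e e0; rewrite add0r.
(* On a disc of radius rho >= 1 one has |f| <= (A + B) rho, so the Taylor remainder at z is at most
   K / rho. *)
pose K := 4 * (A + B) * cmod z ^+ 2.
have K0 : 0 <= K by rewrite mulr_ge0 ?sqr_ge0// mulr_ge0// addr_ge0.
pose rho := 1 + cmod z + K / e.
have Ke : 0 <= K / e by rewrite divr_ge0// ltW.
have z0 := cmod_ge0 z.
have rho1 : 1 <= rho by rewrite /rho; lra.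
have rho0 : 0 < rho by lra.
have [|_ h] := taylor2 rho0 (ef rho) (M := (A + B) * rho).
  move=> w; rewrite /disc subr0 => wr; apply: (le_trans (fb w)).
  have : B * cmod w <= B * rho by rewrite ler_wpM2l// ltW.
  by nra.
have zr : disc 0 rho z by rewrite /disc subr0 /rho; lra.
have := h z zr; rewrite subr0 (_ : f z - f 0 - _ = f z - (f 0 + derive1 f 0 * z)); last by ring.
move=> /le_trans; apply.
rewrite (_ : _ * cmod z ^+ 2 = K / rho); last by rewrite /K; field; rewrite gt_eqF.
rewrite ler_pdivrMr// mulrC -ler_pdivrMr// /rho.
by lra.
Qed.

Lemma liouville f (A : R) : entire f -> (forall z, cmod (f z) <= A) -> forall z w, f z = f w.
Proof.
move=> ef fb; have A0 : 0 <= A by apply: le_trans (fb 0); exact: cmod_ge0.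
move=> z w; apply: (cder0_cst convex_all (f := f)) => // {}z _.
apply: (der_eq (entire_der z ef)); apply/eqP; rewrite -cmod_eq0 eq_le cmod_ge0 andbT.
apply/ler_addgt0Pr => e e0; rewrite add0r.
have r0 : 0 < 2 * A / e + 1 by rewrite ltr_wpDl// divr_ge0 ?mulr_ge0// ltW.
have [//|h _] := taylor2 r0 (entire_holo (U := disc z (2 * A / e + 1)) ef) (M := A).
apply: (le_trans h); rewrite ler_pdivrMr// mulrDr mulr1 mulrCA divff ?gt_eqF// mulr1.
by lra.
Qed.

Lemma sqr_cmod_subrc (w : C) (x : R) :
  cmod (w - rc x) ^+ 2 = (Re w - x) ^+ 2 + Im w ^+ 2.
Proof. by rewrite sqr_cmod ReB ImB /= subr0. Qed.

Lemma sqr_cmod_addrc (w : C) (x : R) :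
  cmod (w + rc x) ^+ 2 = (Re w + x) ^+ 2 + Im w ^+ 2.
Proof. by rewrite sqr_cmod ReD ImD /= addr0. Qed.

(** With g = f - f a, the map g / (2 A - g) takes Re g <= A into the unit disc. Schwarz' lemma
    bounds it by 1/2 on the disc of half the radius, and solving for g gives 2 A. *)
Lemma borel_caratheodory (a : C) rho f (A : R) : 0 < rho -> holo (disc a rho) f -> 0 < A ->
  (forall z, disc a rho z -> Re (f z - f a) <= A) ->
  forall z, cmod (z - a) <= rho / 2 -> cmod (f z - f a) <= 2 * A.
Proof.
move=> rho0 hf A0 hA z hz.
have zr : disc a rho z by rewrite /disc; lra.
pose g w := f w - f a.
have den w : disc a rho w -> rc (2 * A) - g w != 0.
  move=> /hA h; apply/eqP => /(congr1 (fun z : C => Re z)); rewrite ReB /= -/(g w).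
  by rewrite -/(g w) in h; lra.
have hg : holo (disc a rho) g by apply: holoB => //; exact: holo_cst.
pose phi w := g w * (rc (2 * A) - g w)^-1.
have hphi : holo (disc a rho) phi.
  by apply: holoM => //; apply: holoV => //; apply: holoB => //; exact: holo_cst.
have phia : phi a = 0 by rewrite /phi /g subrr mul0r.
have phi1 w : disc a rho w -> cmod (phi w) <= 1.
  move=> hw; rewrite /phi cmodM cmodV ler_pdivrMr ?cmod_gt0 ?den// mul1r.
  rewrite -ler_sqr ?nnegrE ?cmod_ge0// cmodBC sqr_cmod_subrc sqr_cmod lerD2r.
  have := hA w hw; rewrite -/(g w) => h.
  have -> : (Re (g w) - 2 * A) ^+ 2 = Re (g w) ^+ 2 + 4 * A * (A - Re (g w)) by ring.
  by rewrite lerDl mulr_ge0 ?subr_ge0// mulr_ge0// ltW.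
have := schwarz rho0 hphi phia phi1 zr; rewrite mul1r => s1.
have s2 : cmod (phi z) <= 1 / 2.
  by apply: (le_trans s1); rewrite ler_pdivrMr//; lra.
have E : g z = phi z * (rc (2 * A) - g z) by rewrite /phi mulfVK// den.
have : cmod (g z) <= 1 / 2 * (2 * A + cmod (g z)).
  rewrite {1}E cmodM; apply: ler_pM; rewrite ?cmod_ge0//.
  by apply: (le_trans (cmodB_le _ _)); rewrite cmod_rc gtr0_norm ?mulr_gt0.
by rewrite -/(g z); lra.
Qed.

(** A logarithm h of f satisfies Re (h z) <= A + B |z|. Borel-Caratheodory on radius 2 |z| + 1 turns
    this into linear growth of |h|, so h is affine. *)
Lemma zero_free_exp_type f (A B : R) : entire f -> (forall z, f z != 0) -> 0 <= A -> 0 <= B ->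
  (forall z, cmod (f z) <= expR (A + B * cmod z)) ->
  exists a b : C, forall z, f z = cexp (a * z + b).
Proof.
move=> ef f0 A0 B0 fb.
have [h hh eh] := @holo_log (fun=> True) f 0 convex_all open_all I (entire_holo ef) (fun z _ => f0 z).
have eh' : entire h by apply/entireP => z; exact: hh.
have reh z : Re (h z) <= A + B * cmod z.
  by rewrite -ler_expR -cmod_cexp eh.
pose c := cmod (h 0).
have c0 : 0 <= c by exact: cmod_ge0.
have hb z : cmod (h z) <= (c + 2 * (A + c + B + 1)) + 4 * B * cmod z.
  have z0 := cmod_ge0 z.
  pose rho := 2 * cmod z + 1.
  have rho0 : 0 < rho by rewrite /rho; lra.
  pose A' := A + B * rho + c + 1.
  have A'0 : 0 < A'.
    by have := mulr_ge0 B0 (ltW rho0); rewrite /A'; lra.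
  have := borel_caratheodory rho0 (eh' rho) A'0 _ (z := z).
  rewrite subr0 => k; have {}k : cmod (h z - h 0) <= 2 * A'.
    apply: k; last by rewrite /rho; lra.
    move=> w; rewrite /disc subr0 => wr; rewrite ReB.
    have : B * cmod w <= B * rho by rewrite ler_wpM2l// ltW.
    have := reh w; have := Re_le_cmod (h 0); rewrite ler_norml -/c => /andP[? ?].
    by rewrite /A'; lra.
  have := cmod_sub_ge (h z) (h 0); rewrite -/c; move: k; rewrite /A' /rho; lra.
have lin := liouville_linear eh' hb.
have k1 : 0 <= c + 2 * (A + c + B + 1) by lra.
have k2 : 0 <= 4 * B by lra.
exists (derive1 h 0), (h 0) => z; rewrite -(eh z I) (lin k1 k2 z).
by congr cexp; rewrite addrC.
Qed.

Lemma derive_exp_type f (A B : R) : entire f -> 0 <= B ->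
  (forall z, cmod (f z) <= expR (A + B * cmod z)) ->
  forall z, cmod (derive1 f z) <= expR (A + B + 1 + B * cmod z).
Proof.
move=> ef B0 fb z.
have [|h _] := taylor2 ltr01 (entire_holo (U := disc z 1) ef) (M := expR (A + B + B * cmod z)).
  move=> w hw; apply: (le_trans (fb w)); rewrite ler_expR.
  have wz : cmod w <= 1 + cmod z by have := cmod_sub_ge w z; move: hw; rewrite /disc; lra.
  by have := ler_wpM2l B0 wz; rewrite mulrDr mulr1; lra.
apply: (le_trans h); rewrite divr1 (_ : A + B + 1 + _ = 1 + (A + B + B * cmod z)); last by ring.
rewrite [leRHS]expRD ler_wpM2r ?expR_ge0//.
by have := expR_ge1Dx (1 : R); lra.
Qed.

Lemma cvc_cont f l (u : nat -> C) : ccont f l -> cvc u l -> cvc (fun n => f (u n)) (f l).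
Proof. by move=> cf cu e /cf[d /cu[N hN] hd]; exists N => n /hN /hd. Qed.

Lemma nearest_point (Z : C -> Prop) (z z0 : C) : Z z0 ->
  (forall u l, (forall n : nat, Z (u n)) -> cvc u l -> Z l) ->
  exists zeta, [/\ Z zeta, cmod (zeta - z) <= cmod (z0 - z) &
    forall w, cmod (w - z) < cmod (zeta - z) -> ~ Z w].
Proof.
move=> Zz0 cZ.
pose D := [set x : R | exists2 w, Z w & x = cmod (w - z)].
have hD : has_inf D.
  split; first by exists (cmod (z0 - z)), z0.
  by exists 0 => x [w _ ->]; exact: cmod_ge0.
have lb w : Z w -> inf D <= cmod (w - z).
  by move=> Zw; apply: ge_inf; [case: hD|exists w].
have /choice[u hu] : forall n : nat, exists w, Z w /\ cmod (w - z) < inf D + n.+1%:R^-1.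
  move=> n; have e0 : 0 < n.+1%:R^-1 :> R by rewrite invr_gt0.
  by have [x [w Zw ->] hw] := inf_adherent e0 hD; exists w.
have [|s si [l hl]] := @bw R u (inf D + 1 + cmod z).
  move=> n; have [_ h] := hu n; have := cmod_sub_ge (u n) z.
  have : n.+1%:R^-1 <= 1 :> R by rewrite invf_le1// ler1n.
  by move: h; move: (n.+1%:R^-1) => y; lra.
have Zl : Z l by apply: cZ hl => n; have [] := hu (s n).
have dl : cmod (l - z) <= inf D.
  apply/ler_addgt0Pr => e e0; have e2 : 0 < e / 2 by rewrite divr_gt0.
  have [N1 h1] := hl _ e2; have [N2 h2] := inv_lt e2.
  pose n := maxn N1 N2; have k1 := h1 n (leq_maxl _ _).
  have k2 := h2 _ (leq_trans (leq_maxr N1 N2) (inc_ge si n)).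
  have [_ k3] := hu (s n).
  have := cmod_tri l (u (s n)) z; rewrite (cmodBC l (u (s n))).
  by move: k1 k2 k3 => /=; move: ((s n).+1%:R^-1) => y; lra.
exists l; split=> //; first exact: le_trans dl (lb _ Zz0).
move=> w wl Zw; have := lb w Zw; rewrite leNgt => /negP; apply.
exact: lt_le_trans wl dl.
Qed.

(* Harnack's inequality for log|f| on the largest disc about s where |f| > 1,
   and the bound on its gradient at a boundary point where |f| = 1. *)
Lemma growth_from_level_curve f (K : R) s s0 : entire f -> 0 <= K ->
  (forall z, cmod (f z) = 1 -> cmod (derive1 f z) <= K) -> cmod (f s0) <= 1 ->
  cmod (f s) <= expR (2 * K * cmod (s - s0)).
Proof.
move=> ef K0 hK fs0.
have [fs|fs] := leP (cmod (f s)) 1.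
  by apply: (le_trans fs); rewrite -expR0 ler_expR !mulr_ge0 ?cmod_ge0.
have cf z : ccont f z by exact: der_cont (entire_der z ef).
have [|zeta [fz zs far]] := @nearest_point (fun z => cmod (f z) <= 1) s s0 fs0.
  move=> u l hu ul; apply: (cvc_le (cvc_cont (cf l) ul)).
  by exists 0%N => n _; exact: hu.
set d := cmod (zeta - s) in zs far.
have d0 : 0 < d.
  rewrite cmod_gt0 subr_eq0; apply/eqP => e; move: fz; rewrite e leNgt fs//.
have f1 w : disc s d w -> 1 < cmod (f w) by move=> /far; rewrite ltNge => /negP.
have fz1 : cmod (f zeta) = 1.
  (* A value of modulus below 1 at zeta would persist slightly closer to s, against the choice of
     zeta. *)
  apply/eqP; rewrite eq_le fz/= leNgt; apply/negP => h.
  have [e e0 he] := cont_cmod_lt (cf zeta) h.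
  pose t := Num.min 1 (e / d / 2).
  have t0 : 0 < t by rewrite lt_min ltr01 !divr_gt0.
  have t1 : t <= 1 by rewrite ge_min lexx.
  have te : t * d <= e / 2.
    by rewrite -ler_pdivlMr// mulrAC ge_min lexx orbT.
  have w1 : disc s d (segm zeta s t).
    rewrite /disc (_ : _ - s = rc (1 - t) * (zeta - s)); last by rewrite /segm rcB rc1; ring.
    rewrite cmodM cmod_rc ger0_norm ?subr_ge0// -/d; nra.
  have := f1 _ w1; rewrite ltNge => /negP; apply; apply/ltW/he.
  by rewrite /segm addrC addKr cmodM cmod_rc gtr0_norm// (cmodBC s) -/d; lra.
have [|h0 hh0 eh0] := @holo_log (disc s d) f s (disc_convex (a := s) (r := d)) (disc_open (a := s) (r := d)) (disc_center s d0) (entire_holo ef).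
  by move=> z /f1; rewrite -cmod_gt0; lra.
(* Subtracting the imaginary part at s makes h s real, so that phi below vanishes at s. *)
pose h z := h0 z - Complex 0 (Im (h0 s)).
have hh : holo (disc s d) h by apply: holoB => //; exact: holo_cst.
have reh z : disc s d z -> cmod (f z) = expR (Re (h z)).
  by move=> hz; rewrite -eh0// cmod_cexp /h ReB /= subr0.
pose x0 := Re (h s).
have hs : h s = rc x0.
  by apply: Ceq; rewrite /x0//= /h ImB /= subrr.
have repos z : disc s d z -> 0 < Re (h z).
  by move=> hz; have := f1 z hz; rewrite reh// -[X in X < _]expR0 ltr_expR.
have x00 : 0 < x0 by apply: repos; exact: disc_center.
have den z : disc s d z -> h z + rc x0 != 0.
  by move=> /repos h1; apply/eqP => /(congr1 (fun z : C => Re z)); rewrite ReD /=; lra.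
pose phi z := (h z - rc x0) * (h z + rc x0)^-1.
have hphi : holo (disc s d) phi.
  apply: holoM; first by apply: holoB => //; exact: holo_cst.
  by apply: holoV => //; apply: holoD => //; exact: holo_cst.
have phis : phi s = 0 by rewrite /phi hs subrr mul0r.
have phi1 z : disc s d z -> cmod (phi z) <= 1.
  move=> hz; rewrite /phi cmodM cmodV ler_pdivrMr ?cmod_gt0 ?den// mul1r.
  rewrite -ler_sqr ?nnegrE ?cmod_ge0// sqr_cmod_subrc sqr_cmod_addrc lerD2r.
  have := repos z hz => rp.
  have -> : (Re (h z) + x0) ^+ 2 = (Re (h z) - x0) ^+ 2 + 4 * (Re (h z) * x0) by ring.
  by rewrite lerDl mulr_ge0// mulr_ge0// ltW.
have harnack z t : disc s d z -> 0 <= t < 1 -> cmod (z - s) = t * d ->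
    x0 * (1 - t) <= Re (h z) * (1 + t).
  move=> hz /andP[t0 t1] zt; have := schwarz d0 hphi phis phi1 hz.
  rewrite zt mulfK ?gt_eqF// mul1r /phi cmodM cmodV ler_pdivrMr ?cmod_gt0 ?den// => k.
  have rp := repos z hz.
  have : (Re (h z) - x0) ^+ 2 <= (t * (Re (h z) + x0)) ^+ 2.
    have : cmod (h z - rc x0) ^+ 2 <= (t * cmod (h z + rc x0)) ^+ 2.
      by rewrite ler_sqr ?nnegrE ?mulr_ge0 ?cmod_ge0.
    rewrite !exprMn sqr_cmod_subrc sqr_cmod_addrc.
    have : t ^+ 2 * Im (h z) ^+ 2 <= Im (h z) ^+ 2.
      by rewrite ler_piMl ?sqr_ge0// expr_le1// ltW.
    by lra.
  have p0 : 0 <= t * (Re (h z) + x0) by apply: mulr_ge0 => //; lra.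
  rewrite -real_normK ?num_real// ler_sqr ?nnegrE//.
  by rewrite ler_norml => /andP[]; lra.
(* At distance t d from zeta towards s, Harnack gives |f w| >= 1 + x0 t / 2, while the derivative at
   zeta gives |f w| <= 1 + K t d + o(t). *)
have key : x0 <= 2 * (K * d).
  apply/ler_addgt0Pr => e e0.
  have e'0 : 0 < e / (2 * d) by rewrite divr_gt0// mulr_gt0.
  have [d' d'0 hd'] := entire_der zeta ef e'0.
  pose t := Num.min (1 / 2) (d' / d / 2).
  have t0 : 0 < t by rewrite lt_min !divr_gt0.
  have t1 : t <= 1 / 2 by rewrite ge_min lexx.
  have te : t * d <= d' / 2.
    by rewrite -ler_pdivlMr// mulrAC ge_min lexx orbT.
  pose w := segm zeta s t.
  have ws : cmod (w - s) = (1 - t) * d.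
    rewrite (_ : _ - s = rc (1 - t) * (zeta - s)); last by rewrite /w /segm rcB rc1; ring.
    by rewrite cmodM cmod_rc ger0_norm// subr_ge0; lra.
  have wz : cmod (w - zeta) = t * d.
    by rewrite /w /segm addrC addKr cmodM cmod_rc gtr0_norm// (cmodBC s).
  have w1 : disc s d w by rewrite /disc ws; nra.
  have := harnack w (1 - t) w1 _ ws => k1.
  have {}k1 : x0 * t <= Re (h w) * 2.
    have : x0 * (1 - (1 - t)) <= Re (h w) * (1 + (1 - t)) by apply: k1; lra.
    have := repos w w1 => rp; have : Re (h w) * (1 + (1 - t)) <= Re (h w) * 2.
      by rewrite ler_pM2l//; lra.
    have -> : 1 - (1 - t) = t by ring.
    by lra.
  have k2 := hd' w; rewrite wz in k2.
  have {}k2 : cmod (f w - f zeta - derive1 f zeta * (w - zeta)) <= e / (2 * d) * (t * d).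
    by apply: k2; lra.
  have k3 : cmod (f w) <= 1 + K * (t * d) + e / (2 * d) * (t * d).
    rewrite (_ : f w = (f w - f zeta - derive1 f zeta * (w - zeta)) + (f zeta + derive1 f zeta * (w - zeta))); last by ring.
    apply: (le_trans (cmodD _ _)).
    have := cmodD (f zeta) (derive1 f zeta * (w - zeta)); rewrite cmodM wz fz1.
    have : cmod (derive1 f zeta) * (t * d) <= K * (t * d).
      by rewrite ler_wpM2r ?hK// mulr_ge0// ltW.
    by lra.
  have k4 : 1 + Re (h w) <= cmod (f w) by rewrite reh// expR_ge1Dx.
  have E : e / (2 * d) * (t * d) = e / 2 * t by field; rewrite gt_eqF.
  have : x0 * t <= (2 * (K * d) + e) * t.
    have E' : K * (t * d) = K * d * t by ring.
    rewrite E E' in k3; have -> : (2 * (K * d) + e) * t = 2 * (K * d * t) + 2 * (e / 2 * t) by field.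
    by lra.
  by rewrite ler_pM2r.
rewrite reh; last exact: disc_center.
rewrite ler_expR -/x0; apply: (le_trans key).
rewrite mulrA ler_wpM2l ?mulr_ge0// (cmodBC s s0); exact: zs.
Qed.

End EntireFunctions.

(** * Differential monomials *)

Section DiffMonomial.
Variables (R : realType) (k : nat) (q : nat -> nat).
Local Notation C := (Cplx R).
Local Notation cder := (der (fun z : C => z)).
Local Notation ccont := (cont (fun z : C => z)).
Implicit Types (U V : C -> Prop) (f g : C -> C).

Definition dmon f (z : C) : C := \prod_(0 <= i < k.+1) derive1n i f z ^+ q i.
Definition mon_deg := (\sum_(0 <= i < k.+1) q i)%N.
Definition mon_weight := (\sum_(0 <= i < k.+1) i * q i)%N.

(** The multiplicity condition expressed by derivatives: it also holds where f vanishes identically,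
    and in this form it passes to limits. *)
Definition flat_zeros U f := forall a, U a -> f a = 0 ->
  forall i, (i < k)%N -> derive1n i f a = 0.

Definition admissible U f :=
  [/\ holo U f, flat_zeros U f & forall z, U z -> dmon f z <> 1].

(** Termwise i (q i) <= k (q i), with strict inequality for i = 0. *)
Lemma weight_lt : (1 <= k)%N -> (1 <= q 0)%N -> (mon_weight < k * mon_deg)%N.
Proof.
move=> hk h0; rewrite /mon_weight /mon_deg big_distrr/= 2?big_nat_recl//.
rewrite mul0n -addSn leq_add ?muln_gt0 ?hk ?h0//.
by rewrite !big_nat; apply: leq_sum => i /andP[_ ik]; rewrite leq_mul2r ik orbT.
Qed.

Lemma deg_ge i : (i <= k)%N -> (q i <= mon_deg)%N.
Proof.
move=> ik; rewrite /mon_deg big_mkord (bigD1 (Ordinal (ik : (i < k.+1)%N)))//=.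
exact: leq_addr.
Qed.

Lemma admissible_sub U V f : (forall z, V z -> U z) -> admissible U f -> admissible V f.
Proof. by move=> VU [h1 h2 h3]; split=> [z|z|z] /VU; [exact: h1|exact: h2|exact: h3]. Qed.

Lemma open_affine U (a b : C) : open_set U -> open_set (fun z => U (a + b * z)).
Proof.
move=> oU p /oU[d d0 hd]; have b0 := cmod_ge0 b.
exists (d / (cmod b + 1)); first by rewrite divr_gt0// ltr_wpDl.
move=> z hz; apply: hd; rewrite (_ : _ - _ = b * (z - p)); last by ring.
rewrite cmodM; move: hz; rewrite ltr_pdivlMr ?ltr_wpDl// mulrDr mulr1 mulrC.
by have := cmod_ge0 (z - p); lra.
Qed.

Lemma cder_affine f (a b c z l : C) : cder f (a + b * z) l ->
  cder (fun z => c * f (a + b * z)) z (c * b * l).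
Proof.
move=> df; have dg : cder (fun z => a + b * z) z b.
  apply: (der_eq (derD (@der_cst R C (fun z => z) a z) (derZ b (@der_i R C (fun z => z) z)))).
  by rewrite add0r mulr1.
apply: (der_eq (derZ c (@der_comp R C (fun z => z) f (fun z => a + b * z) z _ _ df dg))).
by ring.
Qed.

Lemma holo_affine U f (a b c : C) : holo U f ->
  holo (fun z => U (a + b * z)) (fun z => c * f (a + b * z)).
Proof. by move=> hf z /hf[l dl]; eexists; exact: cder_affine dl. Qed.

Lemma derive1n_affine U f (a b c : C) n : open_set U -> holo U f -> forall z, U (a + b * z) ->
  derive1n n (fun z => c * f (a + b * z)) z = c * b ^+ n * derive1n n f (a + b * z).
Proof.
move=> oU hf; elim: n => [|n IH] z Uz; first by rewrite !derive1n0 expr0 mulr1.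
rewrite !derive1nS.
have oV := @open_affine U a b oU.
rewrite (@derive1_eq R (fun z => U (a + b * z)) _ _ oV (holo_derive1n n oV (@holo_affine U f a b c hf)) IH z Uz).
rewrite (cder_derive1 (cder_affine (c * b ^+ n) (holo_der (holo_derive1n n oU hf) Uz))).
by rewrite exprSr; ring.
Qed.

Lemma dmon_affine U f (a b c : C) : open_set U -> holo U f -> forall z, U (a + b * z) ->
  dmon (fun z => c * f (a + b * z)) z = c ^+ mon_deg * b ^+ mon_weight * dmon f (a + b * z).
Proof.
move=> oU hf z Uz; rewrite /dmon /mon_deg /mon_weight -!prodrXr.
rewrite -!big_split/=; apply: eq_bigr => i _.
by rewrite (derive1n_affine c i oU hf Uz) !exprMn exprM.
Qed.

(** The amplitude contributes (t^-W)^N to the monomial and the chain rule (t^N)^W; these cancel. *)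
Lemma admissible_rescale U f (a : C) (t : R) : 0 < t -> open_set U -> admissible U f ->
  admissible (fun z => U (a + rc (t ^+ mon_deg) * z))
    (fun z => rc (t ^- mon_weight) * f (a + rc (t ^+ mon_deg) * z)).
Proof.
move=> t0 oU [hf zf pf]; set b := rc (t ^+ _); set c := rc _.
have c0 : c != 0 by rewrite rc_eq0 invr_neq0// expf_neq0// gt_eqF.
split.
- exact: holo_affine.
- move=> z Uz /eqP; rewrite mulf_eq0 (negbTE c0)/= => /eqP fz i ik.
  by rewrite (derive1n_affine c i oU hf Uz) (zf _ Uz fz i ik) mulr0.
- move=> z Uz; rewrite (dmon_affine c oU hf Uz).
  rewrite (_ : c ^+ _ * _ = 1) ?mul1r; first exact: pf.
  rewrite /c /b -!rcX -rcM exprVn -!exprM mulnC mulVf ?rc1//.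
  by rewrite expf_neq0// gt_eqF.
Qed.

Lemma holo_dmon U f : open_set U -> holo U f -> holo U (dmon f).
Proof.
move=> oU hf; rewrite /dmon; elim: (index_iota _ _) => [|i s IH].
  by move=> z Uz; exists 0; apply: (der_near (@der_cst R C (fun z => z) 1 z)); exists 1 => // x _; rewrite big_nil.
have h := holoM (holoX (q i) (holo_derive1n i oU hf)) IH.
by apply: (holo_eq oU h) => z _; rewrite big_cons.
Qed.

Lemma hluc_eq U (f f' : nat -> C -> C) (g g' : C -> C) : (forall n, f n = f' n) -> g = g' ->
  hluc U f g -> hluc U f' g'.
Proof. by move=> /funext-> ->. Qed.

Lemma hluc_dmon U (f : nat -> C -> C) g : hluc U f g ->
  hluc U (fun n => dmon (f n)) (dmon g).
Proof.
move=> h; rewrite /dmon; elim: (index_iota _ _) => [|i s IH].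
  by apply: (hluc_eq _ _ (@hluc_cst R U 1)) => [n|]; apply/funext => z; rewrite big_nil.
apply: (hluc_eq _ _ (hlucM (hlucX (q i) (hluc_derive1n i h)) IH)) => [n|];
  by apply/funext => z; rewrite big_cons.
Qed.

Definition ev_admissible U (f : nat -> C -> C) := forall p, U p -> exists2 d : R, 0 < d &
  exists N, forall n, (N <= n)%N -> admissible (disc p d) (f n).

(** Unless g vanishes near p, Hurwitz makes p a limit of zeros of f n, where the derivatives of
    order below k are 0; they converge to those of g at p. *)
Lemma limit_flat_zeros U (f : nat -> C -> C) g : open_set U -> hluc U f g -> ev_admissible U f -> flat_zeros U g.
Proof.
move=> oU h af p Up gp i ik.
have [[d d0 hd]|hz] := hurwitz h Up gp.
  have h0 := @derive1n_factor R (disc p d) i.+1 g (fun=> 0) p (@disc_open R p d) (disc_center p d0)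
    (holo_cst (U := disc p d) 0).
  by have [|/(_ i (ltnSn i))] := h0; first by move=> z /hd->; rewrite mulr0.
apply/eqP; rewrite -cmod_eq0 eq_le cmod_ge0 andbT; apply/ler_addgt0Pr => e e0; rewrite add0r.
have e2 : 0 < e / 2 by rewrite divr_gt0.
have [d [d0 _ hh uc]] := hluc_discs (hluc_derive1n i h) Up.
have [d1 d10 c1] := holo_cont hh (disc_center p d0) e2.
have [d2 d20 [N2 h2]] := af p Up.
have [N1 h1] := uc _ e2.
have d3 : 0 < Num.min d (Num.min d1 d2) by rewrite !lt_min d0 d10 d20.
have [N3 h3] := hz _ d3.
pose n := maxn N1 (maxn N2 N3).
have [z] : exists2 z, cmod (z - p) < Num.min d (Num.min d1 d2) & f n z = 0.
  by apply: h3; rewrite /n !leq_max leqnn !orbT.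
rewrite !lt_min => /and3P[zd zd1 zd2] fz.
have [_ zf _] := h2 n (leq_trans (leq_maxl _ _) (leq_maxr _ _)).
have k1 := h1 n (leq_maxl _ _) z zd; rewrite (zf z zd2 fz i ik) sub0r cmodN in k1.
have := cmod_sub_ge (derive1n i g p) (derive1n i g z); rewrite cmodBC.
by have := c1 z zd1; lra.
Qed.

(** Hurwitz for [dmon (f n) - 1], which is zero-free near p for large n. *)
Lemma limit_dmon U (f : nat -> C -> C) g : open_set U -> hluc U f g -> ev_admissible U f -> forall p, U p ->
  dmon g p <> 1 \/ exists2 d : R, 0 < d & forall z, disc p d z -> dmon g z = 1.
Proof.
move=> oU h af p Up; have [gp|] := pselect (dmon g p = 1); last by left.
right; have h' := hlucB (hluc_dmon h) (@hluc_cst R U 1).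
have [|[d d0 hd]|hz] := hurwitz h' Up; first by rewrite gp subrr.
  by exists d => // z /hd /eqP; rewrite subr_eq0 => /eqP.
have [d2 d20 [N2 h2]] := af p Up.
have [N3 h3] := hz _ d20.
have [z zd /eqP] := h3 _ (leq_maxr N2 N3).
rewrite subr_eq0 => /eqP; have [_ _ pf] := h2 _ (leq_maxl N2 N3).
by move/(pf z zd).
Qed.

End DiffMonomial.

(** * Entire functions of exponential type *)

Section ExponentialType.
Variables (R : realType).
Local Notation C := (Cplx R).
Local Notation cder := (der (fun z : C => z)).
Local Notation ccont := (cont (fun z : C => z)).
Implicit Types (f g : C -> C).

Definition exp_type f := entire f /\
  exists A B : R, [/\ 0 <= A, 0 <= B & forall z, cmod (f z) <= expR (A + B * cmod z)].

Lemma exp_type_cst (c : C) : exp_type (fun=> c).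
Proof.
split; first by move=> rho; exact: holo_cst.
exists (cmod c), 0; split=> [||z] //; first exact: cmod_ge0.
by rewrite mul0r addr0; have := expR_ge1Dx (cmod c); lra.
Qed.

Lemma exp_typeM f g : exp_type f -> exp_type g -> exp_type (fun z => f z * g z).
Proof.
move=> [ef [A [B [A0 B0 fb]]]] [eg [A' [B' [A'0 B'0 gb]]]]; split.
  by move=> rho; apply: holoM; [exact: ef|exact: eg].
exists (A + A'), (B + B'); split=> [||z]; [by lra|by lra|].
rewrite cmodM (_ : A + A' + _ = (A + B * cmod z) + (A' + B' * cmod z)); last by ring.
by rewrite expRD ler_pM ?cmod_ge0.
Qed.

Lemma exp_typeX f n : exp_type f -> exp_type (fun z => f z ^+ n).
Proof.
move=> ef; elim: n => [|n IH].
  by have := exp_type_cst 1; rewrite (_ : (fun=> 1) = fun z => f z ^+ 0).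
by have := exp_typeM ef IH; rewrite (_ : (fun z => _ * _) = fun z => f z ^+ n.+1)//;
   apply/funext => z; rewrite exprS.
Qed.

Lemma exp_typeB f g : exp_type f -> exp_type g -> exp_type (fun z => f z - g z).
Proof.
move=> [ef [A [B [A0 B0 fb]]]] [eg [A' [B' [A'0 B'0 gb]]]]; split.
  by move=> rho; apply: holoB; [exact: ef|exact: eg].
exists (A + A' + 1), (B + B'); split=> [||z]; [by lra|by lra|].
apply: (le_trans (cmodB_le _ _)); have z0 := cmod_ge0 z.
have p1 := mulr_ge0 B0 z0; have p2 := mulr_ge0 B'0 z0.
have l1 : cmod (f z) <= expR (A + A' + (B + B') * cmod z).
  by apply: (le_trans (fb z)); rewrite ler_expR mulrDl; lra.
have l2 : cmod (g z) <= expR (A + A' + (B + B') * cmod z).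
  by apply: (le_trans (gb z)); rewrite ler_expR mulrDl; lra.
rewrite (_ : A + A' + 1 + _ = 1 + (A + A' + (B + B') * cmod z)); last by ring.
rewrite [leRHS]expRD; have := expR_ge1Dx (1 : R); have := expR_ge0 (A + A' + (B + B') * cmod z).
by move: l1 l2; move: (expR (_ + _)) => y; nra.
Qed.

Lemma exp_type_derive f : exp_type f -> exp_type (derive1 f).
Proof.
move=> [ef [A [B [A0 B0 fb]]]]; split; first exact: entire_derive.
exists (A + B + 1), B; split=> //; first by lra.
exact: derive_exp_type.
Qed.

Lemma exp_type_derive1n f n : exp_type f -> exp_type (derive1n n f).
Proof.
by move=> ef; elim: n => [|n IH]; rewrite ?derive1n0// derive1nS; exact: exp_type_derive.
Qed.

Lemma exp_type_prod (F : nat -> C -> C) (e : nat -> nat) (s : seq nat) :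
  (forall i, exp_type (F i)) -> exp_type (fun z => \prod_(i <- s) F i z ^+ e i).
Proof.
move=> hF; elim: s => [|i s IH].
  rewrite (_ : (fun z => _) = fun=> 1); first exact: exp_type_cst.
  by apply/funext => z; rewrite big_nil.
rewrite (_ : (fun z => _) = fun z => F i z ^+ e i * \prod_(i <- s) F i z ^+ e i).
  by apply: exp_typeM => //; exact: exp_typeX.
by apply/funext => z; rewrite big_cons.
Qed.

Lemma entire_identity f p (d : R) : entire f -> 0 < d -> (forall z, disc p d z -> f z = 0) ->
  forall z, f z = 0.
Proof.
move=> ef d0 h z; apply: (@identity_disc R p (d + cmod (z - p) + 1) f d) => //.
- by have := cmod_ge0 (z - p); lra.
- exact: entire_holo.
- by rewrite /disc; lra.
Qed.

Lemma entire_mul_eq0 f g : entire f -> entire g -> (forall z, f z * g z = 0) ->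
  (forall z, f z = 0) \/ (forall z, g z = 0).
Proof.
move=> ef eg h; have [|/existsNP[z1 /eqP fz1]] := pselect (forall z, f z = 0); first by left.
right; have [|d d0 hd] := @cont_cmod_gt R C (fun z => z) f z1 0 (der_cont (entire_der z1 ef)).
  by rewrite cmod_gt0.
apply: (entire_identity (p := z1) eg d0) => z /hd; rewrite cmod_gt0 => fz.
by have /eqP := h z; rewrite mulf_eq0 (negbTE fz)/= => /eqP.
Qed.

Lemma entire_expn f n : entire f -> entire (fun z => f z ^+ n).
Proof. by move=> ef rho; apply: holoX; exact: ef. Qed.

Lemma entire_exp_eq0 f n : (forall z, f z ^+ n = 0) -> forall z, f z = 0.
Proof. by move=> h z; apply/eqP; have /eqP := h z; rewrite expf_eq0 => /andP[]. Qed.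

Lemma entire_prod (F : nat -> C -> C) (e : nat -> nat) (s : seq nat) :
  (forall i, entire (F i)) -> entire (fun z => \prod_(i <- s) F i z ^+ e i).
Proof.
move=> hF; elim: s => [|i s IH].
  rewrite (_ : (fun z => _) = fun=> 1); first by move=> rho; exact: holo_cst.
  by apply/funext => z; rewrite big_nil.
rewrite (_ : (fun z => _) = fun z => F i z ^+ e i * \prod_(i <- s) F i z ^+ e i).
  by move=> rho; apply: holoM; [exact: entire_expn|exact: IH].
by apply/funext => z; rewrite big_cons.
Qed.

Lemma entire_prod_eq0 (F : nat -> C -> C) (e : nat -> nat) (s : seq nat) :
  (forall i, entire (F i)) -> (forall z, \prod_(i <- s) F i z ^+ e i = 0) ->
  exists2 i, i \in s & forall z, F i z = 0.
Proof.
move=> hF; elim: s => [|i s IH] h.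
  by have := h 0; rewrite big_nil => /eqP; rewrite oner_eq0.
have [|h1|h2] := entire_mul_eq0 (entire_expn (e i) (hF i)) (entire_prod e s hF).
- by move=> z; have := h z; rewrite big_cons.
- by exists i; rewrite ?inE ?eqxx//; exact: entire_exp_eq0 h1.
- by have [j js hj] := IH h2; exists j; rewrite ?inE ?js ?orbT.
Qed.

Lemma cder_cexp_lin (a b z : C) : cder (fun z => cexp (a * z + b)) z (a * cexp (a * z + b)).
Proof.
rewrite -[in X in cder X](mul1r b).
have := @cder_affine R (@cexp R) b a 1 z _ (cder_cexp _).
rewrite (_ : (fun z => 1 * cexp (b + a * z)) = fun z => cexp (a * z + 1 * b)).
  by move=> h; apply: (der_eq h); rewrite mul1r (addrC b).
by apply/funext => w; rewrite !mul1r addrC.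
Qed.

Lemma cexp_reaches (a b w : C) : a != 0 -> w != 0 -> exists z, cexp (a * z + b) = w.
Proof.
move=> a0 /cexp_surj[y ey _]; exists ((y - b) / a).
by rewrite mulrCA divff// mulr1 subrK.
Qed.

End ExponentialType.

(** * Entire functions whose monomial omits 1 *)

Section EntireAdmissible.
Variables (R : realType) (k : nat) (q : nat -> nat).
Hypotheses (hk : (1 <= k)%N) (hq0 : (3 <= q 0%N)%N).
Local Notation C := (Cplx R).
Local Notation cder := (der (fun z : C => z)).
Local Notation dmon := (@dmon R k q).
Implicit Types (f g : C -> C).

(** Splitting off f^2 is what makes a zero of f a multiple zero of the monomial. *)
Lemma dmon_head U f : open_set U -> holo U f -> exists2 h : C -> C, holo U h &
  forall z, dmon f z = f z ^+ 2 * h z.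
Proof.
move=> oU hf; exists (fun z => f z ^+ (q 0 - 2) * \prod_(0 <= i < k) derive1n i.+1 f z ^+ q i.+1).
  apply: holoM; first exact: holoX.
  elim: (index_iota _ _) => [|i s IH].
    by apply: (holo_eq oU (holo_cst (U := U) 1)) => z _; rewrite big_nil.
  apply: (holo_eq oU (holoM (holoX (q i.+1) (holo_derive1n i.+1 oU hf)) IH)) => z _.
  by rewrite big_cons.
move=> z; rewrite [dmon f z]big_nat_recl// derive1n0 mulrA -exprD subnKC//.
exact: ltnW.
Qed.

Lemma dmon_zero U f z : open_set U -> holo U f -> U z -> f z = 0 ->
  dmon f z = 0 /\ derive1 (dmon f) z = 0.
Proof.
move=> oU hf Uz fz; have [h hh eh] := dmon_head oU hf.
split; first by rewrite eh fz expr0n mul0r.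
have -> : dmon f = fun z => f z ^+ 2 * h z by apply/funext.
rewrite (cder_derive1 (derM (derX 2 (holo_der hf Uz)) (holo_der hh Uz))).
by rewrite fz /= expr1 mulr0 !mul0r expr0n mul0r addr0.
Qed.

Lemma derive1n_cexp_lin (c d z : C) n :
  derive1n n (fun z => cexp (c * z + d)) z = c ^+ n * cexp (c * z + d).
Proof.
elim: n z => [|n IH] z; first by rewrite derive1n0 mul1r.
rewrite derive1nS (_ : derive1n n _ = fun z => c ^+ n * cexp (c * z + d)); last by apply/funext.
by rewrite (cder_derive1 (derZ (c ^+ n) (cder_cexp_lin c d z))) mulrA exprSr.
Qed.

Lemma dmon_cexp_lin (c d z : C) : dmon (fun z => cexp (c * z + d)) z =
  c ^+ mon_weight k q * cexp ((mon_deg k q)%:R * c * z + (mon_deg k q)%:R * d).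
Proof.
rewrite -mulrA -mulrDr cexp_nat /mon_weight /mon_deg -!prodrXr -big_split/=.
by apply: eq_bigr => i _; rewrite derive1n_cexp_lin exprMn exprM.
Qed.

Lemma mon_deg_gt0 : (0 < mon_deg k q)%N.
Proof. by apply: leq_trans (deg_ge (i := 0) q (leq0n k)); exact: ltnW (ltnW hq0). Qed.

(** Descent in j: if the derivative of order j + 1 is 0, that of order j is constant, and it
    vanishes at z0 because j < k. *)
Lemma entire_top_derivative_eq0 f z0 j : entire f -> flat_zeros k (fun=> True) f -> f z0 = 0 ->
  (j <= k)%N -> (forall z, derive1n j f z = 0) -> forall z, f z = 0.
Proof.
move=> ef zf fz0; elim: j => [|j IH] jk hj; first by move=> z; have := hj z; rewrite derive1n0.
apply: IH; first exact: ltnW.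
move=> z; rewrite -(zf z0 I fz0 j jk); apply: (cder0_cst (@convex_all R)) => // w _.
apply: (der_eq (entire_der w (entire_derive1n j ef))).
by rewrite -derive1nS hj.
Qed.

(* A zero-free exponential type function is exp(cz + d), on which dmon takes
   every nonzero value unless c = 0. If f has a zero, then dmon f = 1 + exp(az + b)
   has a double zero there, so a = 0 and dmon f = 0. *)
Theorem entire_admissible_cst f (L : R) : entire f -> flat_zeros k (fun=> True) f ->
  (forall z, dmon f z <> 1) \/ (forall z, dmon f z = 1) ->
  (forall z, cmod (f z) <= 1 -> cmod (derive1 f z) <= L) -> derive1 f 0 = 0.
Proof.
move=> ef zf dich lev.
have cst (g : C -> C) : entire g -> (forall z w, g z = g w) -> derive1 g 0 = 0.
  move=> eg h; apply: (@cder_derive1 _ g).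
  by apply: (der_near (@der_cst R C (fun z => z) (g 0) 0)); exists 1 => // x _; exact: h.
(* If |f| > 1 everywhere, the growth estimate has no starting point, but then 1 / f is bounded. *)
have [|/existsNP[s0 /negP]] := pselect (forall z, 1 < cmod (f z)).
  move=> h1; have f0 z : f z != 0 by rewrite -cmod_gt0; apply: lt_trans (h1 z).
  have ev : entire (fun z => (f z)^-1) by move=> rho; apply: holoV => //; exact: ef.
  have h : forall z w, (f z)^-1 = (f w)^-1.
    apply: (@liouville R _ 1) => // z; rewrite cmodV invf_le1 ?cmod_gt0//.
    exact: ltW.
  by apply: cst => // z w; apply: invr_inj; exact: h.
rewrite -leNgt => fs0.
have L0 : 0 <= L by apply: le_trans (lev _ fs0); exact: cmod_ge0.
have ft : exp_type f.
  split=> //; exists (2 * L * cmod s0), (2 * L); split=> [||z].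
  - by rewrite !mulr_ge0 ?cmod_ge0.
  - by rewrite mulr_ge0.
  apply: (le_trans (growth_from_level_curve z ef L0 _ fs0)).
    by move=> w fw; apply: lev; rewrite fw.
  by rewrite ler_expR -mulrDr ler_wpM2l ?mulr_ge0// (addrC (cmod s0)) cmodB_le.
have Pt : exp_type (dmon f).
  by apply: exp_type_prod => i; exact: exp_type_derive1n.
have [zfree|/existsNP[z0 /negP/negPn/eqP fz0]] := pselect (forall z, f z != 0).
  have [_ [A [B [A0 B0 fb]]]] := ft.
  have [c [d ecd]] := zero_free_exp_type ef zfree A0 B0 fb.
  have Ef : f = fun z => cexp (c * z + d) by apply/funext.
  have [c0|c0] := eqVneq c 0.
    by apply: cst => // z w; rewrite !ecd c0 !mul0r.
  have reach (w : C) : w != 0 -> exists z, dmon f z = w.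
    move=> w0; have cw : c ^+ mon_weight k q != 0 by rewrite expf_neq0.
    have Nc : (mon_deg k q)%:R * c != 0.
      by rewrite mulf_neq0// -cmod_gt0 cmod_nat ltr0n mon_deg_gt0.
    have [|z ez] := cexp_reaches ((mon_deg k q)%:R * d) Nc (w := w / c ^+ mon_weight k q).
      by rewrite mulf_neq0 ?invr_neq0.
    by exists z; rewrite Ef dmon_cexp_lin ez mulrCA divff ?mulr1.
  have [z1 h1] := reach 1 (oner_neq0 _).
  (* The value 2 rules out the alternative that the monomial is identically 1. *)
  have [z2 h2] : exists z, dmon f z = 2%:R by apply: reach; rewrite -cmod_gt0 cmod_nat.
  case: dich => [/(_ z1)//|h]; have := h z2; rewrite h2 => /(congr1 (@cmod R)).
  by rewrite cmod_nat cmod1 => e2; exfalso; lra.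
have [Pz0 dPz0] := dmon_zero (@open_all R) (entire_holo ef) I fz0.
have {dich} P1 z : dmon f z != 1.
  case: dich => [/(_ z)/eqP//|/(_ z0)].
  by rewrite Pz0 => /esym/eqP; rewrite oner_eq0.
have [eQ [A [B [A0 B0 Qb]]]] := exp_typeB Pt (exp_type_cst 1).
have [|a [b eab]] := zero_free_exp_type eQ _ A0 B0 Qb.
  by move=> z; rewrite subr_eq0.
have EP z : dmon f z = 1 + cexp (a * z + b) by rewrite -eab addrC subrK.
have a0 : a = 0.
  have := dPz0; rewrite (_ : dmon f = fun z => 1 + cexp (a * z + b)); last by apply/funext.
  have dE := derD (@der_cst R C (fun z => z) 1 z0) (cder_cexp_lin a b z0).
  rewrite (cder_derive1 dE) add0r => /eqP.
  by rewrite mulf_eq0 (negbTE (cexp_neq0 _)) orbF => /eqP.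
have P0 z : dmon f z = 0 by rewrite -Pz0 !EP a0 !mul0r.
have [j] := entire_prod_eq0 (fun i => entire_derive1n i ef) P0.
rewrite mem_index_iota => /andP[_ jk] hj.
by apply: cst => // z w; rewrite !(entire_top_derivative_eq0 ef zf fz0 _ hj).
Qed.

End EntireAdmissible.

(** * The gradient bound *)

Section Rescaling.
Variables (R : realType) (k : nat) (q : nat -> nat).
Hypotheses (hk : (1 <= k)%N) (hq0 : (3 <= q 0%N)%N).
Local Notation C := (Cplx R).
Local Notation cder := (der (fun z : C => z)).
Local Notation admissible := (@admissible R k q).
Local Notation N := (mon_deg k q).
Local Notation W := (mon_weight k q).
Implicit Types (f g : C -> C).

(* The spherical derivative |g'| / (1 + |g|^2) at 0 of g zeta = t^(-W) f (z + t^N zeta)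
   is at least 1. *)
Definition steep f (z : C) (t : R) :=
  t ^+ (W * 2) + cmod (f z) ^+ 2 <= t ^+ (N + W) * cmod (derive1 f z).

Lemma mon_weight_lt : (W < k * N)%N. Proof. by apply: weight_lt => //; exact: ltnW (ltnW hq0). Qed.

Lemma pow_le1_anti (t : R) i j : 0 < t <= 1 -> (i <= j)%N -> t ^+ j <= t ^+ i.
Proof.
move=> /andP[t0 t1] ij; rewrite -(subnK ij) exprD ler_piMl ?exprn_ge0 ?(ltW t0)//.
by rewrite exprn_ile1// ltW.
Qed.

(** Non-steepness near a zero of order m + 1, with x the distance to the zero, n = N and w = W. If
    x^(m+1) <= t^w the first term on the right wins, otherwise the second. Both comparisons are made
    after raising to the power m + 1, where w < n (m + 1) leaves a spare factor t. *)
Lemma small_scale_ineq (n w m : nat) (c B x t : R) : (w < n * m.+1)%N -> 0 < t <= 1 -> 0 <= x ->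
  0 <= c -> 0 <= B -> B ^+ m.+1 * t < 1 -> B ^+ m.+1 * t <= (c ^+ 2) ^+ m.+1 ->
  t ^+ (n + w) * (B * x ^+ m) < t ^+ (w * 2) + c ^+ 2 * (x ^+ m.+1) ^+ 2.
Proof.
move=> wn t01 x0 c0 B0 h1 h2; have /andP[t0 t1] := t01.
have tw : 0 < t ^+ w by rewrite exprn_gt0.
have tn : 0 < t ^+ n by rewrite exprn_gt0.
have key : B ^+ m.+1 * (t ^+ n) ^+ m.+1 <= B ^+ m.+1 * t * t ^+ w.
  rewrite -exprM -mulrA -exprS ler_wpM2l ?exprn_ge0//.
  exact: pow_le1_anti.
rewrite exprD exprM.
have xm := exprn_ge0 m x0.
have [a|b] := leP (x ^+ m.+1) (t ^+ w).
  apply: (@lt_le_trans _ _ ((t ^+ w) ^+ 2)); last first.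
    by rewrite lerDl mulr_ge0 ?sqr_ge0.
  rewrite (_ : t ^+ n * t ^+ w * _ = (B * t ^+ n * x ^+ m) * t ^+ w); last by ring.
  rewrite expr2 ltr_pM2r// -(@ltr_pXn2r _ m.+1)// ?nnegrE; last 2 first.
  - by rewrite !mulr_ge0// ltW.
  - exact: ltW.
  rewrite !exprMn -(exprM x) mulnC (exprM x).
  have s1 : B ^+ m.+1 * (t ^+ n) ^+ m.+1 * (x ^+ m.+1) ^+ m <=
      B ^+ m.+1 * t * t ^+ w * (t ^+ w) ^+ m.
    apply: ler_pM => //.
    - by rewrite mulr_ge0// exprn_ge0// ltW.
    - by rewrite !exprn_ge0.
    - by rewrite lerXn2r ?nnegrE ?exprn_ge0// ltW.
  apply: (le_lt_trans s1); rewrite -mulrA -exprS.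
  by rewrite -[X in _ < X]mul1r ltr_pM2r// exprn_gt0.
have x1 : 0 <= x ^+ m.+1 by rewrite exprn_ge0.
have s : B * t ^+ n <= c ^+ 2 * x.
  rewrite -(@ler_pXn2r _ m.+1)// ?nnegrE; last 2 first.
  - by rewrite mulr_ge0// ltW.
  - by rewrite mulr_ge0// sqr_ge0.
  rewrite (exprMn _ (c ^+ 2)) (exprMn _ B); apply: (le_trans key); apply: ler_pM => //; last exact: ltW.
  - by rewrite mulr_ge0 ?exprn_ge0// ltW.
  - exact: ltW.
apply: (@le_lt_trans _ _ (c ^+ 2 * (x ^+ m.+1) ^+ 2)); last first.
  by rewrite ltrDr exprn_gt0.
rewrite (_ : t ^+ n * t ^+ w * _ = (B * t ^+ n) * (x ^+ m * t ^+ w)); last by ring.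
apply: (@le_trans _ _ (c ^+ 2 * x * (x ^+ m * t ^+ w))).
  by rewrite ler_wpM2r// mulr_ge0// ltW.
rewrite (_ : c ^+ 2 * x * _ = c ^+ 2 * (x ^+ m.+1 * t ^+ w)); last by rewrite (exprS x m); ring.
by rewrite ler_wpM2l ?sqr_ge0// expr2 ler_wpM2l// ltW.
Qed.

(** Write f = (z - p)^m g with g p nonzero. For m = 0 a small t is enough; for m > 0 flatness of
    zeros forces m >= k, and W < k N makes [small_scale_ineq] applicable. *)
Lemma not_steep_near f p (rho : R) : 0 < rho -> admissible (disc p rho) f ->
  exists d t0 : R, [/\ 0 < d, 0 < t0 & forall z t, disc p d z -> 0 < t -> t < t0 -> ~ steep f z t].
Proof.
move=> rho0 [hf zf _].
have [f0|[m [g [hg gp eg]]]] := zero_factor rho0 hf.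
  exists rho, 1; split=> // z t hz t0 _; rewrite /steep f0//.
  have -> : derive1 f z = 0.
    rewrite (@derive1_eq R (disc p rho) f (fun=> 0) (@disc_open R p rho) hf f0 z hz).
    exact: cder_derive1 (@der_cst R C (fun z => z) 0 z).
  by rewrite cmod0 mulr0 expr0n addr0 leNgt exprn_gt0.
have [f1 f2] := derive1n_factor (@disc_open R p rho) (disc_center p rho0) hg eg.
pose c := cmod (g p) / 2; have c1 : 0 < cmod (g p) by rewrite cmod_gt0.
have c0 : 0 < c by rewrite divr_gt0.
have cg : c < cmod (g p) by rewrite /c; lra.
have [B [B1 B2 B0]] : exists B, [/\ cmod (g p) < B, cmod (derive1 g p) < B & 0 < B].
  by exists (cmod (g p) + cmod (derive1 g p) + 1); have := cmod_ge0 (derive1 g p); split; lra.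
have hp := disc_center p rho0.
have [d1 d10 hd1] := cont_cmod_gt (holo_cont hg hp) cg.
have [d2 d20 hd2] := cont_cmod_lt (holo_cont hg hp) B1.
have [d3 d30 hd3] := cont_cmod_lt (holo_cont (holo_derive (@disc_open R p rho) hg) hp) B2.
pose d := Num.min (Num.min 1 rho) (Num.min d1 (Num.min d2 d3)).
have d0 : 0 < d by rewrite !lt_min ltr01 rho0 d10 d20 d30.
have dz z : disc p d z -> [/\ cmod (z - p) < 1, disc p rho z, c < cmod (g z), cmod (g z) < B &
    cmod (derive1 g z) < B].
  rewrite /disc !lt_min => /andP[/andP[e1 e2] /and3P[e3 e4 e5]].
  by split; [| |exact: hd1|exact: hd2|exact: hd3].
have dfz z : disc p rho z ->
    derive1 f z = m%:R * (z - p) ^+ m.-1 * g z + (z - p) ^+ m * derive1 g z.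
  move=> hz; rewrite (@derive1_eq R (disc p rho) f _ (@disc_open R p rho) hf eg z hz).
  have dzp : cder (fun z => z - p) z 1.
    by apply: (der_eq (derB (@der_i R C (fun z => z) z) (@der_cst R C (fun z => z) p z))); rewrite subr0.
  rewrite (cder_derive1 (derM (derX m dzp) (holo_der hg hz))).
  by rewrite mulr1.
case: m => [|m] in eg f1 f2 dfz *.
  pose t0 := Num.min 1 (c ^+ 2 / B).
  have t00 : 0 < t0 by rewrite lt_min ltr01 divr_gt0// exprn_gt0.
  exists d, t0; split=> // z t /dz[z1 zr z2 z3 z4] t1; rewrite lt_min => /andP[t2 t3] st.
  have := st; rewrite /steep eg// expr0 mul1r dfz// expr0 mul0r mul0r add0r mul1r.
  apply/negP; rewrite -ltNge.
  have h1 : t ^+ (N + W) <= t.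
    rewrite -[leRHS]expr1; apply: pow_le1_anti; first by rewrite t1 ltW.
    by apply: leq_trans (mon_deg_gt0 k hq0) (leq_addr _ _).
  have h2 : t * B < c ^+ 2 by rewrite -ltr_pdivlMr.
  have h3 : c ^+ 2 <= cmod (g z) ^+ 2 by rewrite ler_sqr ?nnegrE ?cmod_ge0// ltW.
  have h4 : 0 < t ^+ (W * 2) by rewrite exprn_gt0.
  have h5 : t ^+ (N + W) * cmod (derive1 g z) <= t * B.
    by apply: ler_pM (cmod_ge0 _) h1 (ltW z4); rewrite exprn_ge0// (ltW t1).
  by apply: (le_lt_trans h5); apply: (lt_le_trans h2); apply: (le_trans h3); rewrite lerDr ltW.
have km : (k <= m.+1)%N.
  rewrite leqNgt; apply/negP => mk; have := f2; rewrite zf//; last first.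
    by rewrite eg// subrr expr0n mul0r.
  move=> /esym/eqP; rewrite mulf_eq0 (negbTE gp) orbF -cmod_eq0 cmod_nat.
  by rewrite pnatr_eq0; have := fact_gt0 m.+1; rewrite lt0n => /negbTE->.
have WN : (W < N * m.+1)%N by apply: (leq_trans mon_weight_lt); rewrite mulnC leq_mul2l km orbT.
(* Here |f'| <= (m + 1) |z - p|^m B + |z - p|^(m+1) B with |z - p| < 1, hence the factor m + 2. *)
pose B' := m.+2%:R * B; have B'0 : 0 < B' by rewrite mulr_gt0.
have B'm : 0 < B' ^+ m.+1 by rewrite exprn_gt0.
have cm : 0 < (c ^+ 2) ^+ m.+1 by rewrite !exprn_gt0.
pose t0 := Num.min 1 (Num.min (1 / B' ^+ m.+1) ((c ^+ 2) ^+ m.+1 / B' ^+ m.+1)).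
have t00 : 0 < t0 by rewrite !lt_min ltr01 !divr_gt0.
exists d, t0; split=> // z t /dz[z1 zr z2 z3 z4] t1; rewrite !lt_min !ltr_pdivlMr//.
move=> /and3P[t2 t3 t4]; rewrite /steep; apply/negP; rewrite -ltNge.
have x0 := cmod_ge0 (z - p).
apply: (@le_lt_trans _ _ (t ^+ (N + W) * (B' * cmod (z - p) ^+ m))).
  rewrite ler_wpM2l ?exprn_ge0 ?(ltW t1)// dfz//.
  apply: (le_trans (cmodD _ _)); rewrite !cmodM !cmodX cmod_nat /= /B'.
  have xm : 0 <= cmod (z - p) ^+ m by rewrite exprn_ge0.
  have s1 : m.+1%:R * cmod (z - p) ^+ m * cmod (g z) <= m.+1%:R * cmod (z - p) ^+ m * B.
    by rewrite ler_wpM2l ?mulr_ge0// ltW.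
  have s2 : cmod (z - p) ^+ m.+1 * cmod (derive1 g z) <= cmod (z - p) ^+ m * B.
    rewrite exprSr; apply: ler_pM (cmod_ge0 _) _ (ltW z4); first exact: mulr_ge0.
    by rewrite ler_piMr// (ltW z1).
  apply: (le_trans (lerD s1 s2)); rewrite -(natr1 m.+1) le_eqVlt; apply/orP; left; apply/eqP.
  by move: (m.+1%:R) (cmod _ ^+ _) => x y; ring.
rewrite eg// cmodM cmodX exprMn mulrC.
apply: (@lt_le_trans _ _ (t ^+ (W * 2) + c ^+ 2 * (cmod (z - p) ^+ m.+1) ^+ 2)).
  rewrite mulrC; apply: small_scale_ineq => //; rewrite ?t1 ?ltW//.
  - by rewrite mulrC.
  - by rewrite mulrC.
rewrite lerD2l mulrC ler_wpM2l ?sqr_ge0//.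
by rewrite ler_sqr ?nnegrE ?cmod_ge0// ltW.
Qed.

(** Compactness of the closed disc of radius 1/2. The lower bound on t keeps the supremum in
    [rescale_steep] finite. *)
Lemma not_steep_small f : admissible (disc 0 1) f -> exists2 t0 : R, 0 < t0 &
  forall z t, cmod z < 1 / 2 -> 0 < t -> t < t0 -> ~ steep f z t.
Proof.
move=> af; apply: contrapT => hn.
have /choice[u hu] : forall n : nat, exists zt : C * R,
    [/\ cmod zt.1 < 1 / 2, 0 < zt.2, zt.2 < n.+1%:R^-1 & steep f zt.1 zt.2].
  move=> n; apply: contrapT => h; apply: hn; exists n.+1%:R^-1; first by rewrite invr_gt0.
  by move=> z t h1 h2 h3 h4; apply: h; exists (z, t).
have [|s si [l hl]] := @bw R (fun n => (u n).1) (1 / 2).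
  by move=> n; have [/ltW] := hu n.
have l1 : cmod l <= 1 / 2.
  by apply: (cvc_le hl); exists 0%N => n _; have [/ltW] := hu (s n).
have rho0 : 0 < 1 / 2 :> R by [].
have [|d [t0 [d0 t00 hd]]] := @not_steep_near f l (1 / 2) rho0.
  by apply: admissible_sub af => z; rewrite /disc subr0; have := cmod_sub_ge z l; lra.
have [N1 h1] := hl _ d0; have [N2 h2] := inv_lt t00.
pose n := maxn N1 N2; have [k1 k2 k3 k4] := hu (s n).
apply: hd k4 => //; first exact: h1 (leq_maxl _ _).
apply: (lt_trans k3); apply: h2.
exact: leq_trans (leq_maxr N1 N2) (inc_ge si n).
Qed.

(* Zalcman-Pang rescaling at a point where (1/2 - |z|) / t^N is nearly maximal
   among the steep pairs (z, t). *)
Lemma rescale_steep f (n : nat) : admissible (disc 0 1) f -> cmod (f 0) <= 1 ->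
  2 * n.+1%:R ^+ (N + W) <= cmod (derive1 f 0) ->
  exists g, [/\ admissible (disc 0 (n.+1%:R / 8)) g,
    forall z, disc 0 (n.+1%:R / 8) z ->
      cmod (derive1 g z) <= 4 ^+ (N + W) * (1 + cmod (g z) ^+ 2) &
    1 + cmod (g 0) ^+ 2 <= cmod (derive1 g 0)].
Proof.
move=> af f0 df0; have [t0 t00 ht0] := not_steep_small af.
pose S := [set v : R | exists z : C, exists t : R, [/\ cmod z < 1 / 2, 0 < t <= 1, steep f z t &
  v = (1 / 2 - cmod z) / t ^+ N]].
(* The value at the pair (0, 1 / (n + 1)), which is steep by the assumption on the derivative at
   0. *)
pose v0 : R := 1 / 2 * n.+1%:R ^+ N.
have n0 : 0 < n.+1%:R :> R by [].
have n1 : 1 <= n.+1%:R :> R by rewrite ler1n.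
have ni0 : 0 < n.+1%:R^-1 :> R by rewrite invr_gt0.
have ni1 : n.+1%:R^-1 <= 1 :> R by rewrite invf_le1.
have Sv0 : S v0.
  exists 0, n.+1%:R^-1; split; rewrite ?cmod0 ?ni0//.
    rewrite /steep; apply: (@le_trans _ _ 2).
      have -> : 2 = 1 + 1 :> R by [].
      by apply: lerD; apply: exprn_ile1; rewrite ?cmod_ge0// ltW.
    by rewrite exprVn mulrC ler_pdivlMr// exprn_gt0.
  by rewrite subr0 exprVn invrK.
have Sb v : S v -> v <= 1 / 2 / t0 ^+ N.
  move=> [z [t [z2 /andP[t1 t2] st ->]]].
  have tt : t0 <= t by rewrite leNgt; apply/negP => h; exact: ht0 st.
  apply: ler_pM; rewrite ?invr_ge0 ?exprn_ge0 ?(ltW t1)//; first by lra.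
    by have := cmod_ge0 z; lra.
  by rewrite lef_pV2 ?posrE ?exprn_gt0// lerXn2r// ?nnegrE ltW.
have hS : has_sup S by split; [exists v0|exists (1 / 2 / t0 ^+ N)].
have supv0 : v0 <= sup S by apply: sup_upper_bound.
have v00 : 0 < v0 by rewrite mulr_gt0// exprn_gt0.
have s0 : 0 < sup S by apply: lt_le_trans supv0.
have e0 : 0 < sup S / 2 by rewrite divr_gt0.
have [v [z [t [z2 t01 st ev]]] hv] := sup_adherent e0 hS.
have {}hv : sup S < 2 * v by lra.
have /andP[t1 t2] := t01.
have tN : 0 < t ^+ N by rewrite exprn_gt0.
have tW : 0 < t ^+ W by rewrite exprn_gt0.
(* Chosen so that 2 A < v: indeed v > sup S / 2 >= v0 / 2 >= (n + 1) / 4. *)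
pose A : R := n.+1%:R / 8.
have A0 : 0 < A by rewrite divr_gt0.
have nN : n.+1%:R <= n.+1%:R ^+ N :> R.
  by rewrite -[leLHS]expr1 ler_weXn2l// (mon_deg_gt0 k hq0).
have Av : 2 * A < v by rewrite /A; rewrite /v0 in supv0; lra.
have ev' : 1 / 2 - cmod z = v * t ^+ N by rewrite ev divfK// gt_eqF.
pose b := rc (t ^+ N); pose c := rc (t ^- W).
have cmb : cmod b = t ^+ N by rewrite cmod_rc gtr0_norm.
have cmc : cmod c = (t ^+ W)^-1 by rewrite cmod_rc gtr0_norm// invr_gt0.
pose g (w : C) := c * f (z + b * w).
have zw w : disc 0 A w -> (v - A) * t ^+ N <= 1 / 2 - cmod (z + b * w).
  rewrite /disc subr0 => wA; have := cmodD z (b * w); rewrite cmodM cmb.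
  have : t ^+ N * cmod w <= t ^+ N * A by rewrite ler_wpM2l ?(ltW tN)// (ltW wA).
  by rewrite mulrBl -ev'; lra.
have zw1 w : disc 0 A w -> cmod (z + b * w) < 1 / 2.
  move=> /zw; have : 0 < (v - A) * t ^+ N by rewrite mulr_gt0//; lra.
  by lra.
have zw2 w : disc 0 A w -> disc 0 1 (z + b * w) by move=> /zw1; rewrite /disc subr0; lra.
have [hf _ _] := af.
have dg w : disc 0 A w -> derive1 g w = c * b * derive1 f (z + b * w).
  by move=> /zw2 h; rewrite (cder_derive1 (cder_affine c (holo_der hf h))).
exists g; split.
- by apply: admissible_sub (admissible_rescale z t1 (@disc_open R 0 1) af) => w /zw2.
- move=> w hw; rewrite dg// !cmodM cmc cmb.
  (* If the pair (z + b w, t / 4) were steep, its value in S would be at least 4 (v - A); then 4 (v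
     - A) <= sup S < 2 v, against 2 A < v. *)
  have [st'|] := pselect (steep f (z + b * w) (t / 4)).
    exfalso; have t4 : 0 < t / 4 by rewrite divr_gt0.
    have : (1 / 2 - cmod (z + b * w)) / (t / 4) ^+ N <= sup S.
      apply: sup_upper_bound => //; exists (z + b * w), (t / 4); split=> //; first exact: zw1.
      by rewrite t4; lra.
    rewrite ler_pdivrMr ?exprn_gt0// expr_div_n => h1.
    have h2 : (v - A) * t ^+ N <= 2 * v * (t ^+ N / 4).
      apply: (le_trans (zw w hw)); apply: (le_trans h1).
      apply: ler_pM; rewrite ?divr_ge0 ?exprn_ge0 ?(ltW s0) ?(ltW t1) ?(ltW hv)//.
      rewrite ler_wpM2l ?(ltW tN)// lef_pV2 ?posrE ?exprn_gt0//.
      by rewrite -[leLHS]expr1 ler_weXn2l// ?(mon_deg_gt0 k hq0)//; lra.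
    have : (v - A) * t ^+ N <= v / 2 * t ^+ N by rewrite (_ : v / 2 * _ = 2 * v * (t ^+ N / 4)) //; field.
    by rewrite ler_pM2r//; lra.
  have tt : t / 4 <= t by lra.
  have h4 : (t / 4) ^+ (W * 2) <= (t ^+ W) ^+ 2.
    by rewrite -exprM; apply: lerXn2r; rewrite // nnegrE ?divr_ge0// (ltW t1).
  rewrite /steep => /negP; rewrite -ltNge (expr_div_n t) => h.
  move: h h4; rewrite (exprD t).
  move: (cmod (derive1 f _)) (cmod (f _)) (4 ^+ (N + W)) (exprn_gt0 (N + W) (ltr0n R 4)) => x y M M0 h h4.
  have {h h4} h : t ^+ N * t ^+ W * x < M * ((t ^+ W) ^+ 2 + y ^+ 2).
    rewrite mulrC in h; rewrite (mulrC M) -ltr_pdivrMr// (mulrC _ x) -mulrA.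
    exact: lt_le_trans h (lerD h4 (lexx _)).
  rewrite (_ : (t ^+ W)^-1 * t ^+ N * x = (t ^+ N * t ^+ W * x) / (t ^+ W) ^+ 2); last first.
    by field; rewrite gt_eqF.
  rewrite ler_pdivrMr ?exprn_gt0//; apply/ltW/(lt_le_trans h).
  rewrite le_eqVlt; apply/orP; left; apply/eqP; field; rewrite gt_eqF//.
- have h0 : disc 0 A (0 : C) by rewrite /disc subrr cmod0.
  rewrite dg// /g mulr0 addr0 !cmodM cmc cmb; move: st; rewrite /steep exprD exprM.
  move: (cmod (derive1 f _)) (cmod (f _)) => x y h.
  rewrite (_ : (t ^+ W)^-1 * t ^+ N * x = (t ^+ N * t ^+ W * x) / (t ^+ W) ^+ 2); last first.
    by field; rewrite gt_eqF.
  rewrite ler_pdivlMr ?exprn_gt0//; apply: (le_trans _ h).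
  rewrite le_eqVlt; apply/orP; left; apply/eqP; field; rewrite gt_eqF//.
Qed.

End Rescaling.

(** * Limits of rescaled functions and normality at finite points *)

Section GradientBound.
Variables (R : realType) (k : nat) (q : nat -> nat).
Hypotheses (hk : (1 <= k)%N) (hq0 : (3 <= q 0%N)%N).
Local Notation C := (Cplx R).
Local Notation cder := (der (fun z : C => z)).
Local Notation admissible := (@admissible R k q).
Local Notation ev_admissible := (@ev_admissible R k q).
Local Notation dmon := (@dmon R k q).
Local Notation N := (mon_deg k q).
Local Notation W := (mon_weight k q).
Implicit Types (f g : C -> C).

Lemma limit_dmon_entire (f : nat -> C -> C) g : hluc (fun=> True) f g ->
  ev_admissible (fun=> True) f -> (forall z, dmon g z <> 1) \/ (forall z, dmon g z = 1).
Proof.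
move=> h af; have [|/existsNP[p /contrapT gp]] := pselect (forall z, dmon g z <> 1); first by left.
right; have [//|[d d0 hd]] := limit_dmon (@open_all R) h af (p := p) I.
move=> z; apply/eqP; rewrite -subr_eq0; apply/eqP; move: z.
have eg : entire (fun z => dmon g z - 1).
  move=> rho; apply: holoB; last exact: holo_cst.
  apply: holo_dmon; first exact: disc_open.
  by apply: holo_sub (hluc_holo h).
by apply: (entire_identity eg d0 (p := p)) => z /hd->; rewrite subrr.
Qed.

(** Cauchy's estimate for 1 / f n, which tends to 0 uniformly near p and has derivative -f' / f^2.
    It rules out an infinite limit of the rescaled functions. *)
Lemma linf_derive U (f : nat -> C -> C) p : linf U f -> U p ->
  (exists2 d : R, 0 < d & eholo (disc p d) f) -> forall e : R, 0 < e ->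
  exists n0, forall n, (n0 <= n)%N -> cmod (derive1 (f n) p) <= e * cmod (f n p) ^+ 2.
Proof.
move=> lf Up [d1 d10 [n1 h1]] e e0; have [d2 d20 h2] := lf p Up.
pose d := Num.min d1 d2; have d0 : 0 < d by rewrite lt_min d10 d20.
pose M := 2 / (e * d); have M0 : 0 < M by rewrite divr_gt0// mulr_gt0.
have [n2 {}h2] := h2 M; exists (maxn n1 n2) => n; rewrite geq_max => /andP[nn1 nn2].
have dd z : disc p d z -> disc p d1 z /\ disc p d2 z by rewrite /disc lt_min => /andP.
have f0 z : disc p d z -> f n z != 0.
  by move=> /dd[_ zd]; rewrite -cmod_gt0; apply: lt_le_trans (h2 n nn2 z zd).
have hf : holo (disc p d) (f n) by apply: holo_sub (h1 n nn1) => z /dd[].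
have [|h _] := taylor2 d0 (holoV hf f0) (M := M^-1).
  move=> z zd; rewrite cmodV lef_pV2 ?posrE ?cmod_gt0 ?f0//.
  by apply: h2 => //; have [] := dd z zd.
have pd := disc_center p d0.
have fp := f0 p pd; have fp0 : 0 < cmod (f n p) by rewrite cmod_gt0.
move: h; rewrite (cder_derive1 (derV (holo_der hf pd) fp)) cmodM cmodN cmodV cmodX.
rewrite ler_pdivrMr ?exprn_gt0// => h; apply: (le_trans h).
rewrite /M invf_div (_ : 2 * _ / d = e)//; field.
by rewrite gt_eqF.
Qed.

Theorem gradient_bound : exists2 K : R, 0 < K & forall f, admissible (disc 0 1) f ->
  cmod (f 0) <= 1 -> cmod (derive1 f 0) <= K.
Proof.
apply: contrapT => hn.
have /choice[f hf] : forall n : nat, exists f, [/\ admissible (disc 0 1) f, cmod (f 0) <= 1 &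
    2 * n.+1%:R ^+ (N + W) <= cmod (derive1 f 0)].
  move=> n; apply: contrapT => h; apply: hn.
  exists (2 * n.+1%:R ^+ (N + W)); first by rewrite mulr_gt0// exprn_gt0.
  by move=> f af f0; rewrite leNgt; apply/negP => /ltW df; apply: h; exists f.
have /choice[g hg] : forall n : nat, exists g, [/\ admissible (disc 0 (n.+1%:R / 8)) g,
    forall z, disc 0 (n.+1%:R / 8) z ->
      cmod (derive1 g z) <= 4 ^+ (N + W) * (1 + cmod (g z) ^+ 2) &
    1 + cmod (g 0) ^+ 2 <= cmod (derive1 g 0)].
  by move=> n; have [af f0 df] := hf n; exact: rescale_steep af f0 df.
pose M : R := 4 ^+ (N + W) * 2; have M0 : 0 < M by rewrite mulr_gt0// exprn_gt0.
have big rho : exists n0, forall n, (n0 <= n)%N -> rho < n.+1%:R / 8 :> R.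
  have [n0 h0] := archi (rho * 8); exists n0 => n /leqW /h0.
  by rewrite -ltr_pdivlMr.
have sub p : exists n0, forall n, (n0 <= n)%N -> forall z, disc p 1 z -> disc 0 (n.+1%:R / 8 : R) z.
  have [n0 h0] := big (1 + cmod p); exists n0 => n /h0 h z.
  by rewrite /disc subr0 => zp; have := cmod_sub_ge z p; lra.
have lip : locally_lip (fun=> True) g.
  move=> p _; have [n0 h0] := sub p; exists 1, 1, M, n0; split=> // n /h0 hs.
  have [[hgn _ _] dg _] := hg n; split; first exact: holo_sub hgn.
  move=> z /hs zd gz; apply: (le_trans (dg z zd)); rewrite /M ler_wpM2l ?exprn_ge0//.
  have : cmod (g n z) ^+ 2 <= 1 by rewrite exprn_ile1// cmod_ge0.
  by lra.
have afg : ev_admissible (fun=> True) g.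
  move=> p _; exists 1 => //; have [n0 h0] := sub p; exists n0 => n /h0 hs.
  by have [ag _ _] := hg n; apply: admissible_sub ag.
have [s si [[G hG]|lG]] := normal_on (pconnected_convex (@convex_all R)) lip; last first.
  have eh : exists2 d : R, 0 < d & eholo (disc (0 : C) d) (g \o s).
    exists 1 => //; have [n0 h0] := sub 0; exists n0 => n nn.
    have [[h _ _] _ _] := hg (s n); apply: holo_sub h; apply: h0.
    exact: leq_trans nn (inc_ge si n).
  have [n0 /(_ n0 (leqnn _))] := linf_derive lG I eh (e := 1) ltr01.
  by have [_ _] := hg (s n0); rewrite mul1r /=; lra.
have afs : ev_admissible (fun=> True) (g \o s).
  move=> p Up; have [d d0 [n0 h0]] := afg p Up; exists d => //; exists n0 => n nn; apply: h0.
  exact: leq_trans nn (inc_ge si n).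
have eG : entire G by move=> rho; apply: holo_sub (hluc_holo hG).
have := hluc_derive hG => hdG.
have dG : derive1 G 0 = 0.
  (* Where |G| <= 1, eventually |g n| <= 5/4, so 1 + |g n|^2 <= 4 and the derivative is at most 4^(N
     + W) 4 = 2 M. *)
  apply: (@entire_admissible_cst R k q hq0 G (2 * M)) => //.
  - exact: limit_flat_zeros (@open_all R) hG afs.
  - exact: limit_dmon_entire hG afs.
  move=> z Gz; have cz := hluc_pt hG (z := z) I.
  apply: (cvc_le (hluc_pt hdG (z := z) I)).
  have [n1 h1] := cz (1 / 4) ltac:(by []); have [n2 h2] := sub z.
  exists (maxn n1 n2) => n; rewrite geq_max => /andP[/h1 nn1 nn2].
  have [_ dg _] := hg (s n).
  have zd : disc 0 ((s n).+1%:R / 8) z.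
    by apply: (h2 _ (leq_trans nn2 (inc_ge si n))); exact: disc_center.
  apply: (le_trans (dg z zd)); rewrite /M mulrCA ler_wpM2l ?exprn_ge0//.
  have := cmod_sub_ge (g (s n) z) (G z); move: nn1 => /=.
  have := cmod_ge0 (g (s n) z); move: (cmod (g (s n) z)) => y y0 h3 h4.
  have : y <= 5 / 4 by lra.
  by nra.
have := hluc_pt hdG (z := 0) I; rewrite dG => c0.
have [n0 /(_ n0 (leqnn _))] := c0 1 ltr01; rewrite subr0 /=.
by have [_ _] := hg (s n0); have := sqr_ge0 (cmod (g (s n0) 0)); lra.
Qed.

Lemma gradient_bound_scaled : exists2 K : R, 0 < K & forall f a t, 0 < t ->
  admissible (disc a (t ^+ N)) f -> cmod (f a) <= t ^+ W ->
  cmod (derive1 f a) <= K * t ^+ W / t ^+ N.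
Proof.
have [K K0 hK] := gradient_bound; exists K => // f a t t0 af fa.
have tN : 0 < t ^+ N by rewrite exprn_gt0.
have tW : 0 < t ^+ W by rewrite exprn_gt0.
pose g z := rc (t ^- W) * f (a + rc (t ^+ N) * z).
have ag : admissible (disc 0 1) g.
  apply: admissible_sub (admissible_rescale a t0 (@disc_open R a (t ^+ N)) af) => z.
  rewrite /disc subr0 addrC addKr cmodM cmod_rc gtr0_norm// => z1.
  by rewrite -[X in _ < X]mulr1 ltr_pM2l.
have cc : cmod (rc (t ^- W)) = t ^- W by rewrite cmod_rc gtr0_norm// invr_gt0.
have cb : cmod (rc (t ^+ N)) = t ^+ N by rewrite cmod_rc gtr0_norm.
have := hK g ag; rewrite /g !mulr0 addr0 cmodM cc mulrC ler_pdivrMr// mul1r => /(_ fa).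
have [hf _ _] := af.
have hd : cder f (a + rc (t ^+ N) * 0) (derive1 f a).
  by rewrite mulr0 addr0; apply: (holo_der hf); exact: disc_center.
rewrite (cder_derive1 (cder_affine _ hd)) !cmodM cc cb => h.
rewrite ler_pdivlMr// mulrC -ler_pdivrMr//.
by move: h; rewrite (_ : t ^- W * t ^+ N * _ = t ^+ N * cmod (derive1 f a) / t ^+ W)//; ring.
Qed.

Theorem admissible_normal Om (f : nat -> C -> C) : open_set Om -> pconnected Om ->
  ev_admissible Om f ->
  exists2 s, inc s & (exists g, hluc Om (f \o s) g) \/ linf Om (f \o s).
Proof.
move=> oO cO af; apply: normal_on => // p Op.
have [K K0 hK] := gradient_bound_scaled.
have [d d0 [n0 h0]] := af p Op; have [d' d'0 hd'] := oO p Op.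
pose r := Num.min (d / 2) d'; have r0 : 0 < r by rewrite lt_min divr_gt0.
pose t := Num.min 1 r; have t0 : 0 < t by rewrite lt_min ltr01.
have tr : t ^+ N <= r.
  apply: (@le_trans _ _ t); last by rewrite ge_min lexx orbT.
  rewrite -[leRHS]expr1; apply: pow_le1_anti; first by rewrite t0 ge_min lexx.
  exact: mon_deg_gt0.
have rd : r <= d / 2 by rewrite ge_min lexx.
have tN : 0 < t ^+ N by rewrite exprn_gt0.
have tW : 0 < t ^+ W by rewrite exprn_gt0.
exists r, (t ^+ W), (K * t ^+ W / t ^+ N), n0; split=> //.
- by rewrite divr_gt0// mulr_gt0.
- by move=> z zp; apply: hd'; apply: lt_le_trans zp _; rewrite ge_min lexx orbT.
move=> n /h0 afn; split.
  have [hf _ _] := afn; apply: holo_sub hf => z; apply: disc_le.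
  by rewrite (le_trans rd)// ler_pdivrMr// ler_peMr ?(ltW d0)// ler1n.
move=> z zp fz; apply: hK => //; apply: admissible_sub afn => w.
apply: disc_sub; move: zp; rewrite /disc; move: tr rd; move: (t ^+ N) => x; lra.
Qed.

End GradientBound.

(** * The point at infinity *)

Section PuncturedPlane.
Variables (R : realType) (k : nat) (q : nat -> nat).
Hypotheses (hk : (1 <= k)%N) (hq0 : (3 <= q 0%N)%N) (hqk : (1 <= q k)%N).
Local Notation C := (Cplx R).
Local Notation cder := (der (fun z : C => z)).
Local Notation admissible := (@admissible R k q).
Local Notation dmon := (@dmon R k q).
Local Notation N := (mon_deg k q).
Local Notation W := (mon_weight k q).
Local Notation punctured := (fun z : C => 0 < cmod z).

Lemma open_outside (r : R) : open_set (fun z : C => r < cmod z).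
Proof.
move=> p hp; exists (cmod p - r); first by rewrite subr_gt0.
by move=> z; have := cmod_sub_ge p z; rewrite cmodBC; lra.
Qed.

Lemma mon_weight_gt0 : (0 < W)%N.
Proof.
by rewrite /mon_weight big_nat_recr//= addn_gt0 muln_gt0 hk hqk orbT.
Qed.

Lemma nth_root_pos (n : nat) (x : R) : (0 < n)%N -> 0 < x -> exists2 t : R, 0 < t & t ^+ n = x.
Proof.
move=> n0 x0; exists (expR (ln x / n%:R)); first exact: expR_gt0.
by rewrite -expRM_natl mulrCA divff ?mulr1 ?lnK ?posrE// pnatr_eq0 -lt0n.
Qed.

Lemma exp_type_lin (a b : C) : exp_type (fun s => cexp (a * s + b)).
Proof.
split; first by apply/entireP => s; eexists; exact: cder_cexp_lin.
exists (cmod b), (cmod a); split=> [||s]; rewrite ?cmod_ge0//.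
rewrite cmod_cexp ler_expR -cmodM; have := Re_le_cmod (a * s + b).
by have := cmodD (a * s) b; rewrite ler_norml => ? /andP[_ ?]; lra.
Qed.

Variables (h : C -> C) (r0 B : R).
Hypotheses (r00 : 0 < r0) (hh : holo punctured h)
  (hB : forall z, r0 <= cmod z -> cmod (h z) <= B).

(** Derivatives of h, not of the pullback: they stay the factors of the monomial, and each H i is
    entire. The shifts s + n move exp s to infinity. *)
Let H (i : nat) (s : C) : C := derive1n i h (cexp s).

Lemma cexp_punctured s : 0 < cmod (cexp s : C).
Proof. by rewrite cmod_cexp expR_gt0. Qed.

Lemma holo_derive1n_punctured i : holo punctured (derive1n i h).
Proof. by apply: holo_derive1n => //; exact: open_outside. Qed.

Lemma pullback_der i s : cder (H i) s (H i.+1 s * cexp s).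
Proof.
rewrite /H derive1nS.
exact: (@der_comp R C (fun z => z) _ (@cexp R) s _ _ (holo_der (holo_derive1n_punctured i) (cexp_punctured s)) (cder_cexp s)).
Qed.

Lemma pullback_entire i : entire (H i).
Proof. by apply/entireP => s; eexists; exact: pullback_der. Qed.

(** Cauchy's estimate on the disc of radius |z| / 2 about z gains a factor 1 / |z|; one such factor
    is all that is recorded. *)
Lemma derivative_bounded i : exists r M : R, [/\ 0 < r, 0 < M &
  forall z, r <= cmod z -> cmod (derive1n i h z) <= M /\ cmod (derive1n i.+1 h z) <= M / cmod z].
Proof.
have step j r M : 0 < r -> 0 < M -> (forall z, r <= cmod z -> cmod (derive1n j h z) <= M) ->
    forall z, 2 * r <= cmod z -> cmod (derive1n j.+1 h z) <= 4 * M / cmod z.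
  move=> r1 M0 hj z hz; have z0 : 0 < cmod z by lra.
  have d0 : 0 < cmod z / 2 by rewrite divr_gt0.
  have sub w : disc z (cmod z / 2) w -> r <= cmod w.
    by rewrite /disc cmodBC; have := cmod_sub_ge z w; lra.
  have hd : holo (disc z (cmod z / 2)) (derive1n j h).
    by apply: holo_sub (holo_derive1n_punctured j) => w /sub; lra.
  have [|e _] := taylor2 d0 hd (M := M); first by move=> w /sub; exact: hj.
  rewrite derive1nS; apply: (le_trans e); rewrite le_eqVlt; apply/orP; left; apply/eqP.
  by field; rewrite gt_eqF.
suff [r [M [r1 M0 hM]]] : exists r M : R, [/\ 0 < r, 0 < M &
    forall z, r <= cmod z -> cmod (derive1n i h z) <= M].
  exists (2 * r), (4 * M); split; rewrite ?mulr_gt0// => z hz; split.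
    by apply: le_trans (hM z _) _; lra.
  exact: step hz.
elim: i => [|i [r [M [r1 M0 hM]]]].
  exists r0, (Num.max B 1); split=> //; first by rewrite lt_max ltr01 orbT.
  by move=> z /hB; rewrite derive1n0 => hz; rewrite le_max hz.
exists (2 * r), (4 * M / (2 * r)); split; rewrite ?divr_gt0 ?mulr_gt0// => z hz.
apply: (le_trans (step i r M r1 M0 hM z hz)).
have r2 : 0 < 2 * r by lra.
by rewrite ler_wpM2l ?mulr_ge0 ?(ltW M0)// lef_pV2 ?posrE//; lra.
Qed.

Lemma cmod_shift_unbounded (s : C) (M : R) :
  exists n0, forall n, (n0 <= n)%N -> M <= cmod (cexp (n%:R + s)).
Proof.
have [n0 h0] := archi (M - Re s); exists n0 => n /h0 hn.
rewrite cmod_cexp ReD -rc_nat /=; have := expR_ge1Dx (n%:R + Re s); lra.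
Qed.

Lemma pullback_decay i s : cvc (fun n => H i.+1 (n%:R + s)) 0.
Proof.
move=> e e0; have [r [M [r1 M0 hM]]] := derivative_bounded i.
have [n0 hn] := cmod_shift_unbounded s (r + M / e + 1); exists n0 => n /hn h1.
have Me : 0 < M / e by rewrite divr_gt0.
rewrite subr0; have [|_ h2] := hM (cexp (n%:R + s)); first by lra.
apply: (le_lt_trans h2); rewrite ltr_pdivrMr; last by lra.
by rewrite mulrC -ltr_pdivrMr//; lra.
Qed.

Lemma prod_bounded s j : exists M : R, exists n0, forall n, (n0 <= n)%N ->
  cmod (\prod_(0 <= i < j) H i (n%:R + s) ^+ q i) <= M.
Proof.
elim: (index_iota _ _) => [|i l [M [n0 IH]]].
  by exists 1, 0%N => n _; rewrite big_nil cmod1.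
have [r [M' [r1 M0 hM]]] := derivative_bounded i.
have [n1 hn] := cmod_shift_unbounded s r.
exists (M' ^+ q i * M), (maxn n0 n1) => n; rewrite geq_max => /andP[/IH k1 /hn k2].
rewrite big_cons cmodM cmodX; apply: ler_pM; rewrite ?exprn_ge0 ?cmod_ge0//.
apply: lerXn2r; rewrite ?nnegrE ?cmod_ge0 ?(ltW M0)//.
by have [] := hM _ k2.
Qed.

(** The k-th derivative occurs with a positive exponent and has positive order, so it tends to 0;
    the other factors stay bounded. *)
Lemma dmon_decay s : cvc (fun n => dmon h (cexp (n%:R + s))) 0.
Proof.
have [M [n0 hM]] := prod_bounded s k.
move=> e e0.
pose M1 := Num.max M 1; have M10 : 0 < M1 by rewrite lt_max ltr01 orbT.
have d0 : 0 < Num.min 1 (e / M1) by rewrite lt_min ltr01 divr_gt0.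
have [n1 h1] := pullback_decay k.-1 s d0; rewrite prednK// in h1.
exists (maxn n0 n1) => n; rewrite geq_max => /andP[/hM k1 /h1].
rewrite !subr0 lt_min => /andP[k2 k3].
rewrite [dmon _ _]big_nat_recr//= cmodM cmodX.
have k4 : cmod (H k (n%:R + s)) ^+ q k <= cmod (H k (n%:R + s)).
  by rewrite -[leRHS]expr1 -[X in _ ^+ X <= _]prednK// exprS expr1 ler_piMr ?cmod_ge0// exprn_ile1 ?cmod_ge0// ltW.
apply: (@le_lt_trans _ _ (M1 * cmod (H k (n%:R + s)))).
  apply: ler_pM; rewrite ?cmod_ge0 ?exprn_ge0 ?cmod_ge0//.
  by rewrite le_max k1.
by rewrite mulrC -ltr_pdivlMr.
Qed.

Hypothesis ah : admissible punctured h.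

(* With t^N = |z| the disc of radius t^N about z avoids 0, so the level curve
   |h z| = t^W is controlled by gradient_bound_scaled. In the coordinate s = log z this
   is the level curve |G| = 1 of G s = h (e^s) e^(-(W/N) s). *)
Lemma pullback0_exp_type : exp_type (H 0).
Proof.
have [K K0 hK] := gradient_bound_scaled R hk hq0.
have N0 : (0 < N)%N by exact: mon_deg_gt0.
have Nr : 0 < N%:R :> R by rewrite ltr0n.
pose al : R := W%:R / N%:R.
have al0 : 0 < al by rewrite divr_gt0// ltr0n mon_weight_gt0.
pose E s : C := cexp (- rc al * s + 0).
have cE s : cmod (E s) = expR (- al * Re s).
  by rewrite /E cmod_cexp addr0 -rcN Re_rcM.
pose G s := H 0 s * E s.
have eE : entire E by apply/entireP => s; eexists; exact: cder_cexp_lin.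
have eG : entire G by move=> rho; apply: holoM; [exact: pullback_entire|exact: eE].
have H0b s : ln r0 <= Re s -> cmod (H 0 s) <= B.
  by move=> hs; apply: hB; rewrite cmod_cexp -[leLHS]lnK ?posrE// ler_expR.
have lev s : cmod (G s) <= 1 -> cmod (derive1 G s) <= K + al.
  move=> Gs; pose t := expR (Re s / N%:R); have t0 : 0 < t by exact: expR_gt0.
  have tN : t ^+ N = cmod (cexp s).
    by rewrite /t -expRM_natl mulrCA divff ?mulr1 ?cmod_cexp// gt_eqF.
  have tW : t ^+ W = expR (al * Re s) by rewrite /t -expRM_natl /al mulrAC mulrA.
  have tE : cmod (E s) = t ^- W by rewrite cE tW mulNr expRN.
  have tN0 : 0 < t ^+ N by rewrite exprn_gt0.
  have tW0 : 0 < t ^+ W by rewrite exprn_gt0.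
  have h0 : cmod (h (cexp s)) <= t ^+ W.
    by move: Gs; rewrite /G cmodM tE ler_pdivrMr// mul1r.
  have h1 : cmod (derive1 h (cexp s)) <= K * t ^+ W / t ^+ N.
    apply: hK => //; apply: admissible_sub ah => z; rewrite tN /disc cmodBC.
    by have := cmod_sub_ge (cexp s) z; lra.
  rewrite (cder_derive1 (derM (pullback_der 0 s) (cder_cexp_lin _ _ _))).
  apply: (le_trans (cmodD _ _)); apply: lerD.
    rewrite !cmodM tE ler_pdivrMr// -ler_pdivlMr; last by rewrite -tN.
    by rewrite /H derive1nS derive1n0 -tN.
  rewrite mulrCA -/(E s) -/(G s) cmodM cmodN cmod_rc gtr0_norm//.
  by rewrite -[leRHS]mulr1 ler_wpM2l// ltW.
have [s0 Gs0] : exists s0, cmod (G s0) <= 1.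
  (* For this x the bound B applies at exp x, and exp(al x) >= max(B, 1). *)
  pose x := Num.max (ln r0) (ln (Num.max B 1) / al).
  exists (rc x); rewrite /G cmodM cE /= mulNr expRN ler_pdivrMr ?expR_gt0// mul1r.
  have x1 : ln r0 <= x by rewrite le_max lexx.
  apply: (le_trans (H0b (rc x) x1)); apply: (@le_trans _ _ (Num.max B 1)).
    by rewrite le_max lexx.
  rewrite -[leLHS]lnK ?posrE ?lt_max ?ltr01 ?orbT// ler_expR mulrC -ler_pdivrMr//.
  by rewrite le_max lexx orbT.
have Kal : 0 <= K + al by rewrite addr_ge0// ltW.
have Gt : exp_type G.
  split=> //; exists (2 * (K + al) * cmod s0), (2 * (K + al)); split=> [||s].
  - by rewrite !mulr_ge0 ?cmod_ge0.
  - by rewrite mulr_ge0.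
  apply: (le_trans (growth_from_level_curve s eG Kal _ Gs0)).
    by move=> w fw; apply: lev; rewrite fw.
  by rewrite ler_expR -mulrDr ler_wpM2l ?mulr_ge0// (addrC (cmod s0)) cmodB_le.
have -> : H 0 = fun s => G s * cexp (rc al * s + 0).
  apply/funext => s; rewrite /G /E -mulrA -cexpD mulNr !addr0 addNr cexp0 mulr1//.
apply: exp_typeM => //; exact: exp_type_lin.
Qed.

(** The chain rule gives H (i + 1) = (H i)' exp(-s). *)
Lemma pullback_exp_type i : exp_type (H i).
Proof.
elim: i => [|i IH]; first exact: pullback0_exp_type.
have -> : H i.+1 = fun s => derive1 (H i) s * cexp (- 1 * s + 0).
  apply/funext => s; rewrite (cder_derive1 (pullback_der i s)) -mulrA -cexpD.
  by rewrite mulN1r addr0 subrr cexp0 mulr1.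
by apply: exp_typeM; [exact: exp_type_derive|exact: exp_type_lin].
Qed.

(** P omits 1, so P = 1 + exp(a s + b). As P (s + n) tends to 0, exp(a (s + n) + b) tends to -1
    whatever s is, which forces a = 0 and then P = 0. Hence some H j vanishes identically; decay at
    infinity makes the lower derivatives vanish down to the first, so H 0 is constant. *)
Theorem punctured_admissible_cst z w : 0 < cmod z -> 0 < cmod w -> h z = h w.
Proof.
have [_ _ h1] := ah.
pose P s := dmon h (cexp s).
have Pt : exp_type P by apply: exp_type_prod => i; exact: pullback_exp_type.
have [eQ [A [B' [A0 B0 Qb]]]] := exp_typeB Pt (exp_type_cst 1).
have [|a [b eab]] := zero_free_exp_type eQ _ A0 B0 Qb.
  by move=> s; rewrite subr_eq0; apply/eqP/h1/cexp_punctured.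
have EP s : P s = 1 + cexp (a * s + b) by rewrite -eab addrC subrK.
have lim1 s : cvc (fun n => cexp (a * s) * cexp (a * n%:R + b)) (-1).
  move=> e /(dmon_decay s)[n0 h0]; exists n0 => n /h0; rewrite -/(P _) EP subr0 opprK addrC.
  by rewrite -cexpD (_ : a * (n%:R + s) + b = a * s + (a * n%:R + b))//; ring.
have a0 : a = 0.
  apply/eqP/negP => /negP a0; have [|s es] := cexp_reaches 0 a0 (w := 2%:R).
    by rewrite -cmod_gt0 cmod_nat.
  rewrite addr0 in es.
  have l0 := lim1 0; rewrite mulr0 cexp0 in l0.
  have l2 : cvc (fun n => cexp (a * s) * cexp (a * n%:R + b)) (2%:R * -1).
    move=> e e0; have e2 : 0 < e / 2 by rewrite divr_gt0.
    have [n0 hn] := l0 _ e2; exists n0 => n /hn; rewrite mul1r es -mulrBr cmodM cmod_nat; lra.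
  have := cvc_uniq (lim1 s) l2; move=> /(congr1 (@cmod R)); rewrite cmodM cmodN cmod_nat cmod1.
  by move=> e; exfalso; lra.
have P0 s : P s = 0.
  apply: (cvc_uniq _ (dmon_decay 0)) => e e0; exists 0%N => n _.
  by rewrite -/(P _) !EP a0 !mul0r subrr cmod0.
have [j] := entire_prod_eq0 pullback_entire P0; rewrite mem_index_iota => /andP[_ jk].
have cst i : (forall s, H i.+1 s = 0) -> forall s s', H i s = H i s'.
  move=> hi s s'; apply: (cder0_cst (@convex_all R) (f := H i)) => // {}s _.
  by apply: (der_eq (pullback_der i s)); rewrite hi mul0r.
have desc i : (forall s, H i.+2 s = 0) -> forall s, H i.+1 s = 0.
  move=> hi s; apply: (cvc_uniq _ (pullback_decay i 0)) => e e0; exists 0%N => n _.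
  by rewrite (cst i.+1 hi _ s) subrr cmod0.
have H0cst : (forall s, H j s = 0) -> forall s s', H 0 s = H 0 s'.
  case: j {jk} => [h0 s s'|j]; first by rewrite !h0.
  by elim: j => [|j IH] hj; [exact: cst|apply: IH; exact: desc].
move=> /H0cst c; rewrite !cmod_gt0 => /cexp_surj[s <- _] /cexp_surj[s' <- _].
exact: c.
Qed.

End PuncturedPlane.

(** * Blow-ups and normality near infinity *)

Section AtInfinity.
Variables (R : realType) (k : nat) (q : nat -> nat).
Hypotheses (hk : (1 <= k)%N) (hq0 : (3 <= q 0%N)%N) (hqk : (1 <= q k)%N).
Local Notation C := (Cplx R).
Local Notation cder := (der (fun z : C => z)).
Local Notation admissible := (@admissible R k q).
Local Notation ev_admissible := (@ev_admissible R k q).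
Local Notation dmon := (@dmon R k q).
Local Notation N := (mon_deg k q).
Local Notation W := (mon_weight k q).
Local Notation punctured := (fun z : C => 0 < cmod z).

(** Sequential compactness of the circle turns local thresholds into a common one. *)
Lemma circle_uniform (P : nat -> C -> Prop) (r : R) :
  (forall p, cmod p = r -> exists2 d : R, 0 < d &
     exists n0, forall n, (n0 <= n)%N -> forall z, disc p d z -> P n z) ->
  exists n0, forall n, (n0 <= n)%N -> forall z, cmod z = r -> P n z.
Proof.
move=> hP; apply: contrapT => hn.
have /choice[u hu] : forall n0 : nat, exists nz : nat * C,
    [/\ (n0 <= nz.1)%N, cmod nz.2 = r & ~ P nz.1 nz.2].
  move=> n0; apply: contrapT => h; apply: hn; exists n0 => n nn z zr.
  by apply: contrapT => hz; apply: h; exists (n, z).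
have [|s si [l hl]] := @bw R (fun n => (u n).2) r; first by move=> n; have [_ ->] := hu n.
have lr : cmod l = r.
  apply/eqP; rewrite eq_le; apply/andP; split.
    by apply: (cvc_le hl); exists 0%N => n _; have [_ /= ->] := hu (s n).
  by apply: (cvc_ge hl); exists 0%N => n _; have [_ /= ->] := hu (s n).
have [d d0 [n0 h0]] := hP l lr; have [n1 h1] := hl _ d0.
pose n := maxn n0 n1; have [k1 _ k3] := hu (s n).
apply: k3; apply: h0; last exact: h1 (leq_maxr _ _).
apply: leq_trans k1; exact: leq_trans (leq_maxl _ _) (inc_ge si n).
Qed.

Lemma hluc_circle U (f : nat -> C -> C) g (r e : R) : hluc U f g -> 0 < e ->
  (forall z, cmod z = r -> U z) ->
  exists n0, forall n, (n0 <= n)%N -> forall z, cmod z = r -> cmod (f n z - g z) < e.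
Proof.
move=> hf e0 rU; apply: (@circle_uniform (fun n z => cmod (f n z - g z) < e)) => p /rU /hf[d [d0 _ u]].
by exists d => //; have [n0 h0] := u _ e0; exists n0.
Qed.

Lemma linf_circle U (f : nat -> C -> C) (r M : R) : linf U f -> (forall z, cmod z = r -> U z) ->
  exists n0, forall n, (n0 <= n)%N -> forall z, cmod z = r -> M <= cmod (f n z).
Proof.
move=> hf rU; apply: (@circle_uniform (fun n z => M <= cmod (f n z))) => p /rU /hf[d d0 u].
by exists d => //; have [n0 h0] := u M; exists n0.
Qed.

Lemma max_principle0 (f : C -> C) (r M : R) rho : 0 < r -> r < rho -> holo (disc 0 rho) f ->
  (forall z, cmod z = r -> cmod (f z) <= M) -> forall z, cmod z <= r -> cmod (f z) <= M.
Proof.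
move=> r0 rr hf hM z; rewrite le_eqVlt => /orP[/eqP|zr]; first exact: hM.
apply: (max_principle r0 rr hf) => [t|]; last by rewrite /disc subr0.
by apply: hM; rewrite -[X in cmod X]subr0 (@cmod_circ R 0 r r0).
Qed.

Lemma circle_bound (f : C -> C) (r : R) rho : 0 < r -> r < rho -> holo (disc 0 rho) f ->
  exists M : R, forall z, cmod z = r -> cmod (f z) <= M.
Proof.
move=> r0 rr hf; apply: contrapT => hn.
have /choice[u hu] : forall n : nat, exists z, cmod z = r /\ n%:R < cmod (f z).
  move=> n; apply: contrapT => h; apply: hn; exists n%:R => z zr.
  by rewrite leNgt; apply/negP => hz; apply: h; exists z.
have [|s si [l hl]] := @bw R u r; first by move=> n; have [->] := hu n.
have lr : disc 0 rho l.
  rewrite /disc subr0; apply: le_lt_trans rr; apply: (cvc_le hl).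
  by exists 0%N => n _; have [/= ->] := hu (s n).
have [n1 h1] := cvc_cont (holo_cont hf lr) hl ltr01.
have [n2 h2] := archi (cmod (f l) + 1).
pose n := maxn n1 n2; have k1 := h1 n (leq_maxl _ _).
have k2 := h2 _ (leq_trans (leq_maxr n1 n2) (inc_ge si n)).
have [_ k3] := hu (s n); have := cmod_sub_ge (f (u (s n))) (f l).
by move: k1 k2 k3 => /=; lra.
Qed.

(* A blow-up limit that is finite on the punctured plane is bounded at infinity by the
   maximum principle in the coordinate w = 1/z, hence constant. *)
Lemma blow_up_dichotomy (K : nat -> C -> C) : (forall A, eholo (disc 0 A) K) ->
  ev_admissible punctured (fun n z => K n z^-1) ->
  exists2 s, inc s & linf punctured (fun n z => K (s n) z^-1) \/
    exists c : C, forall A e : R, 0 < e ->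
      exists n0, forall n, (n0 <= n)%N -> forall w, cmod w <= A -> cmod (K (s n) w - c) < e.
Proof.
move=> hK aK.
have pc : pconnected punctured by exact: pconnected_outside.
have oP : open_set punctured by exact: open_outside.
have [s si [[h hh]|l]] := admissible_normal hk hq0 oP pc aK; exists s => //; last by left.
right.
have aKs : ev_admissible punctured (fun n z => K (s n) z^-1).
  move=> p pp; have [d d0 [n0 h0]] := aK p pp; exists d => //; exists n0 => n nn; apply: h0.
  exact: leq_trans nn (inc_ge si n).
have [n1 h1] := hluc_circle hh ltr01 (r := 1) (fun z e => eq_ind_r (fun x => 0 < x) ltr01 e).
have [n2 h2] := hK 2.
have [B hB] : exists B, forall z, 1 <= cmod z -> cmod (h z) <= B.
  pose n0 := maxn n1 n2.
  have hol n : (n0 <= n)%N -> holo (disc 0 2) (K (s n)).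
    move=> nn; apply: h2; apply: leq_trans (leq_trans nn (inc_ge si n)); exact: leq_maxr.
  have [M hM] := circle_bound ltr01 (ltr1n R 2) (hol n0 (leqnn _)).
  exists (M + 2) => z z1; have zp : 0 < cmod z by apply: lt_le_trans z1.
  apply: (cvc_le (hluc_pt hh zp)); exists n0 => n nn /=.
  apply: (max_principle0 ltr01 (ltr1n R 2) (hol n nn)) => [w w1|]; last first.
    by rewrite cmodV invf_le1.
  have iw : cmod (w^-1) = 1 by rewrite cmodV w1 invr1.
  have k1 := h1 n (leq_trans (leq_maxl _ _) nn) _ iw.
  have k2 := h1 n0 (leq_maxl _ _) _ iw; have k3 := hM w w1.
  rewrite /= invrK in k1 k2.
  have := cmod_sub_ge (K (s n) w) (h w^-1); have := cmod_sub_ge (h w^-1) (K (s n0) w).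
  by rewrite (cmodBC (h _)); lra.
have hhol : holo punctured h by exact: hluc_holo hh.
have fz : flat_zeros k punctured h by exact: limit_flat_zeros oP hh aKs.
have ah : admissible punctured h.
  (* The monomial of h cannot be 1 near a point: pulled back by the exponential it would be 1
     everywhere, while it decays at infinity. *)
  split=> // z zp dz; have [//|[d d0 hd]] := limit_dmon oP hh aKs zp.
  have [s0 es _] : exists2 s0 : C, cexp s0 = z & True.
    by have [s0 es _] := cexp_surj (etrans (esym (cmod_gt0 z)) zp : z != 0); exists s0.
  have eP : entire (fun s => dmon h (cexp s) - 1).
    have e1 : entire (fun s => dmon h (cexp s)).
      apply: entire_prod => i; exact: (pullback_entire hhol i).
    by move=> rho; apply: holoB; [exact: e1|exact: holo_cst].
  have [d' d'0 hd'] := der_cont (cder_cexp s0) d0.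
  have P1 s1 : dmon h (cexp s1) = 1.
    apply/eqP; rewrite -subr_eq0; apply/eqP; move: s1.
    apply: (entire_identity eP d'0 (p := s0)) => s1 /hd'; rewrite es => hz.
    by rewrite hd// subrr.
  have [n0 hn] := dmon_decay hk hqk ltr01 hhol hB 0 ltr01.
  by have := hn n0 (leqnn _); rewrite P1 subr0 cmod1 ltxx.
have cst z : 0 < cmod z -> h z = h 1.
  by move=> zp; apply: (punctured_admissible_cst hk hq0 hqk ltr01 hhol hB ah) => //; rewrite cmod1.
exists (h 1) => A e e0.
(* Convergence on the circle |w| = A' spreads to the whole disc, including w = 0, by the maximum
   principle. *)
pose A' := Num.max A 1; have A'0 : 0 < A' by rewrite lt_max ltr01 orbT.
have [n3 h3] := hK (A' + 1).
have e2 : 0 < e / 2 by rewrite divr_gt0.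
have [|n4 h4] := hluc_circle hh e2 (r := A'^-1); first by move=> z ->; rewrite invr_gt0.
exists (maxn n3 n4) => n; rewrite geq_max => /andP[nn3 nn4] w wA.
have hol : holo (disc 0 (A' + 1)) (fun w => K (s n) w - h 1).
  by apply: holoB; [apply: h3; exact: leq_trans nn3 (inc_ge si n)|exact: holo_cst].
apply: (@le_lt_trans _ _ (e / 2)); last by lra.
apply: (max_principle0 A'0 _ hol) => [|v vA|]; first by lra.
  have iv : cmod (v^-1) = A'^-1 by rewrite cmodV vA.
  have := h4 n nn4 _ iv; rewrite /= invrK cst; first exact: ltW.
  by rewrite iv invr_gt0.
by rewrite le_max wA.
Qed.

Variables (rho : R) (phi : nat -> C -> C).
Hypotheses (rho0 : 0 < rho) (hphi : forall n, holo (disc 0 rho) (phi n))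
  (aphi : forall n, admissible (fun z => rho^-1 < cmod z) (fun z => phi n z^-1)).

(** In the coordinate z this is the invariant scaling t^(-W) f (t^N z) with centre 0. As r n tends
    to infinity, the domains exhaust the punctured plane in z and the whole plane in w = 1/z. *)
Lemma blow_up (s : nat -> nat) (r : nat -> R) : (forall n, 0 < r n) ->
  (forall M, exists n0, forall n, (n0 <= n)%N -> M <= r n) ->
  exists t K, [/\ forall n, 0 < t n, forall n, t n ^+ N = r n,
    K = (fun n w => rc (t n ^- W) * phi (s n) (rc (r n)^-1 * w)) &
  [/\ forall A, eholo (disc 0 A) K & ev_admissible punctured (fun n z => K n z^-1)]].
Proof.
move=> r0 rinf.
have /choice[t ht] : forall n, exists t : R, 0 < t /\ t ^+ N = r n.
  by move=> n; have [t t0 et] := nth_root_pos (mon_deg_gt0 k hq0) (r0 n); exists t.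
exists t; eexists; split; [by move=> n; have [] := ht n|by move=> n; have [] := ht n|reflexivity|split].
- move=> A; have [n0 h0] := rinf ((`|A| + 1) / rho); exists n0 => n /h0 hn.
  move=> z zA; have := @holo_affine R (disc 0 rho) (phi (s n)) 0 (rc (r n)^-1) (rc (t n ^- W)) (hphi (s n)) z.
  rewrite (_ : (fun z => _ * phi _ (0 + _ * z)) = fun w => rc (t n ^- W) * phi (s n) (rc (r n)^-1 * w)); last first.
    by apply/funext => w; rewrite add0r.
  apply; rewrite /disc add0r subr0 cmodM cmod_rc gtr0_norm ?invr_gt0// mulrC ltr_pdivrMr//.
  rewrite ler_pdivrMr// in hn; move: zA; rewrite /disc subr0.
  by have := ler_norm A; rewrite mulrC in hn; lra.
- move=> p pp; have d0 : 0 < cmod p / 2 by rewrite divr_gt0.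
  exists (cmod p / 2) => //; have [n0 h0] := rinf ((1 + rho^-1) / (cmod p / 2)); exists n0 => n /h0 hn.
  have [t0 et] := ht n.
  have := admissible_rescale 0 t0 (@open_outside R rho^-1) (aphi (s n)).
  rewrite et (_ : (fun z => _ * phi _ (0 + _ * z)^-1) = fun z => rc (t n ^- W) * phi (s n) (rc (r n)^-1 * z^-1)); last first.
    by apply/funext => z; rewrite add0r invfM (rcV (r n)).
  apply: admissible_sub => z; rewrite /disc => zp.
  rewrite add0r cmodM cmod_rc gtr0_norm//.
  have zp2 : cmod p / 2 < cmod z by have := cmod_sub_ge p z; rewrite cmodBC; lra.
  move: hn; rewrite ler_pdivrMr// => hn.
  apply: (@lt_le_trans _ _ (r n * (cmod p / 2))); first by lra.
  by rewrite ler_pM2l// ltW.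
Qed.

(* w_n is the point closest to infinity where |f| >= |z|^(W/N). The blow-up there
   tends to a constant of modulus >= 1, so the zero lies much closer; the blow-up at
   the zero tends to 0 uniformly near infinity, contradicting the choice of w_n. *)
Lemma no_zeros_near_infinity (s : nat -> nat) :
  linf (fun z => rho^-1 < cmod z) (fun n z => phi (s n) z^-1) ->
  (forall n, exists2 w, cmod w <= rho / 2 & phi (s n) w = 0) -> inc s -> False.
Proof.
move=> linfy hz si; have rho0' := rho0.
have W0 : (0 < W)%N by exact: mon_weight_gt0.
have N0 : (0 < N)%N by exact: (mon_deg_gt0 k hq0).
(* The condition |f z| >= |z|^(W/N) at z = 1/w, raised to the power N. *)
pose A n (w : C) := cmod w <= rho / 2 /\ 1 <= cmod (phi (s n) w) ^+ N * cmod w ^+ W.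
have rho2 : rho / 2 < rho by lra.
have closedA n (u : nat -> C) l : (forall m, A n (u m)) -> cvc u l -> A n l.
  move=> Au ul; have l1 : cmod l <= rho / 2.
    by apply: (cvc_le ul); exists 0%N => m _; have [] := Au m.
  split=> //; have lr : disc 0 rho l by rewrite /disc subr0; lra.
  have cl : cont (fun z : C => z) (fun w => phi (s n) w ^+ N * w ^+ W) l.
    by apply: contM; [apply: contX; exact: holo_cont (hphi (s n)) lr|apply: contX; exact: cont_i].
  rewrite -!cmodX -cmodM; apply: (cvc_ge (cvc_cont cl ul)); exists 0%N => m _.
  by rewrite cmodM !cmodX; have [] := Au m.
(* As f tends to infinity at each fixed x, the point 1 / x belongs to A n eventually. So A n becomes
   nonempty, and its point nearest to 0 tends to 0. *)
have A_small (x : R) : rho^-1 < x -> 2 / rho <= x -> exists n0, forall n, (n0 <= n)%N -> A n (rc x^-1).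
  move=> x1 x2; have x0 : 0 < x by apply: lt_trans x1; rewrite invr_gt0.
  have [|d d0 hd] := linfy (rc x); first by rewrite cmod_rc gtr0_norm.
  have [n0 h0] := hd (Num.max 1 (x ^+ W)); exists n0 => n /h0 /(_ _ (disc_center _ d0)).
  rewrite -rcV => hx; split; first by rewrite cmod_rc gtr0_norm ?invr_gt0// -[leRHS]invrK lef_pV2 ?posrE ?invr_gt0 ?divr_gt0// invf_div.
  rewrite cmod_rc gtr0_norm ?invr_gt0// exprVn ler_pdivlMr ?exprn_gt0// mul1r.
  move: hx; rewrite ge_max => /andP[h1 h2]; apply: (le_trans h2).
  by rewrite -[leLHS]expr1 ler_weXn2l.
have [n0 hn0] : exists n0, forall n, (n0 <= n)%N -> A n (rc (2 / rho)^-1).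
  apply: A_small => //; rewrite -[X in X < _]mul1r ltr_pM2r ?invr_gt0//; lra.
have /choice[w hw] : forall n, exists w, A (n0 + n)%N w /\ forall v, cmod v < cmod w -> ~ A (n0 + n)%N v.
  move=> n; have [w [Aw _ hw]] := @nearest_point R (A (n0 + n)%N) 0 _ (hn0 (n0 + n)%N (leq_addr _ _)) (@closedA _).
  by exists w; split=> // v vw; apply: hw; rewrite !subr0.
have w0 n : 0 < cmod (w n).
  have [[_ h1] _] := hw n; rewrite lt_neqAle cmod_ge0 andbT eq_sym; apply/eqP => h0.
  by move: h1; rewrite h0 expr0n (gtn_eqF W0) mulr0 ler10.
pose r n := (cmod (w n))^-1.
have r0 n : 0 < r n by rewrite invr_gt0.
have rinf M : exists m0, forall n, (m0 <= n)%N -> M <= r n.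
  pose x := Num.max M (3 / rho); have x1 : 3 / rho <= x by rewrite le_max lexx orbT.
  have ri : 0 < rho^-1 by rewrite invr_gt0.
  have [||m0 hm] := A_small x; [by lra|by lra|].
  have x0 : 0 < x by lra.
  exists m0 => n mn; apply: (@le_trans _ _ x); first by rewrite le_max lexx.
  have := hm (n0 + n)%N (leq_trans mn (leq_addl _ _)) => Ax.
  rewrite leNgt; apply/negP => xr; have [_ /(_ (rc x^-1))] := hw n; apply=> //.
  rewrite cmod_rc gtr0_norm ?invr_gt0//; move: xr; rewrite /r => xr.
  by rewrite -[X in _ < X]invrK ltf_pV2 ?posrE ?invr_gt0.
have [t [K [t0 tN eK [hK aK]]]] := blow_up (fun n => s (n0 + n)%N) r0 rinf.
have outA n v : cmod v < cmod (w n) -> cmod (phi (s (n0 + n)%N) v) ^+ N * cmod v ^+ W <= 1.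
  move=> vw; have [[w1 _] /(_ v vw) nA] := hw n; rewrite leNgt; apply/negP => h.
  by apply: nA; split; [apply: le_trans w1; exact: ltW|exact: ltW].
have normK n v : cmod (K n v) ^+ N = cmod (phi (s (n0 + n)%N) (rc (r n)^-1 * v)) ^+ N * cmod (w n) ^+ W.
  rewrite eK cmodM cmod_rc gtr0_norm ?invr_gt0 ?exprn_gt0// exprMn mulrC; congr (_ * _).
  by rewrite exprVn -exprM mulnC exprM tN /r exprVn invrK.
have arg n v : cmod (rc (r n)^-1 * v) = cmod (w n) * cmod v.
  by rewrite cmodM cmod_rc gtr0_norm ?invr_gt0// /r invrK.
(* Divergence is impossible: at modulus 1/2 the minimality of w n gives |K|^N <= 2^W. In the
   constant case the value at modulus 1 yields |c| >= 1. *)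
have [s1 s1i [l|[c hc]]] := blow_up_dichotomy hK aK.
  have [|d d0 hd] := l (2%:R); first by rewrite cmod_nat.
  have [m0 /(_ m0 (leqnn _) _ (disc_center _ d0))] := hd (2 ^+ W + 1).
  rewrite leNgt => /negP; apply.
  have K2 : cmod (K (s1 m0) 2%:R^-1) ^+ N <= 2 ^+ W.
    have := outA (s1 m0) (rc (r (s1 m0))^-1 * 2%:R^-1).
    rewrite arg cmodV cmod_nat => /(_ _)/=.
    have w2 : cmod (w (s1 m0)) * 2^-1 < cmod (w (s1 m0)) by have := w0 (s1 m0); lra.
    move=> /(_ w2); rewrite exprMn mulrA -normK exprVn ler_pdivrMr ?exprn_gt0//.
    by rewrite mul1r.
  have [|K1] := leP (cmod (K (s1 m0) 2%:R^-1)) 1.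
    by move=> /le_lt_trans; apply; rewrite ltrDr exprn_gt0.
  apply: (@le_lt_trans _ _ (2 ^+ W)); last by rewrite ltrDl.
  by apply: le_trans K2; rewrite -[leLHS]expr1 ler_weXn2l// ltW.
have c1 : 1 <= cmod c.
  rewrite leNgt; apply/negP => c1; have e0 : 0 < 1 - cmod c by lra.
  have [m0 hm] := hc 1 _ e0.
  pose n := s1 m0; pose v := rc (r n) * w n.
  have v1 : cmod v = 1 by rewrite /v cmodM cmod_rc gtr0_norm// /r mulVf// gt_eqF.
  have k1 : cmod (K n v - c) < 1 - cmod c by apply: (hm m0 (leqnn _)); rewrite v1.
  have k2 : 1 <= cmod (K n v) ^+ N.
    rewrite normK /v mulrA -rcM mulVf ?gt_eqF// rc1 mul1r.
    by have [[_ h] _] := hw n.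
  have : cmod (K n v) < 1 by have := cmod_sub_ge (K n v) c; lra.
  move=> k3; move: k2; rewrite leNgt => /negP; apply; rewrite exprn_ilt1 ?cmod_ge0//.
  by rewrite -lt0n.
(* Since the limit c has modulus at least 1, phi has no zeros of modulus below 2 |w n|. *)
have [m0 nozero] := hc 2 _ ltr01.
have nz m v : (m0 <= m)%N -> cmod v < 2 * cmod (w (s1 m)) -> phi (s (n0 + s1 m)%N) v != 0.
  move=> mm vw; apply/eqP => v0; have := nozero m mm (rc (r (s1 m)) * v).
  rewrite eK mulrA -rcM mulVf ?gt_eqF// rc1 mul1r v0 mulr0 sub0r cmodN => h.
  have : cmod c < 1; last by lra.
  apply: h; rewrite cmodM cmod_rc gtr0_norm// /r mulrC ler_pdivrMr//; exact: ltW.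
have /choice[b hb] : forall m, exists b, cmod b <= rho / 2 /\ phi (s (n0 + s1 (m0 + m))%N) b = 0.
  by move=> m; have [b b1 b2] := hz (n0 + s1 (m0 + m))%N; exists b.
have bge m : 2 * cmod (w (s1 (m0 + m)%N)) <= cmod (b m).
  rewrite leNgt; apply/negP => /(nz _ _ (leq_addr _ _)); have [_ ->] := hb m.
  by rewrite eqxx.
have b0 m : 0 < cmod (b m) by apply: lt_le_trans (bge m); rewrite mulr_gt0.
pose r' m := (cmod (b m))^-1.
have r'0 m : 0 < r' m by rewrite invr_gt0.
pose s2 m := (n0 + s1 (m0 + m))%N.
have s2i : inc s2.
  by move=> i j ij; rewrite /s2 ltn_add2l; apply: s1i; rewrite ltn_add2l.
(* If the zeros b m stayed away from 0 along a subsequence, the points 1 / b m would accumulate at a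
   finite point, near which f tends to infinity. *)
have r'inf M : exists m0, forall n, (m0 <= n)%N -> M <= r' n.
  apply: contrapT => hn.
  have [s3 s3i h3] : exists2 s3, inc s3 & forall m, r' (s3 m) <= M.
    apply: (@extract_io (fun m => r' m <= M)) => m1; apply: contrapT => h.
    apply: hn; exists m1 => m mm; rewrite leNgt; apply/negP => hm.
    by apply: h; exists m => //; exact: ltW.
  have [|s4 s4i [l hl]] := @bw R (fun m => (b (s3 m))^-1) M.
    by move=> m; rewrite cmodV; exact: h3.
  have lb : rho^-1 < cmod l.
    apply: (@lt_le_trans _ _ (2 / rho)).
      by rewrite -[X in X < _]mul1r ltr_pM2r ?invr_gt0//; lra.
    apply: (cvc_ge hl); exists 0%N => m _ /=; rewrite cmodV -[leLHS]invrK invf_div.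
    by rewrite lef_pV2 ?posrE ?divr_gt0//; have [] := hb (s3 (s4 m)).
  have [d d0 hd] := linfy l lb; have [n1 h1] := hd 1; have [n2 h2] := hl _ d0.
  pose m := maxn n1 n2; have k2 := h2 m (leq_maxr _ _).
  have big : (n1 <= s2 (s3 (s4 m)))%N.
    apply: leq_trans (leq_maxl n1 n2) _; apply: leq_trans (inc_ge s4i _) _.
    by apply: leq_trans (inc_ge s3i _) _; exact: inc_ge s2i _.
  have /= := h1 _ big _ k2; rewrite invrK.
  by have [_] := hb (s3 (s4 m)); rewrite /s2 => ->; rewrite cmod0 ler10.
have [t' [K' [t'0 t'N eK' [hK' aK']]]] := blow_up (fun m => s (s2 m)) r'0 r'inf.
have zeroK' m : exists2 v, cmod v = 1 & K' m v = 0.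
  exists (rc (r' m) * b m).
    by rewrite cmodM cmod_rc gtr0_norm// mulVf// gt_eqF.
  rewrite eK' mulrA -rcM mulVf ?gt_eqF// rc1 mul1r.
  by have [_ ->] := hb m; rewrite mulr0.
have [s5 s5i [l|[c' hc']]] := blow_up_dichotomy hK' aK'.
  have [|m1 hm1] := linf_circle (r := 1) 1 l; first by move=> z ->.
  have [v v1 Kv] := zeroK' (s5 m1).
  have iv : cmod (v^-1) = 1 by rewrite cmodV v1 invr1.
  by have := hm1 m1 (leqnn _) _ iv; rewrite invrK Kv cmod0 ler10.
(* The second blow-up has a zero of modulus 1, so its constant limit is 0. At w n, which is closer
   to 0 than b m, this gives |phi|^N |b m|^W < 1, contrary to the definition of A. *)
have c'0 : cmod c' = 0.
  apply/eqP; rewrite eq_le cmod_ge0 andbT; apply/ler_addgt0Pr => e e0; rewrite add0r.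
  have [m1 hm1] := hc' 1 e e0; have [v v1 Kv] := zeroK' (s5 m1).
  have := hm1 m1 (leqnn _) v; rewrite v1 lexx Kv sub0r cmodN => /(_ isT); exact: ltW.
have [m1 hm1] := hc' 1 _ ltr01.
pose m := s5 m1; pose n := s1 (m0 + m)%N.
pose v := rc (r' m) * w n.
have v1 : cmod v <= 1.
  rewrite cmodM cmod_rc gtr0_norm// /r' mulrC ler_pdivrMr// mul1r.
  by apply: le_trans (bge m); have := w0 n; rewrite -/n; lra.
have k1 := hm1 m1 (leqnn _) v v1.
have {}k1 : cmod (K' m v) < 1 by have := cmod_sub_ge (K' m v) c'; move: k1; rewrite -/m; lra.
have k2 : cmod (K' m v) ^+ N = cmod (phi (s (n0 + n)%N) (w n)) ^+ N * cmod (b m) ^+ W.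
  rewrite eK' cmodM cmod_rc gtr0_norm ?invr_gt0 ?exprn_gt0// exprMn mulrC; congr (_ * _).
    by rewrite /v mulrA -rcM mulVf ?gt_eqF// rc1 mul1r.
  by rewrite exprVn -exprM mulnC exprM t'N /r' exprVn invrK.
have : cmod (K' m v) ^+ N < 1 by rewrite exprn_ilt1 ?cmod_ge0// -lt0n.
rewrite k2 ltNge => /negP; apply; have [[_ h] _] := hw n; apply: (le_trans h).
rewrite ler_wpM2l ?exprn_ge0 ?cmod_ge0//; apply: lerXn2r; rewrite ?nnegrE ?cmod_ge0//.
by apply: le_trans (bge m); have := w0 n; rewrite -/n; lra.
Qed.

(** A finite limit on |z| > 1 / rho bounds phi on a circle, hence by the maximum principle on the
    disc inside, and Montel applies. For an infinite limit the absence of zeros allows the maximum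
    principle for 1 / phi. *)
Theorem normal_at_infinity : exists2 s, inc s &
  (exists g, hluc (disc 0 (rho / 8)) (phi \o s) g) \/ linf (disc 0 (rho / 8)) (phi \o s).
Proof.
have rho0' := rho0; have ri : 0 < rho^-1 by rewrite invr_gt0.
have evad : ev_admissible (fun z => rho^-1 < cmod z) (fun n z => phi n z^-1).
  move=> p hp; have [d d0 hd] := @open_outside R rho^-1 p hp.
  by exists d => //; exists 0%N => n _; apply: admissible_sub (aphi n) => z; exact: hd.
have [s si [[g hg]|hl]] := admissible_normal hk hq0 (@open_outside R rho^-1) (pconnected_outside (ltW ri)) evad.
- have r2 : 0 < rho / 2 by rewrite divr_gt0.
  have r2r : rho / 2 < rho by lra.
  have [|n0 h0] := hluc_circle hg ltr01 (r := 2 / rho).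
    by move=> z ->; rewrite -[X in X < _]mul1r ltr_pM2r//; lra.
  have [M hM] := circle_bound r2 r2r (hphi (s n0)).
  pose M1 := Num.max (M + 2) 1; have M10 : 0 < M1 by rewrite lt_max ltr01 orbT.
  have bnd n z : disc 0 (rho / 2) z -> cmod (phi (s (n0 + n)%N) z) <= M1.
    rewrite /disc subr0 => zr; apply: (max_principle0 r2 r2r (hphi _)) (ltW zr) => v vr.
    have iv : cmod (v^-1) = 2 / rho by rewrite cmodV vr invf_div.
    have k1 := h0 _ (leq_addr n n0) _ iv; have k2 := h0 _ (leqnn _) _ iv; have k3 := hM v vr.
    rewrite /= invrK in k1 k2; rewrite le_max; apply/orP; left.
    have := cmod_sub_ge (phi (s (n0 + n)%N) v) (g v^-1).
    by have := cmod_sub_ge (g v^-1) (phi (s n0) v); rewrite (cmodBC (g _)); lra.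
  have hol n : holo (disc 0 (rho / 2)) (phi (s (n0 + n)%N)).
    by apply: holo_sub (hphi _) => z; apply: disc_le; exact: ltW.
  have [s' s'i [G hG]] := montel r2 M10 hol bnd.
  exists (fun n => s (n0 + s' n)%N).
    by move=> i j ij; apply: si; rewrite ltn_add2l; exact: s'i.
  left; exists G; apply: hluc_subset hG => z; apply: disc_le; lra.
- have [n0 nz] : exists n0, forall n, (n0 <= n)%N -> forall w, cmod w <= rho / 2 -> phi (s n) w != 0.
    apply: contrapT => hn.
    have [s' s'i hs'] : exists2 s', inc s' & forall n, exists2 w, cmod w <= rho / 2 & phi (s (s' n)) w = 0.
      apply: (@extract_io (fun n => exists2 w, cmod w <= rho / 2 & phi (s n) w = 0)) => n0.
      apply: contrapT => h; apply: hn; exists n0 => n nn w wr; apply/eqP => w0.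
      by apply: h; exists n => //; exists w.
    apply: (@no_zeros_near_infinity (s \o s')) => //; last exact: inc_comp.
    move=> p hp; have [d d0 hd] := hl p hp; exists d => // M; have [n0 h0] := hd M.
    by exists n0 => n nn; apply: h0; exact: leq_trans nn (inc_ge s'i n).
  exists s => //; right => p hp.
  have r4 : 0 < rho / 4 by rewrite divr_gt0.
  have r42 : rho / 4 < rho / 2 by lra.
  have [d d0 hd] := @disc_open R 0 (rho / 8) p hp; exists d => // M.
  pose M1 := Num.max M 1; have M10 : 0 < M1 by rewrite lt_max ltr01 orbT.
  have [|n1 h1] := linf_circle (r := 4 / rho) M1 hl.
    by move=> z ->; rewrite -[X in X < _]mul1r ltr_pM2r//; lra.
  exists (maxn n0 n1) => n; rewrite geq_max => /andP[nn0 nn1] z /hd zr.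
  have f0 w : disc 0 (rho / 2) w -> phi (s n) w != 0.
    by rewrite /disc subr0 => /ltW; exact: nz.
  have hol : holo (disc 0 (rho / 2)) (fun w => (phi (s n) w)^-1).
    by apply: holoV f0; apply: holo_sub (hphi _) => w; apply: disc_le; lra.
  have zr' : cmod z <= rho / 4 by move: zr; rewrite /disc subr0; lra.
  have : cmod ((phi (s n) z)^-1) <= M1^-1.
    apply: (max_principle0 r4 r42 hol) zr' => v vr.
    have iv : cmod (v^-1) = 4 / rho by rewrite cmodV vr invf_div.
    have := h1 n nn1 _ iv; rewrite /= invrK => k1.
    by rewrite cmodV lef_pV2 ?posrE//; apply: lt_le_trans k1.
  have fz : 0 < cmod (phi (s n) z) by rewrite cmod_gt0 f0// /disc subr0; lra.
  rewrite cmodV lef_pV2 ?posrE//; apply: le_trans; by rewrite le_max lexx.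
Qed.

End AtInfinity.

(** * The Riemann sphere *)

Section SphereTopology.
Variables (R : realType).
Local Notation C := (Cplx R).
Local Notation S := (sphere R).
Local Notation cder := (der (fun z : C => z)).
Local Notation ccont := (cont (fun z : C => z)).

Lemma nbhs_disc (z : C) (A : set C) : nbhs z A <-> exists2 d : R, 0 < d & forall w, disc z d w -> A w.
Proof.
have nE (w : C) : `|w| = (cmod w)%:C%C by case: w.
split=> [/nbhs_ballP[d /= d0 hd]|[d d0 hd]]; last first.
  apply/nbhs_ballP; exists d%:C%C => /=; first by rewrite ltcR.
  by move=> w; rewrite -ball_normE /= nE ltcR -/(disc _ _ _) => zw; apply: hd; rewrite /disc cmodBC.
move: d0; rewrite ltcE /= => /andP[/eqP id d0].
exists (complex.Re d) => // w wd; apply: hd; rewrite -ball_normE /= nE.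
rewrite (_ : d = (complex.Re d)%:C%C) ?ltcR 1?cmodBC//.
by move: id; case: (d) => x y /= ->.
Qed.

Lemma near_disc (z : C) (P : C -> Prop) :
  (\forall w \near z, P w) <-> exists2 d : R, 0 < d & forall w, disc z d w -> P w.
Proof. exact: nbhs_disc. Qed.

Lemma continuous_real_valued (f : C -> R) : (forall a b, `|f a - f b| <= cmod (a - b)) -> continuous f.
Proof.
move=> hf a A /nbhs_ballP[e /= e0 he]; apply/nbhs_disc; exists e => // w wa; apply: he.
by rewrite -ball_normE /=; apply: le_lt_trans (hf a w) _; rewrite cmodBC.
Qed.

Lemma compact_cmod_bounded (A : set C) : compact A -> exists M : R, forall z, A z -> cmod z <= M.
Proof.
move=> cA; have cf : continuous (@cmod R).
  apply: continuous_real_valued => a b; rewrite ler_norml; apply/andP; split.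
    by rewrite cmodBC; have := cmod_sub_ge b a; lra.
  exact: cmod_sub_ge.
have := continuous_compact (continuous_subspaceT cf) cA.
move=> /compact_bounded /= [M [Mr hM]]; exists (M + 1) => z Az.
have /= := hM (M + 1) ltac:(by rewrite ltrDl) (cmod z) (ex_intro2 _ _ z Az erefl).
by rewrite ger0_norm ?cmod_ge0.
Qed.

Lemma square_compact (M : R) : compact [set z : C | `|Re z| <= M /\ `|Im z| <= M].
Proof.
pose h (p : R * R) : C := Complex p.1 p.2.
have ch : continuous h.
  move=> [a b] A /nbhs_disc[d d0 hd]; have d2 : 0 < d / 2 by rewrite divr_gt0.
  exists (ball a (d / 2), ball b (d / 2)) => /=; first by split; exact: nbhsx_ballx.
  move=> [x y] [/= xa yb]; apply: hd; rewrite /disc.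
  apply: (le_lt_trans (cmod_le_ReIm _)); rewrite ReB ImB /=.
  by move: xa yb; rewrite -!ball_normE /= !(distrC _ x) !(distrC _ y); lra.
have := @continuous_compact _ _ h (`[- M, M] `*` `[- M, M]) (continuous_subspaceT ch)
  (compact_setX (@segment_compact R _ _) (@segment_compact R _ _)).
congr compact; apply/seteqP; split=> z /=.
  by move=> [[x y] [/= xM yM] <-] /=; move: xM yM; rewrite !in_itv /= -!ler_norml.
move=> [rz iz]; exists (Re z, Im z); last by case: (z).
by split; rewrite /= in_itv /= -ler_norml.
Qed.

Lemma nbhs_sphere_inv (w : C) (d : R) : 0 < d -> nbhs (sphere_inv w) [set sphere_inv v | v in disc w d].
Proof.
move=> d0; rewrite /sphere_inv; have [->|w0] := eqVneq w 0.
  (* Neighbourhoods of infinity come from complements of closed compact sets. The square is compact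
     as the image of a product of segments, and outside it |z| > 1 / d. *)
  exists [set z : C | `|Re z| <= d^-1 /\ `|Im z| <= d^-1].
    split; first exact: square_compact.
    by apply: compact_closed; [exact: norm_hausdorff|exact: square_compact].
  move=> [z|] /=; last by move=> _; exists 0; rewrite ?eqxx//; exact: disc_center.
  move=> [[z' nz [ez]]|//]; rewrite -{}ez.
  have zd : d^-1 < cmod z'.
    rewrite ltNge; apply/negP => zd; apply: nz; split; apply: le_trans zd.
      exact: Re_le_cmod.
    exact: Im_le_cmod.
  have z0 : 0 < cmod z' by apply: lt_trans zd; rewrite invr_gt0.
  exists (z'^-1); last by rewrite invr_eq0 -cmod_eq0 gt_eqF// invrK.
  rewrite /disc subr0 cmodV -[X in _ < X]invrK ltf_pV2 ?posrE ?invr_gt0//.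
have v0 : w^-1 != 0 by rewrite invr_eq0.
have [d1 d10 h1] := contV (cont_i (fun z : C => z) w^-1) v0 d0.
rewrite invrK in h1.
apply/nbhs_disc; exists (Num.min d1 (cmod w^-1)).
  by rewrite lt_min d10 cmod_gt0.
move=> z; rewrite /disc lt_min => /andP[z1 z2].
have z0 : z != 0 by rewrite -cmod_gt0; have := cmod_sub_ge w^-1 z; rewrite cmodBC; lra.
exists (z^-1); first exact: h1.
by rewrite invr_eq0 (negbTE z0) invrK.
Qed.

Lemma nbhs_Some (z : C) (d : R) : 0 < d -> nbhs (Some z : S) [set (Some v : S) | v in disc z d].
Proof.
move=> d0; apply: one_point_compactification_some_nbhs; apply/nbhs_disc.
by exists d.
Qed.

Lemma open_Some (D : set S) z : open D -> D (Some z) -> exists2 d : R, 0 < d &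
  forall w, disc z d w -> D (Some w).
Proof. by move=> oD Dz; have := open_nbhs_nbhs (conj oD Dz) => /nbhs_disc. Qed.

Lemma open_None (D : set S) : open D -> D None -> exists2 r : R, 0 < r &
  forall w, disc 0 r w -> D (sphere_inv w).
Proof.
move=> oD DN; have [K [cK _] KD] := open_nbhs_nbhs (conj oD DN).
have [M hM] := compact_cmod_bounded cK.
pose M1 := Num.max M 1; have M10 : 0 < M1 by rewrite lt_max ltr01 orbT.
exists M1^-1 => [|w]; first by rewrite invr_gt0.
rewrite /disc subr0 /sphere_inv => wM; have [//|w0] := eqVneq w 0.
apply: KD; left; exists (w^-1) => //= Kw.
have := hM _ Kw; rewrite leNgt => /negP; apply.
have wp : 0 < cmod w by rewrite cmod_gt0.
have MM : M <= M1 by rewrite le_max lexx.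
by apply: (le_lt_trans MM); rewrite cmodV -[X in X < _]invrK ltf_pV2 ?posrE ?invr_gt0.
Qed.

(** The union of the members that meet P and the union of those that meet its complement are open,
    cover D and are disjoint on D. *)
Lemma open_cover_connected (T : topologicalType) (D : set T) (G : nat -> Prop) (U : nat -> set T) :
  connected D -> (forall i, open (U i)) -> (forall x, D x -> exists2 i, G i & U i x) ->
  forall P : T -> Prop, (forall i x y, G i -> U i x -> U i y -> P x -> P y) ->
    forall x y, D x -> D y -> P x -> P y.
Proof.
move=> cD oU cov P hP x y Dx Dy Px.
pose V (Q : T -> Prop) := \bigcup_(i in [set i | G i /\ exists2 z, U i z & Q z]) U i.
have oV Q : open (V Q) by apply: bigcup_open => i _; exact: oU.
have VP z : V P z -> P z.
  by move=> [i [Gi [v Uv Pv]] Uz]; exact: hP Gi Uv Uz Pv.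
have PV Q z : D z -> Q z -> V Q z.
  by move=> /cov[i Gi Ui] Qz; exists i => //; split=> //; exists z.
pose B := D `&` V P.
have BD : B = D.
  apply: cD; first by exists x; split=> //; exact: PV.
    by exists (V P).
  exists (~` V (fun z => ~ P z)); first exact: open_closedC.
  apply/seteqP; split=> z [Dz hz]; split=> //.
    by move=> [i [Gi [v Uv nPv]] Uz]; apply: nPv; exact: hP Gi Uz Uv (VP z hz).
  by apply: (PV P) => //; apply: contrapT => nP; apply: hz; exact: (PV (fun z => ~ P z)).
have : B y by rewrite BD.
by move=> [_ /VP].
Qed.

Lemma chordal_ge0 (a b : S) : 0 <= chordal a b.
Proof. by case: a b => [z|] [w|] //=; rewrite ?divr_ge0 ?mulr_ge0 ?invr_ge0 ?sqrtr_ge0 ?cmod_ge0. Qed.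

Lemma sqrt_ge1 (z : C) : 1 <= Num.sqrt (1 + cmod z ^+ 2).
Proof. by rewrite -[leLHS]sqrtr1 ler_wsqrtr// lerDl sqr_ge0. Qed.

Lemma chordal_fin (z w : C) : chordal (Some z) (Some w) <= cmod (z - w).
Proof.
have := sqrt_ge1 z; have := sqrt_ge1 w => h1 h2.
rewrite /= ler_pdivrMr; last by rewrite mulr_gt0//; lra.
rewrite ler_peMr ?cmod_ge0//; apply: (le_trans h2); rewrite ler_peMr//; lra.
Qed.

Lemma chordal_inf (z : C) : 0 < cmod z -> chordal (Some z) None <= (cmod z)^-1.
Proof.
move=> z0; rewrite /= lef_pV2 ?posrE//; last by have := sqrt_ge1 z; lra.
rewrite -[leLHS]ger0_norm ?cmod_ge0// -sqrtr_sqr ler_wsqrtr//.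
by rewrite lerDr.
Qed.

Lemma spherical_dist_small (e : R) : 0 < e -> exists2 d : R, 0 < d &
  forall a b : S, chordal a b < d -> spherical_dist a b < e.
Proof.
move=> e0; have ca : {for (0 : R), continuous (@asin R)}.
  by apply: continuous_asin; rewrite ltr01 andbT ltrN10.
have a0 : asin (0 : R) = 0.
  rewrite -[X in asin X](@sin0 R) sinK// in_itv /=.
  by have := pi_gt0 R; lra.
have e2 : 0 < e / 2 by rewrite divr_gt0.
have [d /= d0 hd] := (nbhs_ballP _ _).1 (ca _ (nbhsx_ballx _ _ e2)).
exists d => // a b ab; have := hd (chordal a b); rewrite -!ball_normE /= sub0r normrN.
rewrite ger0_norm ?chordal_ge0// a0 sub0r normrN => /(_ ab) h.
by rewrite /spherical_dist; have := ler_norm (asin (chordal a b)); lra.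
Qed.

End SphereTopology.

(** * Gluing the finite charts and the chart at infinity *)

Section NormalityOnTheSphere.
Variables (R : realType) (k : nat) (q : nat -> nat).
Hypotheses (hk : (1 <= k)%N) (hq0 : (3 <= q 0%N)%N) (hqk : (1 <= q k)%N).
Local Notation C := (Cplx R).
Local Notation S := (sphere R).
Local Notation cder := (der (fun z : C => z)).
Local Notation admissible := (@admissible R k q).
Implicit Types (D : set S) (f : S -> C).

Lemma admissible_eq U (f g : C -> C) : open_set U -> (forall z, U z -> f z = g z) ->
  admissible U f -> admissible U g.
Proof.
move=> oU fg [hf zf pf]; have dE i z : U z -> derive1n i f z = derive1n i g z.
  exact: derive1n_eq.
split; first exact: holo_eq hf fg.
- by move=> z Uz gz i ik; rewrite -dE// zf// fg.
- move=> z Uz; rewrite (_ : dmon k q g z = dmon k q f z); first exact: pf.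
  by apply: eq_bigr => i _; rewrite dE.
Qed.

Lemma analytic_holo_Some D f : analytic_on D f -> holo (fun z => D (Some z)) (fun z => f (Some z)).
Proof. by move=> hf z Dz; eexists; exact: derivable_cder (hf (Some z) Dz). Qed.

Lemma sphere_inv_inv (z : C) : z != 0 -> sphere_inv z^-1 = Some z.
Proof. by move=> z0; rewrite /sphere_inv invr_eq0 (negbTE z0) invrK. Qed.

Lemma sphere_inv_neq0 (z : C) : z != 0 -> sphere_inv z = Some z^-1.
Proof. by move=> z0; rewrite /sphere_inv (negbTE z0). Qed.

Lemma sphere_inv0 : sphere_inv 0 = None :> S.
Proof. by rewrite /sphere_inv eqxx. Qed.

Lemma open_punctured : open_set (fun z : C => z != 0).
Proof. by move=> z; rewrite -cmod_gt0 => /open_outside[d d0 hd]; exists d => // w /hd; rewrite cmod_gt0. Qed.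

Lemma analytic_holo_None D f (r : R) : analytic_on D f ->
  (forall w, disc 0 r w -> D (sphere_inv w)) -> holo (disc 0 r) (fun w => f (sphere_inv w)).
Proof.
move=> hf hr w wr; have Dw := hr w wr; have [w0|w0] := eqVneq w 0.
  rewrite w0 sphere_inv0 in Dw *; eexists; exact: derivable_cder (hf None Dw).
rewrite sphere_inv_neq0// in Dw; have [l dl] := analytic_holo_Some hf Dw.
have dv := @der_comp R C (fun z => z) (fun z => f (Some z)) (fun z => z^-1) w _ _ dl
  (derV (@der_i R C (fun z => z) w) w0).
eexists; apply: (der_near dv); have [d d0 hd] := open_punctured w0.
by exists d => // v vd; rewrite sphere_inv_neq0// hd.
Qed.

Lemma diff_monomial_Some f z : diff_monomial k q f (Some z) = dmon k q (fun z => f (Some z)) z.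
Proof. by apply: eq_bigr => i _; congr (_ ^+ _); case: i. Qed.

(** [zeros_mult_ge] is silent about zeros of infinite order, but there f vanishes on a disc and so
    do all its derivatives. *)
Lemma zeros_mult_flat D f : open D -> analytic_on D f -> zeros_mult_ge D f k ->
  flat_zeros k (fun z => D (Some z)) (fun z => f (Some z)).
Proof.
move=> oD af zf a Da fa i ik; have [d d0 hd] := open_Some oD Da.
have hf : holo (disc a d) (fun z => f (Some z)) by apply: holo_sub (analytic_holo_Some af) => z /hd.
have oa := @disc_open R a d; have ca := disc_center a d0.
have [f0|[m [g [hg ga eg]]]] := zero_factor d0 hf.
  have [|/(_ i (ltnSn i))//] := @derive1n_factor R (disc a d) i.+1 (fun z => f (Some z)) (fun=> 0) a oa ca
    (holo_cst (U := disc a d) 0).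
  by move=> z /f0->; rewrite mulr0.
have [hj _] := derive1n_factor oa ca hg eg.
apply: hj; apply: leq_trans ik _; apply: (zf (Some a) m Da); split.
  rewrite lt0n; apply/eqP => m0; move: fa; rewrite eg// m0 expr0 mul1r => /eqP.
  by rewrite (negbTE ga).
exists g; split=> //; first by apply/near_disc; exists d => // z /hg[l]; exact: cder_derivable.
by apply/near_disc; exists d => // z /eg.
Qed.

Variables (D : set S) (u : nat -> S -> C).
Hypotheses (hD : is_domain D) (au : forall n, analytic_on D (u n))
  (zu : forall n, zeros_mult_ge D (u n) k)
  (du : forall n p, D p -> diff_monomial k q (u n) p <> 1).

Let oD : open D. Proof. by case: hD. Qed.

Lemma finite_admissible n : admissible (fun z => D (Some z)) (fun z => u n (Some z)).
Proof.
split; [exact: analytic_holo_Some|exact: zeros_mult_flat|].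
by move=> z Dz; rewrite -diff_monomial_Some; exact: du.
Qed.

Variable rho : R.
Hypotheses (rho0 : 0 < rho) (hrho : D None -> forall w, disc 0 rho w -> D (sphere_inv w)).

(* Chart 0 is a disc around infinity in the coordinate w = 1/z; the others are the
   finite discs with rational centres and radii. *)
Let chart (i : nat) : C -> S := if i is 0 then @sphere_inv R else Some.
Let V (i : nat) (z : C) : Prop := if i is i'.+1 then
    if unpickle i' is Some t then
      let t : rat * rat * rat := t in disc (Complex (ratr t.1.1) (ratr t.1.2) : C) (ratr t.2) z
    else False
  else disc 0 (rho / 8) z.
Let G (i : nat) : Prop := if i is 0 then D None else forall z, V i z -> D (Some z).
Let U (i : nat) : set S := [set chart i z | z in V i].
Let A i (s : nat -> nat) := exists g, hluc (V i) (fun n z => u (s n) (chart i z)) g.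
Let B i (s : nat -> nat) := linf (V i) (fun n z => u (s n) (chart i z)).

Lemma V_open i : open_set (V i).
Proof.
case: i => [|i]; first exact: disc_open.
by rewrite /V; case: unpickle => [t|]; [exact: disc_open|move=> z []].
Qed.

Lemma V_convex i : is_convex (V i).
Proof.
case: i => [|i]; first exact: disc_convex.
by rewrite /V; case: unpickle => [t|]; [exact: disc_convex|move=> z w t []].
Qed.

Lemma nbhs_chart i z d : 0 < d -> nbhs (chart i z) [set chart i w | w in disc z d].
Proof. by case: i => [|i]; [exact: nbhs_sphere_inv|exact: nbhs_Some]. Qed.

Lemma U_open i : open (U i).
Proof.
rewrite openE => _ [z Vz <-]; have [d d0 hd] := V_open Vz.
by apply: filterS (nbhs_chart i z d0) => _ [w wd <-]; exists w => //; exact: hd.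
Qed.

Lemma chart_cover x : D x -> exists2 i, G i & U i x.
Proof.
case: x => [z|] Dx.
  have [d d0 hd] := open_Some oD Dx; have [t [t1 t2]] := rat_disc z d0.
  exists (pickle t).+1; first by rewrite /G /V pickleK => w /t2 /hd.
  by exists z; [rewrite /V pickleK; exact: t1|reflexivity].
exists 0%N => //; exists 0; last exact: sphere_inv0.
by apply: disc_center; rewrite divr_gt0.
Qed.

Lemma inv_disc (w : C) : rho^-1 < cmod w -> w != 0 /\ disc 0 rho w^-1.
Proof.
have r0 := rho0; move=> wr; have w0 : 0 < cmod w by apply: lt_trans wr; rewrite invr_gt0.
split; first by rewrite -cmod_gt0.
by rewrite /disc subr0 cmodV -[X in _ < X]invrK ltf_pV2 ?posrE ?invr_gt0.
Qed.

Lemma chart_normal i s : G i -> inc s -> exists2 r, inc r & A i (s \o r) \/ B i (s \o r).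
Proof.
move=> Gi si; case: i => [|i] in Gi *.
  have hphi n : holo (disc 0 rho) (fun w => u (s n) (sphere_inv w)).
    exact: (@analytic_holo_None D (u (s n)) rho (@au (s n)) (hrho Gi)).
  have aphi n : admissible (fun z => rho^-1 < cmod z) (fun z => u (s n) (sphere_inv z^-1)).
    apply: (@admissible_eq _ (fun z => u (s n) (Some z))); first exact: open_outside.
      by move=> z /inv_disc[z0 _]; rewrite sphere_inv_inv.
    apply: admissible_sub (finite_admissible (s n)) => z /inv_disc[z0 zr].
    by rewrite -sphere_inv_inv//; exact: hrho.
  by have [r ri h] := normal_at_infinity hk hq0 hqk rho0 hphi aphi; exists r.
have ev : ev_admissible k q (V i.+1) (fun n z => u (s n) (Some z)).
  move=> p Vp; have [d d0 hd] := V_open Vp; exists d => //; exists 0%N => n _.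
  by apply: admissible_sub (finite_admissible (s n)) => z /hd /Gi.
have [r ri h] := admissible_normal hk hq0 (@V_open i.+1) (pconnected_convex (@V_convex i.+1)) ev.
by exists r.
Qed.

Lemma chart_limit i s z : A i s -> V i z -> exists l, cvc (fun n => u (s n) (chart i z)) l.
Proof. by move=> [g hg] Vz; exists (g z); exact: (hluc_pt hg Vz). Qed.

Lemma chart_disjoint i j x s : U i x -> U j x -> A i s -> B j s -> False.
Proof.
move=> [z Vz ez] [w Vw ew] /chart_limit/(_ Vz)[l hl] /(_ w Vw)[d d0 hd].
have [n0 h0] := hd (cmod l + 1); have [n1 h1] := hl _ ltr01.
pose n := maxn n0 n1; have := h1 n (leq_maxr _ _).
have := h0 n (leq_maxl _ _) w (disc_center w d0).
by rewrite ez ew; have := cmod_sub_ge (u (s n) x) l; lra.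
Qed.

(** Tying g to pointwise limits makes it independent of the chart in which the convergence is
    observed. *)
Lemma sphere_limit_analytic s (g : S -> C) :
  (forall x l, cvc (fun n => u (s n) x) l -> g x = l) ->
  (forall x, D x -> exists i, [/\ G i, U i x & A i s]) -> analytic_on D g.
Proof.
move=> hg cov p /cov[i [_ [z Vz ez] [g' hg']]].
have gE w : V i w -> g' w = g (chart i w).
  by move=> Vw; rewrite (hg _ _ (hluc_pt hg' Vw)).
have hol : holo (V i) (fun w => g (chart i w)).
  exact: holo_eq (@V_open i) (hluc_holo hg') gE.
case: i => [|i] in z Vz ez g' hg' gE hol *; last first.
  by rewrite -ez /=; have [l dl] := hol z Vz; exact: cder_derivable dl.
have [z0|z0] := eqVneq z 0.
  rewrite -ez z0 /chart sphere_inv0 /=; rewrite z0 in Vz.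
  by have [l dl] := hol 0 Vz; exact: cder_derivable dl.
(* Chart 0 also contains finite points; analyticity in z at these follows by composing with 1/z. *)
rewrite -ez /chart sphere_inv_neq0//=.
have zi0 : z^-1 != 0 by rewrite invr_eq0.
have [l dl] := hol z Vz; rewrite -[z]invrK in dl.
have dv := @der_comp R C (fun z => z) _ (fun z => z^-1) z^-1 _ _ dl
  (derV (@der_i R C (fun z => z) z^-1) zi0).
apply: cder_derivable; apply: (der_near dv); have [d d0 hd] := open_punctured zi0.
by exists d => // v vd; rewrite /chart sphere_inv_inv// hd.
Qed.

Lemma sphere_normal : exists2 s : nat -> nat, {homo s : i j / (i < j)%N} &
  let v n x : S := Some (u (s n) x) in
  (exists2 g, analytic_on D g & cvg_locally_spherically D v (fun x => Some (g x))) \/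
  cvg_locally_spherically D v (fun=> None).
Proof.
have [_ cD _] := hD.
have [||||||s si h] := @glue S D G U A B.
- by move=> i s t [g hg] ts; exists g; exact: (@hluc_esub R (V i) (fun n z => u n (chart i z)) g s t).
- by move=> i s t; exact: (@linf_esub R (V i) (fun n z => u n (chart i z)) s t).
- by move=> i s; exact: chart_normal.
- by move=> i j x s _; exact: chart_disjoint.
- exact: chart_cover.
- by apply: open_cover_connected cD _ chart_cover => i; exact: U_open.
exists s => //=; case: h => cov; [left|right].
  have /choice[g hg] : forall x, exists l, forall l', cvc (fun n => u (s n) x) l' -> l = l'.
    move=> x; have [[l hl]|n] := pselect (exists l, cvc (fun n => u (s n) x) l).
      by exists l => l' hl'; exact: cvc_uniq hl hl'.
    by exists 0 => l' hl'; case: n; exists l'.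
  exists g; first exact: sphere_limit_analytic hg cov.
  move=> p /cov[i [_ [z Vz <-] [g' hg']]].
  have [d [d0 _ uc]] := hg' z Vz; have [d' d'0 hd'] := V_open Vz.
  have d''0 : 0 < Num.min d d' by rewrite lt_min d0.
  exists [set chart i w | w in disc z (Num.min d d')]; first exact: nbhs_chart.
  move=> e /spherical_dist_small[e' e'0 he]; have [n0 h0] := uc _ e'0.
  exists n0 => n nn _ [w + <-] _; rewrite /disc lt_min => /andP[w1 w2].
  apply: he; apply: (le_lt_trans (chordal_fin _ _)).
  by rewrite (hg _ _ (hluc_pt hg' (hd' _ w2))); exact: h0.
move=> p /cov[i [_ [z Vz <-] li]]; have [d d0 hd] := li z Vz.
exists [set chart i w | w in disc z d]; first exact: nbhs_chart.
move=> e /spherical_dist_small[e' e'0 he]; have [n0 h0] := hd (2 / e').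
exists n0 => n nn _ [w wd <-] _; apply: he.
have k1 := h0 n nn w wd; have p0 : 0 < 2 / e' by rewrite divr_gt0.
have u0 : 0 < cmod (u (s n) (chart i w)) by apply: lt_le_trans k1.
apply: (le_lt_trans (chordal_inf u0)); apply: (@le_lt_trans _ _ (2 / e')^-1).
  by rewrite lef_pV2 ?posrE.
by rewrite invf_div; lra.
Qed.

End NormalityOnTheSphere.

Theorem theorem5p1 (R : realType) (D : set (sphere R)) (hD : is_domain D)
  (F : set (sphere R -> Cplx R)) (hF : forall f, F f -> analytic_on D f)
  (k : nat) (q : nat -> nat)
  (hk : (1 <= k)%N) (hq0 : (3 <= q 0%N)%N) (hqk : (1 <= q k)%N)
  (hmult : forall f, F f -> zeros_mult_ge D f k)
  (hne1 : forall f, F f -> forall p, D p -> diff_monomial k q f p <> 1) :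
  normal_family D F.
Proof.
move=> u hu; have [oD _ _] := hD.
have [rho [rho0 hrho]] : exists rho : R, 0 < rho /\
    (D None -> forall w, disc 0 rho w -> D (sphere_inv w)).
  (* The radius only matters when infinity belongs to D; otherwise 1 is a default. *)
  have [DN|nDN] := pselect (D None); last by exists 1.
  by have [r r0 hr] := open_None oD DN; exists r.
exact: (sphere_normal hk hq0 hqk hD (fun n => hF _ (hu n)) (fun n => hmult _ (hu n))
  (fun n => hne1 _ (hu n)) rho0 hrho).
Qed.
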